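(* Let $\mathfrak g=\mathfrak{sp}(2r)$, $r\geq3$ (type $\mathrm C_r$), let $\lambda$ be a dominant integral weight, and put $\boldsymbol\Lambda=(\lambda,\omega_1)$, $\boldsymbol z=(0,1)$. Let $\boldsymbol l$ be of the form $(\underbrace{1,\dots,1}_{k_1},0,\dots,0)$ with $0\leq k_1\leq r$, or $(\underbrace{1,\dots,1}_{k_2},2,\dots,2,1)$ with $0\leq k_2\leq r-2$, and let $l=l_1+\dots+l_r$. If $\boldsymbol l$ is not admissible then the Bethe ansatz equation associated to $\boldsymbol\Lambda,\boldsymbol z,\boldsymbol l$ has no solutions. If $\boldsymbol l$ is admissible then it has exactly one solution, represented by the following $r$-tuple $\boldsymbol y^{(l)}$ (empty sums are $0$, empty products are $1$). (i) For $l=0,\dots,r-1$: $\boldsymbol y^{(l)}=(x-c_1^{(l)},\dots,x-c_l^{(l)},1,\dots,1)$ with $$c_j^{(l)}=\prod_{i=1}^j\frac{\lambda_i+\dots+\lambda_l+l-i}{\lambda_i+\dots+\lambda_l+l-i+1}.$$ (ii) For $l=r$: $\boldsymbol y^{(r)}=(x-c_1^{(r)},\dots,x-c_r^{(r)})$ with $$c_j^{(r)}=\prod_{i=1}^{j}\frac{\lambda_i+\dots+\lambda_{r-1}+2\lambda_r+r+1-i}{\lambda_i+\dots+\lambda_{r-1}+2\lambda_r+r+2-i}\quad(1\leq j\leq r-1),\qquad c_r^{(r)}=\frac{\lambda_r}{\lambda_r+1}\,c_{r-1}^{(r)}.$$ (iii) For $l=r+1,\dots,2r-1$: $$\boldsymbol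 y^{(l)}=\big(x-c_1^{(l)},\dots,x-c_{2r-l-1}^{(l)},\,(x-a_{2r-l}^{(l)})(x-b_{2r-l}^{(l)}),\dots,(x-a_{r-1}^{(l)})(x-b_{r-1}^{(l)}),\,x-c_r^{(l)}\big).$$ Write $$p_i=\sum_{m=i}^{2r-1-l}\lambda_m+2\sum_{m=2r-l}^{r}\lambda_m+l+1-i,\qquad P_i=\frac{p_i}{p_i+1}\qquad(1\leq i\leq 2r-l-1),$$ $$q_i=\sum_{m=2r-l}^{i}\lambda_m+2\sum_{m=i+1}^{r}\lambda_m+l-i,\qquad Q_i=\frac{q_i}{q_i+1}\qquad(2r-l\leq i\leq r),$$ $$\rho_i=\sum_{m=2r-l}^{i}\lambda_m+l+i-2r,\qquad R_i=\frac{\rho_i}{\rho_i+1}\qquad(2r-l\leq i\leq r),$$ $$M=2\sum_{m=2r-l}^{r}\lambda_m+2l-2r.$$ Then $c_j^{(l)}=\prod_{i=1}^jP_i$ for $1\leq j\leq 2r-l-1$, $\;c_r^{(l)}=\prod_{i=1}^{2r-l-1}P_i\prod_{i=2r-l}^rQ_i$, and for $k=2r-l,\dots,r-1$ $$a_k^{(l)}b_k^{(l)}=\Big(\prod_{i=1}^{2r-l-1}P_i\Big)^2\ \prod_{i=2r-l}^{k-1}Q_i\ \prod_{i=2r-l}^{r}Q_i\ \prod_{i=k}^{r}R_i,$$ $$a_k^{(l)}+b_k^{(l)}=\prod_{i=1}^{2r-l-1}P_i\ \prod_{i=2r-l}^{k-1}Q_i\ \Big(\frac{M}{M+1}+\frac{M+2}{M+1}\prod_{i=k}^rQ_i\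 \prod_{i=k}^rR_i\Big).$$
   Context: Type $\mathrm C_r$ conventions: simple roots $\alpha_1,\dots,\alpha_r$ (standard numbering, $\alpha_r$ long), coroots $\alpha_i^\vee$, fundamental weights $\omega_i$ with $\langle\omega_j,\alpha_i^\vee\rangle=\delta_{ij}$. The invariant form on $\mathfrak h^*$ is normalized by $(\alpha_i,\alpha_i)=2$ for $i<r$ and $(\alpha_r,\alpha_r)=4$ (so $(\alpha_i,\alpha_{i+1})=-1$ for $i<r-1$, $(\alpha_{r-1},\alpha_r)=-2$); $\langle\lambda,\alpha_i^\vee\rangle=2(\lambda,\alpha_i)/(\alpha_i,\alpha_i)$, $\lambda_i=\langle\lambda,\alpha_i^\vee\rangle$. $V_\mu$ is the irreducible module of highest weight $\mu$. Bethe ansatz equation. Given weights $\boldsymbol\Lambda=(\Lambda_1,\dots,\Lambda_n)$, distinct complex numbers $\boldsymbol z=(z_1,\dots,z_n)$ and nonnegative integers $\boldsymbol l=(l_1,\dots,l_r)$, let $l=l_1+\dots+l_r$, and let $c:\{1,\dots,l\}\to\{1,\dots,r\}$ be the non-decreasing function with $\#c^{-1}(i)=l_i$. The Bethe ansatz equation associated to $\boldsymbol\Lambda,\boldsymbol z,\boldsymbol l$ is the system for $\boldsymbol t=(t_1,\dots,t_l)\in\mathbb C^l$ $$-\sum_{s=1}^n\frac{(\alpha_{c(i)},\Lambda_s)}{t_i-z_s}+\sum_{j\ne i}\frac{(\alpha_{c(i)},\alpha_{c(j)})}{t_i-t_j}=0,\qquad i=1,\dots,l,$$ where terms with zero numerator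 are omitted and all denominators with nonzero numerator are required to be nonzero. Solutions that differ by a permutation of coordinates preserving $c$ are identified. A solution $\boldsymbol t$ is represented by the $r$-tuple $\boldsymbol y=(y_1,\dots,y_r)$, $y_i(x)=\prod_{j:\,c(j)=i}(x-t_j)$. Admissibility. The tuple $\boldsymbol l$ is admissible if $V_{\lambda+\omega_1-\sum_i l_i\alpha_i}$ is a summand of $V_\lambda\otimes V_{\omega_1}$. For tuples of the form in the claim the length $l$ determines the tuple, and the tuple is admissible iff $l=0$, or $1\leq l\leq r$ and $\lambda_l>0$, or $r<l\leq 2r-1$ and $\lambda_{2r-l}>0$. *)

(* Defs.v *)
From HB Require Import structures.
From mathcomp Require Import all_boot all_order all_fingroup all_algebra.
From mathcomp.real_closed Require Import mxtens.

Set Implicit Arguments.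
Unset Strict Implicit.
Unset Printing Implicit Defensive.

Import Order.TTheory GRing.Theory Num.Theory.

Local Open Scope ring_scope.

(** * The root system C_r

    h^* is 'rV_r with the orthonormal basis eps_1, ..., eps_r for the invariant
    form: alpha_i = eps_i - eps_(i+1) for i < r and alpha_r = 2 eps_r, which
    gives the normalization (alpha_i, alpha_i) = 2 for i < r and
    (alpha_r, alpha_r) = 4.  Indices of eps, alpha, omega, labels and colours
    are natural numbers starting from 1. *)

Section RootSystem.
Variables (K : fieldType) (r : nat).
Implicit Types u v lam : 'rV[K]_r.

Definition form u v : K := \sum_(j < r) u 0 j * v 0 j.

Definition eps (i : nat) : 'rV[K]_r := \row_(j < r) (j.+1 == i)%:R.

Definition alpha (i : nat) : 'rV[K]_r :=
  if i == r then eps r *+ 2 else eps i - eps i.+1.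

Definition omega (i : nat) : 'rV[K]_r := \sum_(1 <= j < i.+1) eps j.

(* <lam, alpha_i^vee> *)
Definition label lam (i : nat) : K :=
  2%:R * form lam (alpha i) / form (alpha i) (alpha i).

Definition dominant_integral lam : Prop :=
  forall i : nat, (1 <= i <= r)%N -> exists m : nat, label lam i = m%:R.

End RootSystem.

Arguments eps {K r} i.
Arguments alpha {K r} i.
Arguments omega {K r} i.

Section RootSystemFacts.
Variables (K : fieldType) (r : nat).
Implicit Types u v w : 'rV[K]_r.

Lemma formC u v : form u v = form v u.
Proof. by apply: eq_bigr => j _; rewrite mulrC. Qed.

Lemma formDl u v w : form (u + v) w = form u w + form v w.
Proof. by rewrite -big_split; apply: eq_bigr => j _; rewrite mxE mulrDl. Qed.

Lemma formNl u w : form (- u) w = - form u w.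
Proof. by rewrite -sumrN; apply: eq_bigr => j _; rewrite mxE mulNr. Qed.

Lemma formBl u v w : form (u - v) w = form u w - form v w.
Proof. by rewrite formDl formNl. Qed.

Lemma formBr u v w : form w (u - v) = form w u - form w v.
Proof. by rewrite !(formC w) formBl. Qed.

Lemma formMnl u w n : form (u *+ n) w = form u w *+ n.
Proof. by rewrite -sumrMnl; apply: eq_bigr => j _; rewrite mulmxnE mulrnAl. Qed.

Lemma formMnr u w n : form w (u *+ n) = form w u *+ n.
Proof. by rewrite !(formC w) formMnl. Qed.

Lemma form_eps (i j : nat) : (1 <= i <= r)%N ->
  form (eps i) (eps j : 'rV[K]_r) = (i == j)%:R.
Proof.
case: i => // i ir; rewrite /form (bigD1 (Ordinal (ir : (i < r)%N))) //= !mxE eqxx mul1r.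
rewrite big1 ?addr0 // => k; rewrite -val_eqE /= => /negPf ki.
by rewrite !mxE eqSS ki mul0r.
Qed.

Lemma form_alpha_short (i : nat) : (1 <= i < r)%N ->
  form (alpha i) (alpha i : 'rV[K]_r) = 2%:R.
Proof.
move=> /andP[i1 ir]; have i1r : (1 <= i <= r)%N by rewrite i1 ltnW.
rewrite /alpha (ltn_eqF ir) formBl !formBr !form_eps // !eqxx.
by rewrite (gtn_eqF (ltnSn i)) (ltn_eqF (ltnSn i)) subr0 sub0r opprK -natrD.
Qed.

Lemma form_alpha_long : (0 < r)%N -> form (alpha r) (alpha r : 'rV[K]_r) = 4%:R.
Proof.
move=> r0; have r1r : (1 <= r <= r)%N by rewrite r0 leqnn.
by rewrite /alpha eqxx formMnl formMnr form_eps // eqxx -mulrnA.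
Qed.

Lemma form_alpha_next (i : nat) : (1 <= i)%N -> (i.+1 < r)%N ->
  form (alpha i) (alpha i.+1 : 'rV[K]_r) = - 1.
Proof.
move=> i1 ir; have ir' := ltnW ir.
have i1r : (1 <= i <= r)%N by rewrite i1 ltnW.
rewrite /alpha (ltn_eqF ir) (ltn_eqF ir') formBl !formBr !form_eps // eqxx.
by rewrite !ltn_eqF // subrr subr0 sub0r.
Qed.

Lemma form_alpha_last (i : nat) : (1 <= i)%N -> i.+1 = r ->
  form (alpha i) (alpha r : 'rV[K]_r) = - 2%:R.
Proof.
move=> i1 ir; have i_lt_r : (i < r)%N by rewrite -ir.
have i1r : (1 <= i <= r)%N by rewrite i1 ltnW.
have r1r : (1 <= r <= r)%N by rewrite leqnn andbT -ir.
rewrite /alpha eqxx (ltn_eqF i_lt_r) ir formMnr formBl !form_eps // eqxx.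
by rewrite (ltn_eqF i_lt_r) sub0r mulNrn.
Qed.

Lemma form_alpha_far (i j : nat) : (1 <= i)%N -> (i.+1 < j <= r)%N ->
  form (alpha i) (alpha j : 'rV[K]_r) = 0.
Proof.
move=> i1 /andP[ij jr].
have ir : (i < r)%N by apply: leq_trans jr; apply: ltnW.
have i1r : (1 <= i <= r)%N by rewrite i1 ltnW.
have Hij (k : nat) : (i.+1 < k)%N -> form (alpha i) (eps k : 'rV[K]_r) = 0.
  move=> ik; rewrite /alpha (ltn_eqF ir) formBl !form_eps //.
  by rewrite (ltn_eqF ik) (ltn_eqF (ltnW ik)) subrr.
rewrite [alpha j]/alpha; case: eqP => [jE|_]; first by rewrite formMnr Hij -?jE ?mul0rn.
by rewrite formBr !Hij ?subrr // ltnW.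
Qed.

Lemma label_omega (i j : nat) : 2%:R != 0 :> K ->
  (1 <= i <= r)%N -> (1 <= j <= r)%N ->
  label (omega j : 'rV[K]_r) i = (i == j)%:R.
Proof.
move=> nz2 i1r j1r; have [i1 ir] := andP i1r; have [j1 jr] := andP j1r.
have omegaE (k : nat) : (1 <= k <= r)%N ->
    form (omega j) (eps k : 'rV[K]_r) = (k <= j)%:R.
  case: k => // k k1r; rewrite /form (bigD1 (Ordinal (k1r : (k < r)%N))) //= big1; last first.
    by move=> m; rewrite -val_eqE [X in _ * X]mxE eqSS => /= /negPf->; rewrite mulr0.
  rewrite mxE eqxx mulr1 addr0 /omega summxE.
  under eq_bigr do rewrite mxE.
  case: (leqP k.+1 j) => kj.
    rewrite (bigD1_seq k.+1) ?iota_uniq ?mem_index_iota ?ltnS //= eqxx big1 ?addr0 //.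
    by move=> m mk; rewrite eq_sym (negPf mk).
  rewrite big_nat big1 // => m /andP[_ mj].
  by rewrite gtn_eqF // (leq_trans mj).
case: (ltngtP i r) ir (i1r) => [ir|//|irE] _ i1r'.
  rewrite /label form_alpha_short ?i1 // mulrAC divff // mul1r.
  rewrite /alpha (ltn_eqF ir) formBr !omegaE //.
  by case: (ltngtP i j) => _; rewrite ?subrr ?subr0.
have alphaE : alpha i = eps i *+ 2 :> 'rV[K]_r by rewrite /alpha irE eqxx.
rewrite /label alphaE !(formMnl, formMnr) form_eps // eqxx omegaE //.
have simp (x : K) : 2%:R * (x *+ 2) / (1 *+ 2 *+ 2) = x.
  rewrite -[x *+ 2]mulr_natl -[1 *+ 2 *+ 2]mulr_natl mulrA [_ * x]mulrC.
  by rewrite -mulrA divff ?mulr1 // mulf_neq0.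
have ji : (j <= i)%N by rewrite irE.
by rewrite simp eqn_leq ji andbT.
Qed.

End RootSystemFacts.

(** * Modules over sp(2r)

    sp(2r) consists of the matrices X with X^T J + J X = 0, where
    J = [0, 1; -1, 0].  Its Cartan subalgebra is formed by the matrices
    diag(d, -d), and eps_j maps diag(d, -d) to d_j.  A module of dimension n is
    a map from matrices to 'M_n acting on column vectors, of which only the
    values on sp(2r) matter. *)

Section SymplecticModules.
Variables (K : fieldType) (r : nat).

Definition symp_form : 'M[K]_(r + r) := block_mx 0 1%:M (- 1%:M) 0.

Definition in_sp (X : 'M[K]_(r + r)) : Prop :=
  X^T *m symp_form + symp_form *m X = 0.

Lemma in_sp_block (A B C : 'M[K]_r) : B^T = B -> C^T = C ->
  in_sp (block_mx A B C (- A^T)).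
Proof.
move=> BT CT; rewrite /in_sp /symp_form tr_block_mx !mulmx_block.
have NT : (- A^T)^T = - A by apply/matrixP => i j; rewrite !mxE.
rewrite NT BT CT !(mulmx0, mul0mx, mulmx1, mul1mx, mulNmx, mulmxN).
by rewrite !(add0r, addr0) add_block_mx opprK addNr !subrr block_mx0.
Qed.

Definition cartan (d : 'rV[K]_r) : 'M[K]_(r + r) :=
  block_mx (diag_mx d) 0 0 (- diag_mx d).

(* the matrix unit E_(i,j), with i and j starting from 1 *)
Definition elem_mx (i j : nat) : 'M[K]_r :=
  \matrix_(a < r, b < r) ((a.+1 == i) && (b.+1 == j))%:R.

(* the Chevalley generator e_i, of weight alpha i *)
Definition raising (i : nat) : 'M[K]_(r + r) :=
  if i == r then block_mx 0 (elem_mx r r) 0 0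
  else block_mx (elem_mx i i.+1) 0 0 (- elem_mx i.+1 i).

Lemma cartan_in_sp (d : 'rV[K]_r) : in_sp (cartan d).
Proof.
have := @in_sp_block (diag_mx d) 0 0 (trmx0 _ _ _) (trmx0 _ _ _).
by rewrite tr_diag_mx.
Qed.

Lemma raising_in_sp (i : nat) : in_sp (raising i).
Proof.
have tr_elem j k : (elem_mx j k)^T = elem_mx k j.
  by apply/matrixP => a b; rewrite !mxE andbC.
rewrite /raising; case: eqP => _; last first.
  have := @in_sp_block (elem_mx i i.+1) 0 0 (trmx0 _ _ _) (trmx0 _ _ _).
  by rewrite tr_elem.
have := @in_sp_block 0 (elem_mx r r) 0 (tr_elem r r) (trmx0 _ _ _).
by rewrite trmx0 oppr0.
Qed.

Definition is_rep (n : nat) (rho : 'M[K]_(r + r) -> 'M[K]_n) : Prop :=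
  (forall (a : K) X Y, in_sp X -> in_sp Y ->
     rho (a *: X + Y) = a *: rho X + rho Y) /\
  (forall X Y, in_sp X -> in_sp Y ->
     rho (X *m Y - Y *m X) = rho X *m rho Y - rho Y *m rho X).

Definition irreducible_rep (n : nat) (rho : 'M[K]_(r + r) -> 'M[K]_n) : Prop :=
  (0 < n)%N /\
  forall W : {vspace 'cV[K]_n},
    (forall X v, in_sp X -> v \in W -> rho X *m v \in W) ->
    W = 0%VS \/ W = fullv.

Definition highest_weight_vector (n : nat) (rho : 'M[K]_(r + r) -> 'M[K]_n)
    (mu : 'rV[K]_r) (v : 'cV[K]_n) : Prop :=
  [/\ v != 0,
      forall d, rho (cartan d) *m v = (\sum_(j < r) mu 0 j * d 0 j) *: v &
      forall i : nat, (1 <= i <= r)%N -> rho (raising i) *m v = 0].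

(* rho is a model of V_mu *)
Definition is_V (mu : 'rV[K]_r) (n : nat) (rho : 'M[K]_(r + r) -> 'M[K]_n) : Prop :=
  [/\ is_rep rho, irreducible_rep rho & exists v, highest_weight_vector rho mu v].

Definition tensor_rep (m n : nat) (rho : 'M[K]_(r + r) -> 'M[K]_m)
    (sigma : 'M[K]_(r + r) -> 'M[K]_n) (X : 'M[K]_(r + r)) : 'M[K]_(m * n) :=
  rho X *t 1%:M + 1%:M *t sigma X.

(* the module sigma is isomorphic to a direct summand of tau *)
Definition is_summand (p n : nat) (sigma : 'M[K]_(r + r) -> 'M[K]_p)
    (tau : 'M[K]_(r + r) -> 'M[K]_n) : Prop :=
  exists (inj : 'M[K]_(n, p)) (proj : 'M[K]_(p, n)),
    [/\ proj *m inj = 1%:M,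
        forall X, in_sp X -> tau X *m inj = inj *m sigma X &
        forall X, in_sp X -> proj *m tau X = sigma X *m proj].

(* ls = [:: l_1; ...; l_r] *)
Definition admissible (lam : 'rV[K]_r) (ls : seq nat) : Prop :=
  let mu := lam + omega 1 - \sum_(1 <= i < r.+1) alpha i *+ nth 0%N ls i.-1 in
  exists (m n p : nat) (rho : 'M[K]_(r + r) -> 'M[K]_m)
      (sigma : 'M[K]_(r + r) -> 'M[K]_n) (tau : 'M[K]_(r + r) -> 'M[K]_p),
    [/\ is_V lam rho, is_V (omega 1) sigma, is_V mu tau &
        is_summand tau (tensor_rep rho sigma)].

End SymplecticModules.

(* the values c(1), ..., c(l) for ls = [:: l_1; ...; l_r] *)
Definition colors (ls : seq nat) : seq nat :=
  flatten [seq nseq (nth 0 ls i.-1) i | i <- iota 1 (size ls)]%N.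

Definition color (ls : seq nat) (j : 'I_(sumn ls)) : nat := nth 0%N (colors ls) j.

Lemma size_colors (ls : seq nat) : size (colors ls) = sumn ls.
Proof.
rewrite size_flatten /shape -map_comp -[in RHS](mkseq_nth 0%N ls) /mkseq.
rewrite -[1%N]addn0 iotaDl -map_comp.
by congr sumn; apply: eq_map => i /=; rewrite size_nseq.
Qed.

Lemma sorted_colors (ls : seq nat) : sorted leq (colors ls).
Proof.
suff path_c (f : nat -> nat) n m :
    path leq m (flatten [seq nseq (f i) i | i <- iota m n]).
  by rewrite (path_sorted (path_c _ _ _)).
elim: n m => //= n IHn m; rewrite cat_path.
have [-> ->] : path leq m (nseq (f m) m) /\ last m (nseq (f m) m) = m.
  by elim: (f m) => //= k [-> ->]; rewrite leqnn.
by apply: (path_le leq_trans _ (IHn m.+1)).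
Qed.

Lemma count_colors (ls : seq nat) (i : nat) : (1 <= i <= size ls)%N ->
  count_mem i (colors ls) = nth 0%N ls i.-1.
Proof.
move=> /andP[i1 il]; rewrite count_flatten -map_comp sumnE big_map.
rewrite (bigD1_seq i) ?iota_uniq ?mem_iota ?i1 ?add1n ?ltnS //= count_nseq /= eqxx mul1n.
by rewrite big1 ?addn0 // => j /negPf ji; rewrite count_nseq /= ji.
Qed.

Section BetheAnsatz.
Variables (K : fieldType) (r : nat).

Definition bethe_solution (n : nat) (Lam : n.-tuple 'rV[K]_r) (z : n.-tuple K)
    (ls : seq nat) (t : 'I_(sumn ls) -> K) : Prop :=
  forall i : 'I_(sumn ls),
    let a (s : 'I_n) := form (alpha (color i)) (tnth Lam s) in
    let b (j : 'I_(sumn ls)) := form (alpha (color i)) (alpha (color j) : 'rV[K]_r) in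
    [/\ forall s, a s != 0 -> t i != tnth z s,
        forall j, j != i -> b j != 0 -> t i != t j &
        - (\sum_(s < n | a s != 0) a s / (t i - tnth z s))
          + \sum_(j < sumn ls | (j != i) && (b j != 0)) b j / (t i - t j) = 0].

Definition same_up_to_perm (ls : seq nat) (t t' : 'I_(sumn ls) -> K) : Prop :=
  exists2 s : {perm 'I_(sumn ls)},
    forall j, color (s j) = color j & forall j, t' j = t (s j).

Definition y_poly (ls : seq nat) (t : 'I_(sumn ls) -> K) (i : nat) : {poly K} :=
  \prod_(j < sumn ls | color j == i) ('X - (t j)%:P).

End BetheAnsatz.

(** * The tuples y^(l)

    [L] is the sequence of labels lambda_1, ..., lambda_r; c_small, c_middle and
    c_large are the c_j^(l) for l < r, l = r and l > r. *)

Section Tuples.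
Variables (K : fieldType) (r : nat) (L : nat -> K) (l : nat).

Definition c_small (j : nat) : K :=
  \prod_(1 <= i < j.+1)
    ((\sum_(i <= m < l.+1) L m + l%:R - i%:R) /
     (\sum_(i <= m < l.+1) L m + l%:R - i%:R + 1)).

Definition c_middle_short (j : nat) : K :=
  \prod_(1 <= i < j.+1)
    ((\sum_(i <= m < r) L m + 2%:R * L r + r%:R + 1 - i%:R) /
     (\sum_(i <= m < r) L m + 2%:R * L r + r%:R + 2%:R - i%:R)).

Definition c_middle (j : nat) : K :=
  if j == r then L r / (L r + 1) * c_middle_short r.-1 else c_middle_short j.

(* The truncated subtraction is harmless: l > r only occurs with l <= 2r - 1. *)
Let d : nat := (2 * r - l)%N.

Definition p_ (i : nat) : K :=
  \sum_(i <= m < d) L m + 2%:R * (\sum_(d <= m < r.+1) L m) + l%:R + 1 - i%:R.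
Definition P_ (i : nat) : K := p_ i / (p_ i + 1).

Definition q_ (i : nat) : K :=
  \sum_(d <= m < i.+1) L m + 2%:R * (\sum_(i.+1 <= m < r.+1) L m) + l%:R - i%:R.
Definition Q_ (i : nat) : K := q_ i / (q_ i + 1).

Definition rho_ (i : nat) : K :=
  \sum_(d <= m < i.+1) L m + l%:R + i%:R - (2 * r)%:R.
Definition R_ (i : nat) : K := rho_ i / (rho_ i + 1).

Definition M_ : K :=
  2%:R * (\sum_(d <= m < r.+1) L m) + (2 * l)%:R - (2 * r)%:R.

Definition c_large (j : nat) : K :=
  if j == r then \prod_(1 <= i < d) P_ i * \prod_(d <= i < r.+1) Q_ i
  else \prod_(1 <= i < j.+1) P_ i.

Definition ab_prod (k : nat) : K :=
  (\prod_(1 <= i < d) P_ i) ^+ 2 * \prod_(d <= i < k) Q_ i *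
  \prod_(d <= i < r.+1) Q_ i * \prod_(k <= i < r.+1) R_ i.

Definition ab_sum (k : nat) : K :=
  \prod_(1 <= i < d) P_ i * \prod_(d <= i < k) Q_ i *
  (M_ / (M_ + 1) +
   (M_ + 2%:R) / (M_ + 1) *
     \prod_(k <= i < r.+1) Q_ i * \prod_(k <= i < r.+1) R_ i).

Definition is_y_tuple (y : nat -> {poly K}) : Prop :=
  if (l < r)%N then
    forall i, (1 <= i <= r)%N ->
      y i = if (i <= l)%N then 'X - (c_small i)%:P else 1
  else if l == r then
    forall i, (1 <= i <= r)%N -> y i = 'X - (c_middle i)%:P
  else
    exists a b : nat -> K,
      (forall k, (d <= k < r)%N ->
         a k * b k = ab_prod k /\ a k + b k = ab_sum k) /\
      (forall i, (1 <= i <= r)%N ->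
         y i = if (d <= i < r)%N then ('X - (a i)%:P) * ('X - (b i)%:P)
               else 'X - (c_large i)%:P).

End Tuples.

(* Main.v *)
(* A summand V_mu of V_lambda (x) V_omega1 has dominant mu, and for the tuples
   considered here mu = lambda + eps_k or lambda - eps_k is dominant iff the label
   lambda_d is positive, with d = l for l <= r and d = 2r - l for l > r (no
   condition for l = 0).  When it is, annihilation and creation operators on the
   exterior algebra of C^(2r), which transform like vectors of C^(2r) and relate
   the highest weight vectors of weights omega_k and omega_(k-1), produce a
   singular vector of weight mu in V_lambda (x) V_omega1.  All modules involved
   are *-representations, so that orthogonal complements of submodules are
   submodules and a singular vector generates what it should up to projection.

   The Bethe ansatz equation for l <= r is a chain, solved from color l downwards.
   For l > r the equations at the two roots of y_d say that there is a linear
   polynomial g_d with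
     (A + 1) y_d g_d + x (y_d - y_d' g_d) = A y_(d-1) y_(d+1),   A = lambda_d,
   i.e. the Wronskian of y_d and x^(A+1) g_d is proportional to
   x^A y_(d-1) y_(d+1).  In the remaining equations y_d may then be traded for g_d
   at the cost of reflecting lambda, and one goes on with y_(d+1), ..., y_(r-1).
   The linear polynomials so obtained satisfy a chain again, and its solution
   determines all y_k. *)

Require Import Defs.
From mathcomp Require Import all_boot all_order all_fingroup all_algebra.
From mathcomp Require Import reals boolp ring zify.
From mathcomp.real_closed Require Import complex mxtens.
(* sesquilinear.v shadows the invariant form *)
Import Defs.

Set Implicit Arguments.
Unset Strict Implicit.
Unset Printing Implicit Defensive.

Import Order.TTheory GRing.Theory Num.Theory.

Local Open Scope ring_scope.

(** * Unitarizable modules of sp(2r) and admissibility *)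

(** [admissible] asserts the existence of modules, so its positive direction must build them: a
    *-representation is projected onto an irreducible component in which a chosen highest weight
    vector survives. In the negative direction some label of mu equals -1, which sl2-theory
    excludes. In the equations the obstacle is that a root is kept away from 0 only where its label
    is nonzero, so roots at the origin have to be treated along the way. The reflected labels rho_k
    are positive, so every fraction e/(e+1) lies strictly between 0 and 1, and this supplies all the
    non-degeneracy. The constant M = 2 rho_r comes from color r: its root is rho_r/(rho_r+1) times
    the root g of g_(r-1), and it acts on color r-1 with factor 2, which makes this interaction at g
    equal to (M+2)/g. The same constant recurs at every lower color because rho_k + q_k = M, and it
    turns the g_k into a chain with effective labels q_k. The closed forms of the y_k are verified
    against the recursion. *)

Section StarReps.
Local Open Scope sesquilinear_scope.
Variables (C : numClosedFieldType) (r : nat).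
Implicit Types X Y : 'M[C]_(r + r).

Local Notation "B ^!" :=
  (orthomx Num.conj (mx_of_hermitian (hermitian1mx _)) B) : matrix_set_scope.
Local Notation J := (symp_form C r).

Lemma trmxC_mul m n p (A : 'M[C]_(m, n)) (B : 'M[C]_(n, p)) :
  (A *m B)^t* = B^t* *m A^t*.
Proof. by rewrite trmx_mul map_mxM. Qed.

Lemma trmxCD m n (A B : 'M[C]_(m, n)) : (A + B)^t* = A^t* + B^t*.
Proof. by rewrite linearD map_mxD. Qed.

Lemma trmxCB m n (A B : 'M[C]_(m, n)) : (A - B)^t* = A^t* - B^t*.
Proof. by rewrite linearB map_mxB. Qed.

Lemma trmxC1 n : (1%:M : 'M[C]_n)^t* = 1%:M.
Proof. by rewrite trmx1 map_mx1. Qed.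

Lemma symp_sqr : J *m J = - 1%:M.
Proof.
rewrite /symp_form mulmx_block !(mulmx0, mul0mx, mulmx1, mul1mx, mulNmx, mulmxN).
by rewrite !(add0r, addr0) -[RHS]scaleN1r scalar_mx_block scale_block_mx !scaler0 !scaleN1r.
Qed.

Lemma symp_tr : J^T = - J.
Proof.
rewrite /symp_form tr_block_mx -[RHS]scaleN1r scale_block_mx !scaleN1r.
by rewrite !(trmx0, oppr0, opprK) linearN /= !trmx1.
Qed.

Lemma symp_trC : J^t* = - J.
Proof.
rewrite symp_tr; apply/matrixP => i j; rewrite !mxE rmorphN; congr (- _).
by case: splitP => k _; rewrite !mxE; case: splitP => l _; rewrite !mxE ?rmorphN ?rmorph_nat ?rmorph0.
Qed.

(** This is the defining relation for [X^T], obtained by multiplying with [J] on both sides. Closure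
    under adjoints and the passage from C^(2r) to its dual rest on it. *)
Lemma in_spP X : in_sp X <-> X *m J = - (J *m X^T).
Proof.
have JK Z : J *m (J *m Z) = - Z by rewrite mulmxA symp_sqr mulNmx mul1mx.
have KJ Z : Z *m J *m J = - Z by rewrite -mulmxA symp_sqr mulmxN mulmx1.
rewrite /in_sp; split=> [/eqP|H].
  rewrite addr_eq0 => /eqP /(congr1 (fun Z => J *m Z *m J)).
  by rewrite mulmxA KJ mulmxN JK opprK => <-.
apply/eqP; rewrite addr_eq0; apply/eqP.
have /eqP := congr1 (fun Z => J *m Z *m J) H.
by rewrite mulmxN JK opprK mulmxA KJ => /eqP <-.
Qed.

Lemma in_sp_star X : in_sp X -> in_sp (X^t*).
Proof.
move/in_spP/(congr1 (fun Z => Z^t*)); rewrite trmxC_mul symp_trC => H.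
rewrite /in_sp.
have -> : X^t*^T = (X^T)^t* by apply/matrixP => i j; rewrite !mxE.
move/(congr1 (fun Z => - Z)): H.
rewrite mulNmx opprK => ->; rewrite -scaleN1r.
have -> : (- (J *m X^T))^t* = - (J *m X^T)^t*.
  by apply/matrixP => i j; rewrite !mxE rmorphN.
by rewrite scaleN1r opprK trmxC_mul symp_trC mulmxN subrr.
Qed.

(** Unitarizability: the compact real form acts by skew-Hermitian matrices. *)
Definition star_rep n (rho : 'M[C]_(r + r) -> 'M[C]_n) :=
  is_rep rho /\ forall X, in_sp X -> rho (X^t*) = (rho X)^t*.

Definition intertwines m n (rho : 'M[C]_(r + r) -> 'M[C]_m)
    (tau : 'M[C]_(r + r) -> 'M[C]_n) (T : 'M[C]_(n, m)) :=
  forall X, in_sp X -> T *m rho X = tau X *m T.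

(** Stability of the row space gives [U *m rho X = M *m U], and unitarity identifies [M] with the
    compression; [U] is then an intertwiner, from which multiplicativity follows. *)
Lemma star_rep_compress n k (rho : 'M[C]_(r + r) -> 'M[C]_n) (U : 'M[C]_(k, n)) :
  star_rep rho -> U \is unitarymx ->
  (forall X, in_sp X -> (U *m rho X <= U)%MS) ->
  let tau X := U *m rho X *m U^t* in star_rep tau /\ intertwines rho tau U.
Proof.
move=> [[lin br] st] /unitarymxP UU inv tau.
have tw : intertwines rho tau U.
  move=> X HX; have /submxP [M E] := inv X HX.
  by rewrite /tau E -(mulmxA M) UU mulmx1.
split=> //; split; first split.
- move=> a X Y HX HY; rewrite /tau lin // mulmxDr mulmxDl.
  by rewrite -scalemxAr -scalemxAl.
- move=> X Y HX HY; rewrite /tau br // mulmxBr mulmxBl.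
  have tw2 Z T : in_sp Z -> in_sp T ->
      U *m (rho Z *m rho T) *m U^t* = tau Z *m tau T.
    by move=> HZ HT; rewrite mulmxA tw // -(mulmxA (tau Z) U) -(mulmxA (tau Z)).
  by rewrite !tw2.
- by move=> X HX; rewrite /tau st // !trmxC_mul trmxCK -!mulmxA.
Qed.

(** Induction on the dimension: a proper submodule and its orthogonal complement give two smaller
    *-representations, and [v] cannot vanish in both. *)
Lemma irr_component n (rho : 'M[C]_(r + r) -> 'M[C]_n) (v : 'cV[C]_n) :
  star_rep rho -> v != 0 ->
  exists p (tau : 'M[C]_(r + r) -> 'M[C]_p) (T : 'M[C]_(p, n)),
    [/\ star_rep tau, irreducible_rep tau, intertwines rho tau T & T *m v != 0].
Proof.
elim/ltn_ind: n => n IHn in rho v *; move=> srho v0.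
case: (pselect (irreducible_rep rho)) => [irr|nirr].
  exists n, rho, 1%:M; split=> //; last by rewrite mul1mx.
  by move=> X _; rewrite mul1mx mulmx1.
have n0 : (0 < n)%N by case: (n) v v0 => // w; rewrite flatmx0 eqxx.
have [W [stW W0 Wf]] : exists W : {vspace 'cV[C]_n},
    [/\ forall X w, in_sp X -> w \in W -> rho X *m w \in W, W != 0%VS & W != fullv].
  apply: contrapT => nW; apply: nirr; split=> // W stW.
  have [|W0] := eqVneq W 0%VS; first by left.
  have [|Wf] := eqVneq W fullv; first by right.
  by case: nW; exists W.
(* [W] consists of columns whereas matrix spaces are row spaces; taking adjoints of a basis passes
   from one to the other. *)
pose V := \matrix_(i < \dim W) ((vbasis W)`_i)^t*.
have rowV i : row i V = ((vbasis W)`_i)^t* by rewrite rowK.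
have VW (u : 'rV_n) : (u <= V)%MS <-> u^t* \in W.
  split=> [/submxP [a ->]|uW].
    rewrite mulmx_sum_row; elim/big_ind: _ => [|x y xW yW|i _].
    + by rewrite trmx0 map_mx0 rpred0.
    + by rewrite trmxCD rpredD.
    + rewrite linearZ /= map_mxZ rowV trmxCK rpredZ //.
      by apply: vbasis_mem; rewrite mem_nth // size_tuple.
  rewrite -[u]trmxCK (coord_vbasis uW); elim/big_ind: _ => [|x y xW yW|i _].
  + by rewrite trmx0 map_mx0 sub0mx.
  + by rewrite trmxCD addmx_sub.
  + by rewrite linearZ /= map_mxZ scalemx_sub // -rowV row_sub.
(* A unitary matrix: the rows of [U1] span [V], those of [U2] its orthogonal complement. *)
pose U := schmidt_complete V.
pose U1 := usubmx U; pose U2 := dsubmx U.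
have UE : U = col_mx U1 U2 by rewrite vsubmxK.
have /unitarymxP := schmidt_complete_unitarymx V; rewrite -/U UE.
rewrite tr_col_mx map_row_mx mul_col_row scalar_mx_block => /eq_block_mx [U11 U12 U21 U22].
have UU : U1^t* *m U1 + U2^t* *m U2 = 1%:M.
  have := @mulmxKtV C _ _ _ 1%:M U (schmidt_complete_unitarymx V).
  move=> /(_ (add_rank_ortho V)); rewrite mul1mx UE tr_col_mx map_row_mx.
  by rewrite mul_row_col.
have U1V : (U1 :=: V)%MS.
  rewrite /U1 col_mxKu.
  by apply: eqmx_trans (eqmx_schmidt_free (row_base_free _)) (eq_row_base _).
have inv1 X : in_sp X -> (U1 *m rho X <= U1)%MS.
  move=> HX; apply/row_subP => i; rewrite U1V row_mul; apply/VW.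
  rewrite trmxC_mul -srho.2 //; apply: stW; first exact: in_sp_star.
  by apply/VW; rewrite -U1V row_sub.
(* The *-structure enters here: stability of [U1] under the adjoint of [X] kills the off-diagonal
   block of [rho X]. *)
have inv2 X : in_sp X -> (U2 *m rho X <= U2)%MS.
  move=> HX; rewrite -[X in (X <= _)%MS]mulmx1 -UU mulmxDr !mulmxA.
  have /submxP [M HM] := inv1 _ (in_sp_star HX).
  have -> : U2 *m rho X *m U1^t* = 0.
    rewrite -mulmxA -[rho X]trmxCK -srho.2 // -trmxC_mul HM trmxC_mul.
    by rewrite mulmxA U21 mul0mx.
  by rewrite mul0mx add0r submxMl.
have k1 : (0 < \rank V)%N.
  rewrite lt0n mxrank_eq0; apply: contraNneq W0 => V0.
  rewrite -subv0; apply/subvP => w wW; rewrite memv0.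
  have : (w^t* <= V)%MS by apply/VW; rewrite trmxCK.
  rewrite V0 => /submx0null /(congr1 (fun z => z^t*)).
  by rewrite trmxCK trmx0 map_mx0 => ->.
have k2 : (\rank V < n)%N.
  rewrite ltn_neqAle rank_leq_col andbT; apply: contraNneq Wf => Vn.
  rewrite eqEsubv subvf; apply/subvP => w _; rewrite -[w]trmxCK; apply/VW.
  by apply: submx_full; rewrite /row_full Vn.
have k3 : (\rank V^!%MS < n)%N by rewrite rank_ortho ltn_subrL k1.
have reduce k (T : 'M[C]_(k, n)) : (k < n)%N -> T *m T^t* = 1%:M ->
    (forall X, in_sp X -> (T *m rho X <= T)%MS) -> T *m v != 0 ->
    exists p (tau : 'M[C]_(r + r) -> 'M[C]_p) (T : 'M[C]_(p, n)),
    [/\ star_rep tau, irreducible_rep tau, intertwines rho tau T & T *m v != 0].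
  move=> kn /unitarymxP TT inv Tv.
  have [st tw] := star_rep_compress srho TT inv.
  have [p [tau [S [tau1 tau2 tau3 tau4]]]] := IHn _ kn _ _ st Tv.
  exists p, tau, (S *m T); split=> //; last by rewrite -mulmxA.
  by move=> X HX; rewrite -mulmxA tw // mulmxA tau3 // mulmxA.
have [U1v|] := eqVneq (U1 *m v) 0; last exact: reduce.
have [U2v|] := eqVneq (U2 *m v) 0; last exact: reduce.
by move: v0; rewrite -[v]mul1mx -UU mulmxDl -!mulmxA U1v U2v !mulmx0 addr0 eqxx.
Qed.

End StarReps.

(** * Tensor products of *-representations and the vector representation *)

Section TensorProducts.
Local Open Scope sesquilinear_scope.
Variables (C : numClosedFieldType) (r : nat).
Implicit Types X Y : 'M[C]_(r + r).

Local Notation J := (symp_form C r).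

Lemma tensmxDl m n p q (A B : 'M[C]_(m, n)) (D : 'M[C]_(p, q)) :
  (A + B) *t D = A *t D + B *t D.
Proof. by apply/matrixP => i j; rewrite !mxE mulrDl. Qed.

Lemma tensmxDr m n p q (A : 'M[C]_(m, n)) (B D : 'M[C]_(p, q)) :
  A *t (B + D) = A *t B + A *t D.
Proof. by apply/matrixP => i j; rewrite !mxE mulrDr. Qed.

Lemma tensmxZl m n p q a (A : 'M[C]_(m, n)) (D : 'M[C]_(p, q)) :
  (a *: A) *t D = a *: (A *t D).
Proof. by apply/matrixP => i j; rewrite !mxE mulrA. Qed.

Lemma tensmxZr m n p q a (A : 'M[C]_(m, n)) (D : 'M[C]_(p, q)) :
  A *t (a *: D) = a *: (A *t D).
Proof. by apply/matrixP => i j; rewrite !mxE mulrCA. Qed.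

Lemma tensmxBl m n p q (A B : 'M[C]_(m, n)) (D : 'M[C]_(p, q)) :
  (A - B) *t D = A *t D - B *t D.
Proof. by rewrite tensmxDl -scaleN1r tensmxZl scaleN1r. Qed.

Lemma tensmxBr m n p q (A : 'M[C]_(m, n)) (B D : 'M[C]_(p, q)) :
  A *t (B - D) = A *t B - A *t D.
Proof. by rewrite tensmxDr -scaleN1r tensmxZr scaleN1r. Qed.

Lemma tensmx_trC m n p q (A : 'M[C]_(m, n)) (D : 'M[C]_(p, q)) :
  (A *t D)^t* = A^t* *t D^t*.
Proof. by apply/matrixP => i j; rewrite !mxE rmorphM. Qed.

(** The Kronecker product has [1 * 1] columns, which is only convertible to [1]; the definition
    fixes the type of a column vector. *)
Definition vtens m n (v : 'cV[C]_m) (w : 'cV[C]_n) : 'cV[C]_(m * n) := v *t w.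

Lemma vtensE m n (v : 'cV[C]_m) (w : 'cV[C]_n) i j :
  vtens v w (mxtens_index (i, j)) 0 = v i 0 * w j 0.
Proof.
have e : mxtens_index (0 : 'I_1, 0 : 'I_1) = (0 : 'I_1) by apply: ord1.
by rewrite -(tensmxE v w i j 0 0) e.
Qed.

Lemma vtensP m n (u w : 'cV[C]_(m * n)) :
  (forall i j, u (mxtens_index (i, j)) 0 = w (mxtens_index (i, j)) 0) -> u = w.
Proof.
by move=> E; apply/colP => k; rewrite -(mxtens_unindexK k); case: (mxtens_unindex k).
Qed.

Lemma vtens_suml m n (I : finType) (x : I -> 'cV[C]_m) (w : 'cV[C]_n) :
  vtens (\sum_i x i) w = \sum_i vtens (x i) w.
Proof.
apply: vtensP => i j; rewrite vtensE !summxE mulr_suml.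
by apply: eq_bigr => k _; rewrite vtensE.
Qed.

Lemma vtens_sumr m n (I : finType) (v : 'cV[C]_m) (x : I -> 'cV[C]_n) :
  vtens v (\sum_i x i) = \sum_i vtens v (x i).
Proof.
apply: vtensP => i j; rewrite vtensE !summxE mulr_sumr.
by apply: eq_bigr => k _; rewrite vtensE.
Qed.

Lemma vtensZl m n a (v : 'cV[C]_m) (w : 'cV[C]_n) : vtens (a *: v) w = a *: vtens v w.
Proof. by apply: vtensP => i j; rewrite !(vtensE, mxE) mulrA. Qed.

Lemma vtensZr m n a (v : 'cV[C]_m) (w : 'cV[C]_n) : vtens v (a *: w) = a *: vtens v w.
Proof. by apply: vtensP => i j; rewrite !(vtensE, mxE) mulrCA. Qed.

Lemma vtensDl m n (u v : 'cV[C]_m) (w : 'cV[C]_n) :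
  vtens (u + v) w = vtens u w + vtens v w.
Proof. by apply: vtensP => i j; rewrite !(vtensE, mxE) mulrDl. Qed.

Lemma vtens0l m n (w : 'cV[C]_n) : vtens (0 : 'cV[C]_m) w = 0.
Proof. by apply: vtensP => i j; rewrite !(vtensE, mxE) mul0r. Qed.

Lemma vtens0r m n (v : 'cV[C]_m) : vtens v (0 : 'cV[C]_n) = 0.
Proof. by apply: vtensP => i j; rewrite !(vtensE, mxE) mulr0. Qed.

Lemma vtens_neq0 m n (v : 'cV[C]_m) (w : 'cV[C]_n) :
  v != 0 -> w != 0 -> vtens v w != 0.
Proof.
move=> /cV0Pn [i vi] /cV0Pn [j wj]; apply/cV0Pn; exists (mxtens_index (i, j)).
by rewrite vtensE mulf_neq0.
Qed.

Lemma vtens_act m n (rho : 'M[C]_(r + r) -> 'M[C]_m)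
    (sigma : 'M[C]_(r + r) -> 'M[C]_n) X v w :
  tensor_rep rho sigma X *m vtens v w =
    vtens (rho X *m v) w + vtens v (sigma X *m w).
Proof.
have E : tensor_rep rho sigma X *m (v *t w) =
    (rho X *m v) *t w + v *t (sigma X *m w).
  by rewrite /tensor_rep mulmxDl !tensmx_mul !mul1mx.
exact: E.
Qed.

Lemma star_rep_tensor m n (rho : 'M[C]_(r + r) -> 'M[C]_m)
    (sigma : 'M[C]_(r + r) -> 'M[C]_n) :
  star_rep rho -> star_rep sigma -> star_rep (tensor_rep rho sigma).
Proof.
move=> [[rho1 rho2] rho3] [[sigma1 sigma2] sigma3]; rewrite /tensor_rep.
split; first split.
- move=> a X Y HX HY; rewrite rho1 // sigma1 // tensmxDl tensmxDr tensmxZl tensmxZr.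
  by rewrite scalerDr addrACA.
- move=> X Y HX HY; rewrite rho2 // sigma2 // tensmxBl tensmxBr.
  rewrite !mulmxDl !mulmxDr !tensmx_mul !mul1mx !mulmx1.
  set a := rho X *m rho Y *t _; set b := rho Y *m rho X *t _.
  set c := _ *t (sigma X *m _); set d := _ *t (sigma Y *m _).
  rewrite (addrC _ c) (addrC _ d) (addrACA a (_ *t _)) (addrACA b (_ *t _)) opprD.
  by rewrite [rho Y *t _ + _]addrC (addrACA (a + c)) subrr addr0 opprD addrACA.
- by move=> X HX; rewrite rho3 // sigma3 // trmxCD !tensmx_trC !trmxC1.
Qed.

Lemma hwv_neq0 n (rho : 'M[C]_(r + r) -> 'M[C]_n) mu v :
  highest_weight_vector rho mu v -> v != 0.
Proof. by case. Qed.

Lemma hwv_tensor m n (rho : 'M[C]_(r + r) -> 'M[C]_m)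
    (sigma : 'M[C]_(r + r) -> 'M[C]_n) mu nu v w :
  highest_weight_vector rho mu v -> highest_weight_vector sigma nu w ->
  highest_weight_vector (tensor_rep rho sigma) (mu + nu) (vtens v w).
Proof.
move=> [v0 hv ev] [w0 hw ew].
split; first exact: vtens_neq0.
- move=> d; rewrite vtens_act hv hw vtensZl vtensZr -scalerDl -big_split /=.
  by congr (_ *: _); apply: eq_bigr => j _; rewrite mxE mulrDl.
- by move=> i ir; rewrite vtens_act ev // ew // vtens0l vtens0r addr0.
Qed.

Lemma hwv_intertwines m n (rho : 'M[C]_(r + r) -> 'M[C]_m)
    (tau : 'M[C]_(r + r) -> 'M[C]_n) T mu v :
  intertwines rho tau T -> highest_weight_vector rho mu v -> T *m v != 0 ->
  highest_weight_vector tau mu (T *m v).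
Proof.
move=> tw [v0 hv ev] Tv; split=> // [d|i ir].
  by rewrite mulmxA -(tw _ (cartan_in_sp d)) -mulmxA hv -scalemxAr.
by rewrite mulmxA -(tw _ (raising_in_sp C r i)) -mulmxA ev // mulmx0.
Qed.

Definition vector_rep X : 'M[C]_(r + r) := X.

Lemma star_rep_vector : star_rep vector_rep.
Proof. by []. Qed.

Lemma in_sp_rank1 (u : 'cV[C]_(r + r)) : in_sp (u *m u^T *m J).
Proof.
apply/in_spP; rewrite !trmx_mul trmxK symp_tr mulNmx mulmxN opprK.
by rewrite (mulmxA J) -mulmxA !symp_sqr mulNmx mul1mx mulmxN mulmx1.
Qed.

(* The rank one elements w |-> (u, w) u of sp(2r), where (u, w) is the
   symplectic form, carry a nonzero vector w to every u with (u, w) != 0. *)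
Lemma irreducible_vector_rep : (0 < r)%N -> irreducible_rep vector_rep.
Proof.
move=> r0; split; first by rewrite addn_gt0 r0.
move=> W stW; have [|W0] := eqVneq W 0%VS; [by left | right].
have [w wW w0] : exists2 w, w \in W & w != 0.
  by exists (vpick W); rewrite ?memv_pick ?vpick0.
pose om (u : 'cV_(r + r)) : C := (u^T *m J *m w) 0 0.
have omP u : om u != 0 -> u \in W.
  move=> ou; have := stW _ _ (in_sp_rank1 u) wW; rewrite /vector_rep.
  rewrite -!mulmxA (mulmxA u^T) [u^T *m J *m w]mx11_scalar -/(om u).
  by rewrite mul_mx_scalar rpredZeq (negPf ou).
have [u0 ou0] : exists u, om u != 0.
  have /cV0Pn [i Ji] : J *m w != 0.
    apply: contra_neq w0 => /(congr1 (mulmx J)); rewrite mulmxA symp_sqr.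
    by rewrite mulNmx mul1mx mulmx0 => /eqP; rewrite oppr_eq0 => /eqP.
  exists (delta_mx i 0); rewrite /om -mulmxA trmx_delta.
  by rewrite -rowE mxE.
apply/eqP; rewrite eqEsubv subvf; apply/subvP => u _.
have [ou|] := eqVneq (om u) 0; last exact: omP.
(* When (u, w) = 0, both [u + u0] and [u0] still pair nontrivially with [w]. *)
have -> : u = (u + u0) - u0 by rewrite addrK.
rewrite memvB ?omP //; apply: contraNneq ou0.
by rewrite /om linearD /= !mulmxDl mxE -/(om u) ou add0r => ->.
Qed.

Lemma is_V_vector_rep : (0 < r)%N -> is_V (omega 1) vector_rep.
Proof.
move=> r0; split; [exact: star_rep_vector.1 | exact: irreducible_vector_rep |].
pose e := delta_mx (Ordinal r0) 0 : 'cV[C]_r.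
exists (col_mx e 0); rewrite /vector_rep; split.
- apply/cV0Pn; exists (lshift r (Ordinal r0)).
  by rewrite col_mxEu mxE !eqxx oner_eq0.
- move=> d; rewrite mul_block_col !(mul0mx, mulmx0, addr0) scale_col_mx scaler0.
  congr col_mx; rewrite (bigD1 (Ordinal r0)) //= big1 => [|j j0]; last first.
    by rewrite /omega big_nat1 mxE eqSS -(inj_eq val_inj) in j0 *; rewrite (negPf j0) mul0r.
  rewrite /omega big_nat1 mxE mul1r addr0; apply/colP => k.
  rewrite mul_diag_mx !mxE andbT; case: (k =P Ordinal r0) => [->//|_].
  by rewrite !mulr0.
- move=> i /andP[i1 _]; rewrite /raising; case: ifP => _.
    by rewrite mul_block_col !(mul0mx, mulmx0, addr0) col_mx0.
  rewrite mul_block_col !(mul0mx, mulmx0, addr0) -colE.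
  have -> : col (Ordinal r0) (elem_mx C r i i.+1) = 0; last by rewrite col_mx0.
  by apply/colP => k; rewrite !mxE /= eqSS (ltn_eqF i1) andbF.
Qed.

End TensorProducts.

(** * The exterior algebra of C^(2r) as a *-representation *)

Section Fock.
Local Open Scope sesquilinear_scope.
Variables (C : numClosedFieldType) (r : nat).
Implicit Types X Y : 'M[C]_(r + r).

Local Notation J := (symp_form C r).

(* Canonical anticommutation relations; each mode doubles the dimension
   (Jordan-Wigner). *)
Lemma car_family_exists n : exists N (a : nat -> 'M[C]_N) (Om : 'cV[C]_N),
  [/\ forall j k, (j < n)%N -> (k < n)%N -> a j *m a k + a k *m a j = 0,
      forall j k, (j < n)%N -> (k < n)%N ->
        a j *m (a k)^t* + (a k)^t* *m a j = (j == k)%:R%:M,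
      Om != 0 & forall j, (j < n)%N -> a j *m Om = 0].
Proof.
elim: n => [|n [N [a [Om [aa ac Om0 aOm]]]]].
  by exists 1%N, (fun _ => 0), 1%:M; split=> //; rewrite matrix_nonzero1.
(* The new mode is number 0; the sign in the lower block, its parity operator, makes the old modes
   anticommute with it. *)
pose A j : 'M[C]_(N + N) := if j is j'.+1 then block_mx (a j') 0 0 (- a j')
  else block_mx 0 1%:M 0 0.
have AcE j : (A j)^t* = if j is j'.+1 then block_mx ((a j')^t*) 0 0 (- (a j')^t*)
  else block_mx 0 0 1%:M 0.
  case: j => [|j]; rewrite tr_block_mx map_block_mx !trmx0 !map_mx0 ?trmxC1 //.
  by congr block_mx; apply/matrixP => x y; rewrite !mxE rmorphN.
exists (N + N)%N, A, (col_mx Om 0); split.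
- case=> [|j] [|k] jn kn; rewrite /A /= !mulmx_block
    !(mulmx0, mul0mx, mulmx1, mul1mx, mulNmx, mulmxN, addr0, add0r, opprK)
    add_block_mx
    !(mulmx0, mul0mx, mulmx1, mul1mx, mulNmx, mulmxN, addr0, add0r, opprK)
    ?addNr ?subrr ?aa //;
    by rewrite ?block_mx0.
- case=> [|j] [|k] jn kn; rewrite AcE /A /= !mulmx_block
    !(mulmx0, mul0mx, mulmx1, mul1mx, mulNmx, mulmxN, addr0, add0r, opprK)
    add_block_mx
    !(mulmx0, mul0mx, mulmx1, mul1mx, mulNmx, mulmxN, addr0, add0r, opprK)
    ?addNr ?subrr ?ac //;
    by rewrite /= ?eqxx -?scalar_mx_block // ?scalar_mx_block ?raddf0 ?block_mx0.
- by rewrite col_mx_eq0 negb_and Om0.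
- by case=> [|j] jn; rewrite /A /= mul_block_col
    !(mulmx0, mul0mx, mulmx1, mul1mx, mulNmx, mulmxN, addr0, add0r, opprK)
    ?aOm ?oppr0 ?col_mx0.
Qed.

Lemma omegaE k (j : 'I_r) : omega k 0 j = (j < k)%N%:R :> C.
Proof.
rewrite /omega summxE; under eq_bigr do rewrite mxE.
case: ltnP => kj.
  rewrite (bigD1_seq j.+1) ?iota_uniq ?mem_index_iota ?ltnS //= eqxx big1 ?addr0 //.
  by move=> m mk; rewrite eq_sym (negPf mk).
rewrite big_nat big1 // => m /andP[_ mj].
by rewrite gtn_eqF // (leq_trans mj).
Qed.

Section Modes.
Variables (N : nat) (a : nat -> 'M[C]_N) (Om : 'cV[C]_N).
Hypothesis aa : forall j k, (j < r + r)%N -> (k < r + r)%N ->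
  a j *m a k + a k *m a j = 0.
Hypothesis ac : forall j k, (j < r + r)%N -> (k < r + r)%N ->
  a j *m (a k)^t* + (a k)^t* *m a j = (j == k)%:R%:M.
Hypothesis aOm : forall j, (j < r + r)%N -> a j *m Om = 0.

(** Second quantization: the derivation of the exterior algebra extending [X], with [(a i)^t*] as
    the wedge with the i-th basis vector. *)
Definition fock_rep X : 'M[C]_N := \sum_i \sum_j X i j *: ((a i)^t* *m a j).

Lemma fock_rep_lin c X Y : fock_rep (c *: X + Y) = c *: fock_rep X + fock_rep Y.
Proof.
rewrite scaler_sumr -big_split; apply: eq_bigr => i _ /=.
rewrite scaler_sumr -big_split; apply: eq_bigr => j _ /=.
by rewrite !mxE scalerDl scalerA.
Qed.

Lemma fock_rep_star X : fock_rep (X^t*) = (fock_rep X)^t*.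
Proof.
have trS (I : finType) (F : I -> 'M[C]_N) : (\sum_i F i)^t* = \sum_i (F i)^t*.
  elim/big_rec2: _ => [|i x y _ <-]; first by rewrite trmx0 map_mx0.
  by rewrite trmxCD.
rewrite /fock_rep trS exchange_big; apply: eq_bigr => i _.
rewrite trS; apply: eq_bigr => j _.
by rewrite linearZ /= map_mxZ trmxC_mul trmxCK !mxE.
Qed.

(** Moving [a j] through [(a i)^t* *m a l] costs an anticommutator that is nonzero only for [i = j],
    so a single row of [X] survives: annihilation operators transform like the dual of C^(2r). *)
Lemma fock_rep_a X (j : 'I_(r + r)) :
  fock_rep X *m a j - a j *m fock_rep X = - \sum_i X j i *: a i.
Proof.
rewrite /fock_rep mulmx_suml mulmx_sumr -sumrB (bigD1 j) //= [X in _ + X = _]big1 => [|i ij].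
  rewrite addr0 mulmx_suml mulmx_sumr -sumrB -sumrN; apply: eq_bigr => l _.
  rewrite -scalemxAl -scalemxAr -scalerBr -scalerN; congr (_ *: _).
  have /eqP := aa (ltn_ord l) (ltn_ord j); rewrite addr_eq0 => /eqP E.
  rewrite -mulmxA E mulmxN !mulmxA -opprD -mulmxDl addrC ac // eqxx.
  by rewrite mul1mx.
rewrite mulmx_suml mulmx_sumr -sumrB big1 // => l _.
rewrite -scalemxAl -scalemxAr -scalerBr.
have /eqP := aa (ltn_ord l) (ltn_ord j); rewrite addr_eq0 => /eqP E.
rewrite -mulmxA E mulmxN !mulmxA -opprD -mulmxDl addrC ac //.
by rewrite eq_sym (inj_eq val_inj) (negPf ij) raddf0 mul0mx oppr0 scaler0.
Qed.

Lemma fock_rep_adj X (j : 'I_(r + r)) :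
  fock_rep X *m (a j)^t* - (a j)^t* *m fock_rep X = \sum_i X i j *: (a i)^t*.
Proof.
have trN (A : 'M[C]_N) : (- A)^t* = - A^t*.
  by apply/matrixP => x y; rewrite !mxE rmorphN.
have := congr1 (fun Z => Z^t*) (fock_rep_a (X^t*) j).
rewrite trmxCB !trmxC_mul -fock_rep_star trmxCK trN => /eqP.
rewrite -eqr_opp opprB opprK => /eqP ->.
elim/big_rec2: _ => [|i x y _ <-]; first by rewrite trmx0 map_mx0.
by rewrite trmxCD linearZ /= map_mxZ !mxE /= conjCK.
Qed.

(** Commutation with [fock_rep X] is a derivation known on creation and annihilation operators,
    hence on the quadratic terms that make up [fock_rep Y]. *)
Lemma fock_rep_bracket X Y :
  fock_rep (X *m Y - Y *m X) =
  fock_rep X *m fock_rep Y - fock_rep Y *m fock_rep X.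
Proof.
have EY Z : fock_rep Z *m fock_rep Y - fock_rep Y *m fock_rep Z =
    \sum_k \sum_l Y k l *: (\sum_i Z i k *: ((a i)^t* *m a l)
                            - \sum_i Z l i *: ((a k)^t* *m a i)).
  have adjE := fock_rep_adj Z; have aE := fock_rep_a Z.
  (* Hiding [fock_rep Z] behind [F] lets the next unfolding reach [fock_rep Y] only. *)
  move: (fock_rep Z) adjE aE => F adjE aE.
  rewrite /fock_rep mulmx_suml mulmx_sumr -sumrB.
  apply: eq_bigr => k _; rewrite mulmx_suml mulmx_sumr -sumrB.
  apply: eq_bigr => l _; rewrite -scalemxAl -scalemxAr -scalerBr; congr (_ *: _).
  have -> : \sum_i Z i k *: ((a i)^t* *m a l) = (\sum_i Z i k *: (a i)^t*) *m a l.
    by rewrite mulmx_suml; apply: eq_bigr => i _; rewrite scalemxAl.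
  have -> : \sum_i Z l i *: ((a k)^t* *m a i) = (a k)^t* *m \sum_i Z l i *: a i.
    by rewrite mulmx_sumr; apply: eq_bigr => i _; rewrite scalemxAr.
  rewrite -adjE -[\sum_i Z l i *: a i]opprK -aE.
  by rewrite mulmxN opprK mulmxBl mulmxBr !mulmxA addrA subrK.
rewrite EY.
have -> : fock_rep (X *m Y - Y *m X) = \sum_k \sum_l (X *m Y) k l *: ((a k)^t* *m a l)
   - \sum_k \sum_l (Y *m X) k l *: ((a k)^t* *m a l).
  rewrite -sumrB; apply: eq_bigr => k _; rewrite -sumrB; apply: eq_bigr => l _.
  by rewrite !mxE scalerBl.
under [RHS]eq_bigr => k _.
  under eq_bigr do rewrite scalerBr.
  rewrite sumrB.
  over.
rewrite sumrB; congr (_ - _).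
- rewrite exchange_big [RHS]exchange_big; apply: eq_bigr => l _ /=.
  under eq_bigr do rewrite mxE scaler_suml.
  under [RHS]eq_bigr do rewrite scaler_sumr.
  rewrite exchange_big; apply: eq_bigr => k _; apply: eq_bigr => i _.
  by rewrite scalerA mulrC.
- apply: eq_bigr => k _.
  under eq_bigr do rewrite mxE scaler_suml.
  under [RHS]eq_bigr do rewrite scaler_sumr.
  rewrite exchange_big; apply: eq_bigr => l _; apply: eq_bigr => i _.
  by rewrite scalerA.
Qed.

Lemma star_rep_fock : star_rep fock_rep.
Proof.
split; first split.
- by move=> c X Y _ _; apply: fock_rep_lin.
- by move=> X Y _ _; apply: fock_rep_bracket.
- by move=> X _; apply: fock_rep_star.
Qed.

(** The wedge of the first [k] basis vectors, the highest weight vector of V_(omega k) for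
    [k <= r]. *)
Fixpoint filled k : 'cV[C]_N := if k is k'.+1 then (a k')^t* *m filled k' else Om.

Lemma filled_empty k j : (k <= r + r)%N -> (k <= j < r + r)%N -> a j *m filled k = 0.
Proof.
elim: k j => [|k IHk] j kr /andP[kj jr] /=; first exact: aOm.
have /eqP := ac jr kr; rewrite gtn_eqF // raddf0 addr_eq0 => /eqP E.
by rewrite mulmxA E mulNmx -mulmxA IHk ?(ltnW kr) ?(ltnW kj) ?mulmx0 ?oppr0.
Qed.

Lemma filled_annihilate k : (k < r + r)%N -> a k *m filled k.+1 = filled k.
Proof.
move=> kr; have /(canRL (addrK _)) E := ac kr kr.
rewrite /= mulmxA E eqxx mulmxBl mul1mx -mulmxA.
by rewrite filled_empty ?leqnn ?(ltnW kr) // mulmx0 subr0.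
Qed.

Lemma filled_full k j : (k <= r + r)%N -> (j < k)%N -> (a j)^t* *m filled k = 0.
Proof.
have anti x y : (x < r + r)%N -> (y < r + r)%N ->
    (a x)^t* *m (a y)^t* = - ((a y)^t* *m (a x)^t*).
  move=> xr yr; apply/eqP; rewrite -addr_eq0 -!trmxC_mul -trmxCD aa //.
  by rewrite trmx0 map_mx0.
elim: k => // k IHk kr; rewrite ltnS leq_eqVlt => /orP[/eqP->|jk] /=.
  rewrite mulmxA; suff -> : (a k)^t* *m (a k)^t* = 0 by rewrite mul0mx.
  have /eqP := anti k k kr kr; rewrite -addr_eq0 -mulr2n => /eqP E.
  apply/eqP; move: E; rewrite -scaler_nat => /eqP; rewrite scaler_eq0 pnatr_eq0.
  by [].
rewrite mulmxA anti ?(ltn_trans jk) // mulNmx -mulmxA IHk ?(ltnW kr) //.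
by rewrite mulmx0 oppr0.
Qed.

Lemma filled_neq0 k : Om != 0 -> (k <= r + r)%N -> filled k != 0.
Proof.
move=> Om0; elim: k => // k IHk kr; apply: contraNneq (IHk (ltnW kr)) => E.
by rewrite -filled_annihilate // E mulmx0.
Qed.

(** Such an [X] preserves the span of the first [k] basis vectors, so on its top exterior power it
    acts by the trace. Cartan elements and all raising operators have this shape. *)
Lemma fock_rep_triangular X k : (k <= r)%N ->
  (forall i j : 'I_r, X (rshift r i) (lshift r j) = 0) ->
  (forall i j : 'I_r, (j < i)%N -> X (lshift r i) (lshift r j) = 0) ->
  fock_rep X *m filled k =
    (\sum_(j < r) X (lshift r j) (lshift r j) * (j < k)%N%:R) *: filled k.
Proof.
move=> kr Xd Xu; have kr2 : (k <= r + r)%N by rewrite (leq_trans kr) ?leq_addr.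
rewrite /fock_rep mulmx_suml big_split_ord /= [X in _ + X]big1 => [|i _]; last first.
  rewrite mulmx_suml big_split_ord /= !big1 ?addr0 // => j _.
    rewrite -scalemxAl -mulmxA filled_empty ?mulmx0 ?scaler0 //.
    by rewrite ltn_add2l ltn_ord andbT (leq_trans kr) ?leq_addr.
  by rewrite Xd scale0r mul0mx.
rewrite addr0 scaler_suml; apply: eq_bigr => i _.
rewrite mulmx_suml big_split_ord /= [X in _ + X]big1 => [|j _]; last first.
  rewrite -scalemxAl -mulmxA filled_empty ?mulmx0 ?scaler0 //.
  by rewrite ltn_add2l ltn_ord andbT (leq_trans kr) ?leq_addr.
have lr (m : 'I_r) : (m < r + r)%N by rewrite (leq_trans (ltn_ord m)) ?leq_addr.
rewrite addr0 (bigD1 i) //= big1 ?addr0 => [|j ji].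
  rewrite -scalemxAl -scalerA; congr (_ *: _).
  have /(canRL (addKr _)) -> := ac (lr i) (lr i).
  rewrite eqxx mulmxDl mul1mx mulNmx -!mulmxA.
  case: ltnP => ik; first by rewrite filled_full // mulmx0 oppr0 add0r scale1r.
  have := ac (lr i) (lr i); rewrite eqxx => /(congr1 (mulmx^~ (filled k))).
  rewrite mulmxDl mul1mx -!mulmxA [a i *m filled k]filled_empty ?ik ?lr //.
  by rewrite mulmx0 addr0 => ->; rewrite addNr scale0r.
rewrite -scalemxAl.
have [kj|jk] := leqP k j.
  by rewrite -mulmxA filled_empty ?kj ?lr // mulmx0 scaler0.
have [lij|lji|/val_inj eij] := ltngtP i j.
- have := ac (lr j) (lr i); rewrite gtn_eqF // raddf0 => /eqP.
  rewrite addrC addr_eq0 => /eqP ->; rewrite mulNmx -mulmxA filled_full ?mulmx0 ?oppr0 ?scaler0 //.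
  exact: ltn_trans jk.
- by rewrite Xu ?scale0r.
- by rewrite eij eqxx in ji.
Qed.

Lemma hwv_filled k : Om != 0 -> (k <= r)%N ->
  highest_weight_vector fock_rep (omega k) (filled k).
Proof.
move=> Om0 kr; split.
- by rewrite filled_neq0 // (leq_trans kr) ?leq_addr.
- move=> d; rewrite fock_rep_triangular // => [|i j|i j ij].
  + congr (_ *: _); apply: eq_bigr => j _; rewrite block_mxEul mxE eqxx mulrC; congr (_ * _).
    by rewrite omegaE.
  + by rewrite block_mxEdl mxE.
  + by rewrite block_mxEul mxE eq_sym -(inj_eq val_inj) ltn_eqF.
- move=> i /andP[i0 ir]; rewrite fock_rep_triangular // => [|j l|j l lj].
  + rewrite big1 ?scale0r // => j _; rewrite /raising; case: ifP => _; rewrite block_mxEul mxE ?mul0r //.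
    case: eqP => [->|_]; last by rewrite mul0r.
    by rewrite ltn_eqF // mul0r.
  + by rewrite /raising; case: ifP => _; rewrite block_mxEdl mxE.
  + rewrite /raising; case: ifP => _; rewrite block_mxEul mxE //.
    case: eqP => [E|//]; case: eqP => [F|//].
    by move: lj; rewrite -ltnS E F ltnNge leqnSn.
Qed.

End Modes.
End Fock.

(** * Vector operators and the summands they produce *)

Section Covariance.
Local Open Scope sesquilinear_scope.
Variables (C : numClosedFieldType) (r : nat).
Implicit Types X Y : 'M[C]_(r + r).

Local Notation J := (symp_form C r).

(** Equivalently, mapping [w] to the sum over [j] of [B j *m w] tensor the j-th basis vector
    intertwines [rho] with its tensor product by the vector representation. *)
Definition covariant n (rho : 'M[C]_(r + r) -> 'M[C]_n) (B : 'I_(r + r) -> 'M[C]_n) :=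
  forall X, in_sp X -> forall j,
    rho X *m B j - B j *m rho X = - \sum_i X j i *: B i.

Lemma covariant_tensor m n (sigma : 'M[C]_(r + r) -> 'M[C]_m)
    (rho : 'M[C]_(r + r) -> 'M[C]_n) B :
  covariant rho B -> covariant (tensor_rep sigma rho) (fun j => 1%:M *t B j).
Proof.
move=> cov X HX j; rewrite /tensor_rep mulmxDl mulmxDr !tensmx_mul !mul1mx !mulmx1.
rewrite opprD addrACA subrr add0r -tensmxBr cov // -sumrN -sumrN.
elim/big_rec2: _ => [|i x y _ <-]; first by rewrite tensmx0.
by rewrite tensmxDr -!scaleNr tensmxZr.
Qed.

(** The symplectic form identifies C^(2r) with its dual, so operators transforming like basis
    vectors also yield a covariant family. *)
Lemma covariant_symp n (rho : 'M[C]_(r + r) -> 'M[C]_n) (A : 'I_(r + r) -> 'M[C]_n) :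
  (forall X j, in_sp X -> rho X *m A j - A j *m rho X = \sum_i X i j *: A i) ->
  covariant rho (fun j => \sum_i J j i *: A i).
Proof.
move=> cov X HX j; rewrite mulmx_sumr mulmx_suml -sumrB.
have E l : \sum_i J j i * X l i = - \sum_i X j i * J i l.
  have /in_spP/matrixP/(_ j l) := HX; rewrite mxE => ->; rewrite !mxE opprK.
  by apply: eq_bigr => i _; congr (_ * _); rewrite mxE.
transitivity (\sum_l (\sum_i J j i * X l i) *: A l).
  under [RHS]eq_bigr do rewrite scaler_suml.
  rewrite exchange_big; apply: eq_bigr => i _.
  rewrite -scalemxAr -scalemxAl -scalerBr cov // scaler_sumr.
  by apply: eq_bigr => l _; rewrite scalerA.
under eq_bigr do rewrite E scaleNr.
rewrite sumrN; congr (- _).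
under [RHS]eq_bigr do rewrite scaler_sumr.
rewrite exchange_big; apply: eq_bigr => l _ /=.
by rewrite scaler_suml; apply: eq_bigr => i _; rewrite scalerA.
Qed.

Lemma mulmx_trC_eq0 m n (Q : 'M[C]_(m, n)) : Q *m Q^t* = 0 -> Q = 0.
Proof.
move=> QQ; apply/matrixP => i j; rewrite mxE.
have /eqP := congr1 (fun Z : 'M_m => Z i i) QQ; rewrite !mxE psumr_eq0.
  move=> /allP /(_ j (mem_index_enum _)) /implyP /(_ isT).
  by rewrite !mxE -normCK expf_eq0 /= normr_eq0 => /eqP.
by move=> k _; rewrite !mxE -normCK exprn_ge0.
Qed.

(** An eigenspace of [A] is a nonzero submodule, hence everything. The transpose appears because
    [eigenvalue] refers to row vectors. *)
Lemma schur_scalar n (tau : 'M[C]_(r + r) -> 'M[C]_n) (A : 'M[C]_n) :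
  irreducible_rep tau -> intertwines tau tau A -> exists c, A = c%:M.
Proof.
move=> [n0 irr] tw.
have [c /eigenvalueP [w wA w0]] := eigenvalue_closed A^T n0.
exists c.
pose W := lker (linfun (mulmx (A - c%:M)) : 'Hom('cV[C]_n, 'cV[C]_n)).
have WE v : (v \in W) = (A *m v == c *: v).
  by rewrite memv_ker lfunE /= mulmxBl subr_eq0 mul_scalar_mx.
have [|W0|Wf] := irr W.
- move=> X v HX; rewrite !WE => /eqP Av; apply/eqP.
  by rewrite mulmxA tw // -mulmxA Av -scalemxAr.
- have: w^T \in W by rewrite WE -[A]trmxK -trmx_mul wA linearZ.
  by rewrite W0 memv0 -[0]trmx0 => /eqP/trmx_inj w00; rewrite w00 eqxx in w0.
- have AE (v : 'cV[C]_n) : A *m v = c *: v.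
    have: v \in W by rewrite Wf memvf.
    by rewrite WE => /eqP.
  apply/matrixP => i j; have /colP/(_ i) := AE (delta_mx j 0).
  by rewrite -colE !mxE eqxx andbT mulr_natr.
Qed.

(** By Schur's lemma [T] times its adjoint is a scalar [c], nonzero because [T] is; the adjoint of
    [T] embeds and [c^-1 *: T] projects. *)
Lemma intertwiner_summand m n (rho : 'M[C]_(r + r) -> 'M[C]_m)
    (tau : 'M[C]_(r + r) -> 'M[C]_n) T :
  star_rep rho -> star_rep tau -> irreducible_rep tau -> intertwines rho tau T ->
  T != 0 -> is_summand tau rho.
Proof.
move=> srho stau irr tw T0.
have twC : intertwines tau rho (T^t*).
  move=> X HX; have /(congr1 (fun Z => Z^t*)) := tw _ (in_sp_star HX).
  by rewrite !trmxC_mul -srho.2 -?stau.2 ?trmxCK //; apply: in_sp_star.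
have [|c TT] := @schur_scalar _ tau (T *m T^t*) irr.
  by move=> X HX; rewrite -mulmxA twC // !mulmxA tw.
have c0 : c != 0.
  apply: contra_neq T0 => c0; apply: mulmx_trC_eq0.
  by rewrite TT c0 raddf0.
exists (T^t*), (c^-1 *: T); split.
- by rewrite -scalemxAl TT scale_scalar_mx mulVf.
- by move=> X HX; rewrite twC.
- by move=> X HX; rewrite -scalemxAl tw // scalemxAr.
Qed.

Lemma vtens_delta_sum_neq0 m n (x : 'I_n -> 'cV[C]_m) k :
  x k != 0 -> \sum_j vtens (x j) (delta_mx j 0) != 0.
Proof.
move=> /cV0Pn [i xi]; apply/cV0Pn; exists (mxtens_index (i, k)).
rewrite summxE (bigD1 k) //= big1 => [|j jk].
  by rewrite addr0 vtensE mxE !eqxx mulr1.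
by rewrite vtensE mxE eq_sym (negPf jk) mulr0.
Qed.

(** [P] maps to an irreducible component in which [B k *m v] survives, a model of V_lam. Covariance
    makes [s] an intertwiner from [rho] into the product of this component with C^(2r), so [s v] is
    singular of weight [mu]; it is nonzero because of its term [k], and a component in which it
    survives is a model of V_mu. *)
Lemma covariant_summand n (rho : 'M[C]_(r + r) -> 'M[C]_n) B mu lam v k :
  star_rep rho -> covariant rho B -> highest_weight_vector rho mu v ->
  highest_weight_vector rho lam (B k *m v) ->
  exists m p (sigma : 'M[C]_(r + r) -> 'M[C]_m) (tau : 'M[C]_(r + r) -> 'M[C]_p),
    [/\ is_V lam sigma, is_V mu tau & is_summand tau (tensor_rep sigma (@vector_rep C r))].
Proof.
move=> srho cov hv hBv.
have [m [sigma [P [ssig isig twP PBv]]]] := irr_component srho (hwv_neq0 hBv).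
pose s w := \sum_j vtens (P *m B j *m w) (delta_mx j 0 : 'cV_(r + r)).
have sact X w : in_sp X ->
    tensor_rep sigma (@vector_rep C r) X *m s w = s (rho X *m w).
  move=> HX; rewrite /s mulmx_sumr.
  under eq_bigr do rewrite vtens_act.
  rewrite big_split /=.
  have -> : \sum_j vtens (P *m B j *m w) (vector_rep X *m delta_mx j 0) =
      \sum_j vtens (P *m (\sum_i X j i *: B i) *m w) (delta_mx j 0 : 'cV_(r + r)).
    transitivity (\sum_j \sum_i vtens (X i j *: (P *m B j *m w)) (delta_mx i 0 : 'cV_(r + r))).
      apply: eq_bigr => j _; rewrite /vector_rep -colE.
      rewrite [col j X](_ : _ = \sum_i X i j *: delta_mx i 0); last first.
        rewrite [LHS]matrix_sum_delta; apply: eq_bigr => i _.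
        by rewrite big_ord1 mxE.
      rewrite vtens_sumr; apply: eq_bigr => i _.
      by rewrite vtensZl vtensZr.
    rewrite exchange_big; apply: eq_bigr => j _ /=.
    rewrite mulmx_sumr mulmx_suml vtens_suml; apply: eq_bigr => i _.
    by rewrite -scalemxAr -scalemxAl.
  rewrite -big_split; apply: eq_bigr => j _ /=.
  rewrite -vtensDl -[\sum_i X j i *: B i]opprK -cov //.
  rewrite !mulmxA -twP // mulmxN mulNmx mulmxBr mulmxBl !mulmxA.
  by rewrite opprB addrC subrK.
have sZ c w : s (c *: w) = c *: s w.
  rewrite /s scaler_sumr; apply: eq_bigr => j _.
  by rewrite -scalemxAr vtensZl.
have hs : highest_weight_vector (tensor_rep sigma (@vector_rep C r)) mu (s v).
  split.
  - by apply: (@vtens_delta_sum_neq0 _ _ _ k); rewrite -mulmxA.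
  - move=> d; rewrite sact; last exact: cartan_in_sp.
    by case: hv => _ -> _; rewrite sZ.
  - move=> i ir; rewrite sact; last exact: raising_in_sp.
    case: hv => _ _ -> //; rewrite /s big1 // => j _.
    by rewrite mulmx0 vtens0l.
have stens := star_rep_tensor ssig (@star_rep_vector C r).
have [p [tau [Q [stau itau twQ Qs]]]] := irr_component stens (hwv_neq0 hs).
exists m, p, sigma, tau; split.
- split; [exact: ssig.1 | by [] |].
  by exists (P *m (B k *m v)); apply: hwv_intertwines hBv _.
- split; [exact: stau.1 | by [] |].
  by exists (Q *m s v); apply: hwv_intertwines hs _.
- apply: intertwiner_summand twQ _ => //.
  by apply: contraNneq Qs => ->; rewrite mul0mx.
Qed.

End Covariance.

(** * Weights and their labels *)

Section Weights.
Variables (C : numClosedFieldType) (r : nat).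
Implicit Types lam mu nu : 'rV[C]_r.

Lemma form_epsr lam (k : 'I_r) : form lam (eps k.+1) = lam 0 k.
Proof.
rewrite /form (bigD1 k) //= big1 => [|j jk]; first by rewrite addr0 mxE eqxx mulr1.
by rewrite mxE eqSS (inj_eq val_inj) (negPf jk) mulr0.
Qed.

Lemma form_eps_out lam : form lam (eps r.+1) = 0.
Proof.
by rewrite /form big1 // => j _; rewrite mxE eqSS ltn_eqF ?mulr0.
Qed.

(** The formula covers the long root too: [eps r.+1] is the zero vector, and the factor 2 in
    [alpha r] is absorbed by the square length 4. *)
Lemma label_form lam i : (1 <= i <= r)%N ->
  label lam i = form lam (eps i - eps i.+1).
Proof.
move=> /andP[i1 ir]; rewrite /label; have [ir'|] := ltnP i r.
  by rewrite form_alpha_short ?i1 // mulrAC divff ?pnatr_eq0 // mul1r /alpha ltn_eqF.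
move=> ri; have -> : i = r by apply/eqP; rewrite eqn_leq ir.
rewrite form_alpha_long ?(leq_trans i1) // /alpha eqxx formBr form_eps_out subr0.
rewrite formMnr; by field.
Qed.

Lemma weight_sum_labels lam :
  lam = \sum_(1 <= i < r.+1) label lam i *: omega i.
Proof.
apply/rowP => j; rewrite summxE.
rewrite (big_cat_nat (n := j.+1)) //= ?ltnS; last exact: ltnW.
rewrite [X in X + _]big_nat big1 => [|i /andP[_ ij]].
  rewrite add0r.
  transitivity (\sum_(j.+1 <= i < r.+1) (- form lam (eps i.+1) - - form lam (eps i))).
    rewrite (telescope_sumr (fun i => - form lam (eps i))); last by rewrite ltnW // ltnS.
    by rewrite form_eps_out oppr0 sub0r opprK form_epsr.
  apply: eq_big_nat => i /andP[ji ir]; rewrite mxE omegaE ji mulr1 label_form.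
    by rewrite formBr opprK addrC.
  by rewrite (leq_ltn_trans (leq0n _) ji).
by rewrite mxE omegaE ltnNge -ltnS ij mulr0.
Qed.

Lemma omegaS k : omega k.+1 = omega k + eps k.+1 :> 'rV[C]_r.
Proof. by rewrite /omega big_nat_recr. Qed.

Lemma omega0 : omega 0 = 0 :> 'rV[C]_r.
Proof. by rewrite /omega big_geq. Qed.

(** Isolates the copy of [omega d] that is later exchanged for a neighboring fundamental weight. *)
Lemma dominant_pred lam (n : nat -> nat) d : (1 <= d <= r)%N -> (0 < n d)%N ->
  (forall i, (1 <= i <= r)%N -> label lam i = (n i)%:R) ->
  exists n', lam = omega d + \sum_(1 <= i < r.+1) omega i *+ n' i.
Proof.
move=> /andP[d1 dr] nd lamE; exists (fun i => n i - (i == d))%N.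
rewrite {1}[lam]weight_sum_labels.
have -> : omega d = \sum_(1 <= i < r.+1) omega i *+ (i == d) :> 'rV[C]_r.
  rewrite (bigD1_seq d) ?iota_uniq ?mem_index_iota ?d1 //= eqxx big1 ?addr0 //.
  by move=> i /negPf ->.
rewrite -big_split; apply: eq_big_nat => i /andP[i1]; rewrite ltnS => ir /=.
rewrite lamE ?i1 // -mulrnDr subnKC ?scaler_nat //.
by case: eqP => // ->.
Qed.

End Weights.

(** * Integrality of highest weights for sl2 *)

Section SL2.
Variables (C : numClosedFieldType).

(** If [c] is not natural, E F^(n+1) v = (n+1)(c-n) F^n v keeps every F^n v nonzero. These are
    eigenvectors of [H] with distinct eigenvalues c - 2n, more than the characteristic polynomial
    has roots. *)
Lemma sl2_highest_weight p (E F H : 'M[C]_p) (v : 'cV[C]_p) c :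
  E *m F - F *m E = H -> H *m F - F *m H = F *- 2 ->
  v != 0 -> E *m v = 0 -> H *m v = c *: v -> exists m : nat, c = m%:R.
Proof.
move=> EF HF v0 Ev Hv; apply: contrapT => cN.
pose w n := iter n (mulmx F) v.
have Hw n : H *m w n = (c - 2%:R * n%:R) *: w n.
  elim: n => [|n IHn]; first by rewrite mulr0 subr0.
  have /(canRL (subrK _)) HFE := HF.
  rewrite /= mulmxA HFE mulmxDl -mulmxA IHn -scalemxAr -/(w n).
  rewrite mulNmx -scaler_nat -scalemxAl -scaleNr -scalerDl; congr (_ *: _).
  by rewrite -[n.+1]add1n natrD; ring.
have Ew n : E *m w n.+1 = (n.+1%:R * (c - n%:R)) *: w n.
  elim: n => [|n IHn].
    have /(canRL (subrK _)) EFE := EF.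
    by rewrite /= mulmxA EFE mulmxDl -mulmxA Ev mulmx0 addr0 Hv subr0 mul1r.
  have /(canRL (subrK _)) EFE := EF.
  have wS : w n.+2 = F *m w n.+1 by [].
  rewrite wS mulmxA EFE mulmxDl Hw -mulmxA IHn -scalemxAr -/(w n.+1).
  rewrite -scalerDl; congr (_ *: _).
  by rewrite -[n.+2]addn2 -[n.+1]addn1 !natrD; ring.
have w0 n : w n != 0.
  elim: n => // n IHn; apply/eqP => wn; have := Ew n; rewrite wn mulmx0 => /esym/eqP.
  rewrite scaler_eq0 (negPf IHn) orbF mulf_eq0 pnatr_eq0 /= subr_eq0 => /eqP cn.
  by case: cN; exists n.
pose rs := [seq c - 2%:R * n%:R | n <- iota 0 p.+1].
have : (size rs < size (char_poly H^T))%N.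
  apply: max_poly_roots.
  - by rewrite monic_neq0 ?char_poly_monic.
  - apply/allP => _ /mapP [n _ ->]; rewrite -eigenvalue_root_char.
    apply/eigenvalueP; exists (w n)^T; last first.
      by apply: contra_neq (w0 n) => wn; apply: trmx_inj; rewrite wn trmx0.
    by rewrite -trmx_mul Hw linearZ.
  - rewrite map_inj_uniq ?iota_uniq // => x y /addrI /oppr_inj.
    have n2 : 2%:R != 0 :> C by rewrite pnatr_eq0.
    by move/(mulfI n2)/eqP; rewrite eqr_nat => /eqP.
by rewrite size_char_poly size_map size_iota ltnn.
Qed.

End SL2.

(** * Modules with prescribed highest weights *)

Section Admissibility.
Local Open Scope sesquilinear_scope.
Variables (C : numClosedFieldType) (r : nat).
Implicit Types (lam mu nu : 'rV[C]_r) (X : 'M[C]_(r + r)).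

Lemma elem_mx_mul i j k l : (1 <= j <= r)%N ->
  elem_mx C r i j *m elem_mx C r k l = elem_mx C r i l *+ (j == k).
Proof.
case: j => // j jr; apply/matrixP => x y; rewrite mulmxnE !mxE.
rewrite (bigD1 (Ordinal (jr : (j < r)%N))) //= big1 => [|z zj]; last first.
  by rewrite !mxE eqSS (inj_eq val_inj _ (Ordinal _)) (negPf zj) andbF mul0r.
rewrite addr0 !mxE /= eqxx andbT -natrM mulnb -mulrnA mulnb.
by rewrite andbAC andbA.
Qed.

Lemma elem_mx_tr i j : (elem_mx C r i j)^T = elem_mx C r j i.
Proof. by apply/matrixP => x y; rewrite !mxE andbC. Qed.

Lemma diag_eps i : diag_mx (eps i : 'rV[C]_r) = elem_mx C r i i.
Proof.
apply/matrixP => x y; rewrite !mxE -mulrnA mulnb; congr (_ *+ nat_of_bool _).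
case: (x =P y) => [->|xy]; first by rewrite andbT andbb.
rewrite andbF; apply/esym/negP => /andP[/eqP xi /eqP yi]; apply: xy.
by apply: val_inj; apply: succn_inj; rewrite xi yi.
Qed.

Lemma elem_mx_out i : elem_mx C r r.+1 i = 0.
Proof. by apply/matrixP => x y; rewrite !mxE eqSS ltn_eqF. Qed.

Lemma raising_tr_in_sp i : in_sp (raising C r i)^T.
Proof.
have := in_sp_star (raising_in_sp C r i).
congr in_sp; apply/matrixP => x y; rewrite !mxE /raising.
case: ifP => _; rewrite /block_mx !(mxE, castmxE) /=; case: splitP => ? _; rewrite !mxE;
 case: splitP => ? _; rewrite !mxE ?rmorphN ?rmorph_nat ?rmorph0 //.
Qed.

(** Transposes serve as lowering operators: each simple root gives an sl2-triple whose Cartan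
    element is the coroot, which is what [label_form] pairs with the weight. *)
Lemma coroot_bracket i : (1 <= i <= r)%N ->
  raising C r i *m (raising C r i)^T - (raising C r i)^T *m raising C r i =
    cartan (eps i - eps i.+1).
Proof.
move=> /andP[i1 ir]; rewrite /cartan linearB /= !diag_eps /raising.
case: eqP => [->|/eqP ri]; rewrite tr_block_mx !mulmx_block.
  rewrite !(trmx0, mulmx0, mul0mx, addr0, add0r, elem_mx_tr, elem_mx_out, subr0).
  rewrite elem_mx_mul ?(leq_trans i1 ir) ?leqnn // eqxx mulr1n.
  by rewrite opp_block_mx add_block_mx !oppr0 !addr0 add0r.
have ilr : (i < r)%N by rewrite ltn_neqAle ri.
rewrite !linearN /= !(trmx0, mulmx0, mul0mx, addr0, add0r, elem_mx_tr, mulNmx, mulmxN, opprK).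
rewrite !elem_mx_mul ?i1 ?ir ?ilr // !eqxx !mulr1n.
by rewrite opp_block_mx add_block_mx !oppr0 !addr0 opprB.
Qed.

Lemma coroot_lowering i : (1 <= i <= r)%N ->
  cartan (eps i - eps i.+1) *m (raising C r i)^T
   - (raising C r i)^T *m cartan (eps i - eps i.+1) = (raising C r i)^T *- 2.
Proof.
move=> /andP[i1 ir]; rewrite /cartan linearB /= !diag_eps /raising.
case: eqP => [->|/eqP ri]; rewrite tr_block_mx !mulmx_block.
  rewrite !(trmx0, mulmx0, mul0mx, addr0, add0r, elem_mx_tr, elem_mx_out, subr0, mulNmx, mulmxN).
  rewrite elem_mx_mul ?(leq_trans i1 ir) ?leqnn // eqxx mulr1n.
  by rewrite mulr2n opprD opp_block_mx !add_block_mx !oppr0 !addr0.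
have ilr : (i < r)%N by rewrite ltn_neqAle ri.
rewrite !linearN /= !(trmx0, mulmx0, mul0mx, addr0, add0r, elem_mx_tr, mulNmx, mulmxN, opprK).
rewrite !mulmxBl !mulmxBr.
rewrite !elem_mx_mul ?i1 ?ir ?ilr // !eqxx (gtn_eqF (ltnSn i)) (ltn_eqF (ltnSn i)) !mulr1n !mulr0n.
by rewrite mulr2n opprD !opp_block_mx !add_block_mx !oppr0 !addr0 !sub0r ?subr0 !opprK.
Qed.

Lemma is_V_dominant mu n (tau : 'M[C]_(r + r) -> 'M[C]_n) i :
  is_V mu tau -> (1 <= i <= r)%N -> exists m : nat, label mu i = m%:R.
Proof.
move=> [[lin br] _ [v [v0 hv ev]]] ir.
have eS := raising_in_sp C r i; have fS := raising_tr_in_sp i.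
have hS := cartan_in_sp (eps i - eps i.+1 : 'rV[C]_r).
rewrite label_form //.
apply: (@sl2_highest_weight C n (tau (raising C r i)) (tau (raising C r i)^T)
  (tau (cartan (eps i - eps i.+1))) v) => //; last exact: ev.
- by rewrite -br // coroot_bracket.
- rewrite -br // coroot_lowering //.
  (* [is_rep] gives linearity for [a *: X + Y], so -2A is written as -3A + A. *)
  have three p (A : 'M[C]_p) : A *- 2 = - 3%:R *: A + A.
    by rewrite -{3}[A]scale1r -scalerDl -scaler_nat -scaleNr; congr (_ *: _); ring.
  by rewrite (three (r + r)%N) lin // -three.
Qed.

(** A tensor product of Fock spaces, one for each fundamental weight in the sum, carries a singular
    vector of that weight; irreducibility comes later from [irr_component]. *)
Lemma fundamental_sum_exists (n : nat -> nat) : exists N (rho : 'M[C]_(r + r) -> 'M[C]_N) v,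
  star_rep rho /\ highest_weight_vector rho (\sum_(1 <= i < r.+1) omega i *+ n i) v.
Proof.
pose P nu := exists N (rho : 'M[C]_(r + r) -> 'M[C]_N) v,
  star_rep rho /\ highest_weight_vector rho nu v.
have PD nu1 nu2 : P nu1 -> P nu2 -> P (nu1 + nu2).
  move=> [N1 [rho1 [v1 [s1 h1]]]] [N2 [rho2 [v2 [s2 h2]]]].
  exists (N1 * N2)%N, (tensor_rep rho1 rho2), (vtens v1 v2).
  by split; [exact: star_rep_tensor | exact: hwv_tensor].
have P0 : P 0.
  exists 1%N, (fun _ => 0), 1%:M; split; first split.
  - by split=> [a|] X Y _ _; rewrite ?scaler0 ?addr0 ?mulmx0 ?subr0.
  - by move=> X _; rewrite trmx0 map_mx0.
  - split; first exact: matrix_nonzero1.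
      by move=> d; rewrite mul0mx big1 ?scale0r // => j _; rewrite mxE mul0r.
    by move=> i _; rewrite mul0mx.
rewrite big_nat; elim/big_ind: _ => // i /andP[i1 ir].
elim: (n i) => // m IHm; rewrite mulrS; apply: PD IHm.
have [N [a [Om [aa ac Om0 aOm]]]] := car_family_exists C (r + r).
exists N, (fock_rep a), (filled a Om i); split; first exact: star_rep_fock.
exact: hwv_filled.
Qed.

Lemma hwvN n (rho : 'M[C]_(r + r) -> 'M[C]_n) mu v :
  highest_weight_vector rho mu v -> highest_weight_vector rho mu (- v).
Proof.
move=> [v0 hv ev]; split; first by rewrite oppr_eq0.
- by move=> d; rewrite mulmxN hv scalerN.
- by move=> i ir; rewrite mulmxN ev ?oppr0.
Qed.

Lemma vtens_act_r m n (A : 'M[C]_n) (v : 'cV[C]_m) w :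
  (1%:M *t A) *m vtens v w = vtens v (A *m w).
Proof.
have E : (1%:M *t A) *m (v *t w) = v *t (A *m w) by rewrite tensmx_mul mul1mx.
exact: E.
Qed.

(* The fundamental modules are realized in the Fock space, where the
   annihilation operators carry the highest weight vector of V_(omega k.+1)
   to that of V_(omega k), and the creation operators do the converse. *)
Lemma vector_summands (n : nat -> nat) (k : 'I_r)
    (nu := \sum_(1 <= i < r.+1) omega i *+ n i) (lam := nu + omega k) (mu := nu + omega k.+1) :
  (exists m p (sigma : 'M[C]_(r + r) -> 'M[C]_m) (tau : 'M[C]_(r + r) -> 'M[C]_p),
    [/\ is_V lam sigma, is_V mu tau & is_summand tau (tensor_rep sigma (@vector_rep C r))]) /\
  (exists m p (sigma : 'M[C]_(r + r) -> 'M[C]_m) (tau : 'M[C]_(r + r) -> 'M[C]_p),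
    [/\ is_V mu sigma, is_V lam tau & is_summand tau (tensor_rep sigma (@vector_rep C r))]).
Proof.
have [M [sigma [y [ssig hy]]]] := fundamental_sum_exists n; rewrite -/nu in hy.
have [N [a [Om [aa ac Om0 aOm]]]] := car_family_exists C (r + r).
have sfock := star_rep_fock aa ac.
have stens := star_rep_tensor ssig sfock.
have hw j : (j <= r)%N -> highest_weight_vector (tensor_rep sigma (fock_rep a))
    (nu + omega j) (vtens y (filled a Om j)).
  by move=> jr; apply: hwv_tensor hy _; apply: hwv_filled.
have kr : (k < r + r)%N by rewrite ltn_addr.
split.
- have cov : covariant (fock_rep a) (fun j : 'I_(r + r) => a j).
    by move=> X HX j; apply: fock_rep_a.
  apply: (@covariant_summand _ _ _ _ _ _ _ _ (lshift r k) stens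
    (covariant_tensor sigma cov) (hw k.+1 (ltn_ord k))).
  by rewrite vtens_act_r (filled_annihilate ac aOm) //; apply: hw; apply: ltnW.
- have cov : covariant (fock_rep a)
      (fun j : 'I_(r + r) => \sum_i symp_form C r j i *: (a i)^t*).
    by apply: covariant_symp => X j HX; apply: fock_rep_adj.
  (* Row [r + k] of the symplectic form selects the creation operator of mode [k], with a minus
     sign. *)
  apply: (@covariant_summand _ _ _ _ _ _ _ _ (rshift r k) stens
    (covariant_tensor sigma cov) (hw k (ltnW (ltn_ord k)))).
  rewrite vtens_act_r mulmx_suml big_split_ord /= [X in _ + X]big1 => [|j _]; last first.
    by rewrite block_mxEdr mxE scale0r mul0mx.
  rewrite (bigD1 k) //= big1 => [|j jk]; last first.
    by rewrite block_mxEdl !mxE eq_sym (negPf jk) oppr0 scale0r mul0mx.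
  rewrite !addr0 block_mxEdl !mxE eqxx scaleN1r mulNmx.
  rewrite -scaleN1r vtensZr scaleN1r; apply: hwvN; exact: hw k.+1 _.
Qed.

End Admissibility.

(** * The admissibility criterion *)

Section Criterion.
Variables (C : numClosedFieldType) (r : nat) (lam : 'rV[C]_r) (n : nat -> nat).
Hypothesis r0 : (0 < r)%N.
Hypothesis lamE : forall i, (1 <= i <= r)%N -> label lam i = (n i)%:R.

Lemma sum_alpha a b : (a <= b <= r)%N ->
  \sum_(a <= i < b) alpha i = eps a - eps b :> 'rV[C]_r.
Proof.
elim: b => [|b IHb] /andP[ab br].
  by move: ab; rewrite leqn0 => /eqP ->; rewrite big_geq // subrr.
move: ab; rewrite leq_eqVlt ltnS => /orP[/eqP->|ab]; first by rewrite big_geq // subrr.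
rewrite big_nat_recr //= IHb ?ab ?(ltnW br) // /alpha ltn_eqF //.
by rewrite addrA subrK.
Qed.

Lemma omega1 : omega 1 = eps 1 :> 'rV[C]_r.
Proof. by rewrite omegaS omega0 add0r. Qed.

Let shift ls := \sum_(1 <= i < r.+1) alpha i *+ nth 0%N ls i.-1 : 'rV[C]_r.

Lemma shift_single k : (k < r)%N ->
  shift (nseq k 1%N ++ nseq (r - k) 0%N) = eps 1 - eps k.+1.
Proof.
move=> kr; rewrite /shift (big_cat_nat (n := k.+1)) //= ?ltnS ?(ltnW kr) //.
rewrite [X in _ + X]big_nat [X in _ + X]big1 => [|[//|i] /andP[ki ir] /=].
  rewrite addr0 -sum_alpha ?kr //; apply: eq_big_nat => -[//|i] /andP[_ ik] /=.
  by rewrite nth_cat size_nseq nth_nseq -ltnS ik mulr1n.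
by rewrite nth_cat size_nseq !nth_nseq ltnNge -ltnS ki /=; case: ifP; rewrite mulr0n.
Qed.

Lemma shift_all : shift (nseq r 1%N) = eps 1 + eps r.
Proof.
rewrite /shift big_nat_recr //= nth_nseq prednK // leqnn /alpha eqxx mulr1n mulr2n.
rewrite addrA; congr (_ + _); rewrite -[RHS](subrK (eps r)) -sum_alpha ?r0 ?leqnn //.
congr (_ + _); apply: eq_big_nat => -[//|i] /andP[_ ir] /=.
by rewrite nth_nseq ltnW // mulr1n /alpha.
Qed.

Lemma shift_double k : (k < r.-1)%N ->
  shift (nseq k 1%N ++ nseq (r - 1 - k) 2%N ++ [:: 1%N]) = eps 1 + eps k.+1.
Proof.
move=> kr; have kr1 : (k < r)%N by rewrite (leq_trans kr) ?leq_pred.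
rewrite /shift big_nat_recr //= (big_cat_nat (n := k.+1)) //=.
have -> : \sum_(1 <= i < k.+1) alpha i *+ nth 0%N
    (nseq k 1%N ++ nseq (r - 1 - k) 2%N ++ [:: 1%N]) i.-1 = eps 1 - eps k.+1 :> 'rV[C]_r.
  rewrite -sum_alpha ?kr1 //; apply: eq_big_nat => -[//|i] /andP[_ ik] /=.
  by rewrite nth_cat size_nseq nth_nseq -ltnS ik mulr1n.
have -> : \sum_(k.+1 <= i < r) alpha i *+ nth 0%N
    (nseq k 1%N ++ nseq (r - 1 - k) 2%N ++ [:: 1%N]) i.-1 = (eps k.+1 - eps r) *+ 2 :> 'rV[C]_r.
  rewrite -sum_alpha ?leqnn ?andbT // -sumrMnl; apply: eq_big_nat => -[//|i] /andP[ki ir] /=.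
  have ik : (i - k < r - 1 - k)%N by lia.
  by rewrite nth_cat size_nseq ltnNge -ltnS ki /= nth_cat size_nseq ik nth_nseq ik.
have -> : nth 0%N (nseq k 1%N ++ nseq (r - 1 - k) 2%N ++ [:: 1%N]) r.-1 = 1%N.
  have kr' : (r.-1 < k)%N = false by lia.
  by rewrite nth_cat size_nseq kr' /= nth_cat size_nseq subn1 ltnn subnn.
rewrite mulr1n /alpha eqxx; move: (eps 1) (eps k.+1) (eps r) => x y z.
by apply/rowP => j; rewrite !mxE; ring.
Qed.

Lemma label_add_eps d k : (1 <= d <= r)%N -> (1 <= k <= r)%N ->
  label (lam + eps k) d = (n d)%:R + ((k == d)%:R - (k == d.+1)%:R).
Proof.
move=> dr kr; rewrite label_form // formDl -label_form // lamE // formBr.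
by rewrite !form_eps.
Qed.

Lemma label_sub_eps d k : (1 <= d <= r)%N -> (1 <= k <= r)%N ->
  label (lam - eps k) d = (n d)%:R - ((k == d)%:R - (k == d.+1)%:R).
Proof.
move=> dr kr; rewrite label_form // formBl -label_form // lamE // formBr.
by rewrite !form_eps.
Qed.

(** For [k > 0] the label of [mu] at [k] is [n k - 1], and highest weights have natural labels.
    Conversely one [omega k] inside [lam] is exchanged for [omega k.+1]; for [k = 0] it is the zero
    weight. *)
Lemma admissible_add ls k : (k < r)%N -> shift ls = eps 1 - eps k.+1 ->
  admissible lam ls <-> ((0 < k)%N -> (0 < n k)%N).
Proof.
move=> kr lsE.
have muE : lam + omega 1 - shift ls = lam + eps k.+1.
  by rewrite lsE omega1 opprB addrCA addrK addrC.
rewrite /admissible -/(shift ls) muE; split.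
  move=> [m [n' [p [rho [sigma [tau [_ _ Vmu _]]]]]]] k0.
  have dr : (1 <= k <= r)%N by rewrite k0 ltnW.
  have [q] := is_V_dominant Vmu dr.
  rewrite label_add_eps ?kr // eqxx gtn_eqF // sub0r => /eqP.
  by rewrite subr_eq natr1 eqr_nat => /eqP ->.
move=> nk.
have [n' lamE'] : exists n', lam = \sum_(1 <= i < r.+1) omega i *+ n' i + omega k.
  case: (posnP k) => [->|k0].
    exists n; rewrite omega0 addr0 {1}[lam]weight_sum_labels.
    by apply: eq_big_nat => i /andP[i1 ir]; rewrite lamE ?i1 // scaler_nat.
  have [|n' E] := @dominant_pred _ _ lam n k _ (nk k0) lamE; first by rewrite k0 ltnW.
  by exists n'; rewrite addrC.
have [[m [p [rho [tau [V1 V2 S]]]]] _] := @vector_summands C r n' (Ordinal kr).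
exists m, (r + r)%N, p, rho, (@vector_rep C r), tau; split=> //.
- by rewrite lamE'.
- exact: is_V_vector_rep.
- by move: V2; rewrite /= omegaS addrA -lamE'.
Qed.

(** The label of [mu] at [d] is [n d - 1]; conversely one [omega d] inside [lam] is exchanged for
    [omega d.-1]. *)
Lemma admissible_sub ls d : (1 <= d <= r)%N -> shift ls = eps 1 + eps d ->
  admissible lam ls <-> (0 < n d)%N.
Proof.
move=> dr lsE.
have muE : lam + omega 1 - shift ls = lam - eps d.
  by rewrite lsE omega1 opprD addrA addrK.
rewrite /admissible -/(shift ls) muE; split.
  move=> [m [n' [p [rho [sigma [tau [_ _ Vmu _]]]]]]].
  have [q] := is_V_dominant Vmu dr.
  rewrite label_sub_eps // eqxx ltn_eqF // subr0 => /eqP.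
  by rewrite subr_eq natr1 eqr_nat => /eqP ->.
move=> nd; have [n' lamE'] := dominant_pred dr nd lamE.
case: d dr lamE' {nd lsE muE} => // d /= dr lamE'.
have [_ [m [p [rho [tau [V1 V2 S]]]]]] := @vector_summands C r n' (Ordinal dr).
exists m, (r + r)%N, p, rho, (@vector_rep C r), tau; split=> //.
- by move: V1; rewrite /= addrC -lamE'.
- exact: is_V_vector_rep.
- by rewrite lamE' omegaS addrAC addrK addrC.
Qed.

End Criterion.

(** * Reproduction of solutions *)

Section LocalEquations.
Variable K : numFieldType.
Implicit Types A a b c g h x S N : K.

(* With y = x^2 - S x + N and Y = x^2 - S' x + N', the coefficients of
   (A + 1) y (x - g) + x (y - y' (x - g)) = A (x - h) Y. *)
Definition reproduction A h g S N S' N' :=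
  [/\ (A + 1) * S + (A - 1) * g = A * (h + S'),
      (A + 2%:R) * N + A * S * g = A * (N' + S' * h) &
      (A + 1) * N * g = A * h * N'].

(** Leaves it to [ring] or [field] to check that the goal is [k] times a known equation. *)
Lemma linear_combination (x y u v k : K) : u = v -> x - y = k * (u - v) -> x = y.
Proof. by move=> ->; rewrite subrr mulr0 => /eqP; rewrite subr_eq0 => /eqP. Qed.

Lemma reproductionE A h g S N S' N' x : reproduction A h g S N S' N' ->
  (A + 1) * (x ^+ 2 - S * x + N) * (x - g) + x * (x ^+ 2 - S * x + N)
    - x * (2%:R * x - S) * (x - g) = A * (x - h) * (x ^+ 2 - S' * x + N').
Proof.
move=> [E1 E2 E3]; apply/eqP; rewrite -subr_eq0; apply/eqP.
transitivity (- x ^+ 2 * ((A + 1) * S + (A - 1) * g - A * (h + S'))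
  + x * ((A + 2%:R) * N + A * S * g - A * (N' + S' * h))
  - ((A + 1) * N * g - A * h * N')); first by ring.
by rewrite E1 E2 E3 !subrr !mulr0 addr0 subr0.
Qed.

Lemma two_fractions a b x : x != a -> x != b ->
  (x - a)^-1 + (x - b)^-1 = (2%:R * x - (a + b)) / (x ^+ 2 - (a + b) * x + a * b).
Proof.
rewrite -subr_eq0 -[x == b]subr_eq0 => xa xb.
have -> : x ^+ 2 - (a + b) * x + a * b = (x - a) * (x - b) by ring.
by field; rewrite xa xb.
Qed.

Lemma quadratic_neq0 a b x : x != a -> x != b -> x ^+ 2 - (a + b) * x + a * b != 0.
Proof.
rewrite -subr_eq0 -[x == b]subr_eq0 => xa xb.
have -> : x ^+ 2 - (a + b) * x + a * b = (x - a) * (x - b) by ring.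
by rewrite mulf_neq0.
Qed.

(** The Bethe equation at [a] cleared of denominators: with F(x) = (x - h) Y(x), the logarithmic
    derivative of x^A F at [a] is 2/(a - b). *)
Lemma root_equation A h a b a' b' : a != 0 -> a != b -> a != h -> a != a' -> a != b' ->
  A / a + (a - h)^-1 + ((a - a')^-1 + (a - b')^-1) = 2%:R / (a - b) ->
  let F x := (x - h) * (x ^+ 2 - (a' + b') * x + a' * b') in
  let F' x := (x ^+ 2 - (a' + b') * x + a' * b') + (x - h) * (2%:R * x - (a' + b')) in
  a * (a - b) * F' a = (2%:R * a - A * (a - b)) * F a.
Proof.
move=> a0; rewrite -subr_eq0 -![a == _]subr_eq0 => ab ah aa ab' E F F'.
have : (a * (a - b) * (a - h) * (a - a') * (a - b')) *
  (A / a + (a - h)^-1 + ((a - a')^-1 + (a - b')^-1)) =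
  (a * (a - b) * (a - h) * (a - a') * (a - b')) * (2%:R / (a - b)) by rewrite E.
have -> : a * (a - b) * (a - h) * (a - a') * (a - b') * (2%:R / (a - b)) =
  2%:R * a * F a by rewrite /F; field; rewrite ab.
have -> : a * (a - b) * (a - h) * (a - a') * (a - b') *
  (A / a + (a - h)^-1 + ((a - a')^-1 + (a - b')^-1)) =
  A * (a - b) * F a + a * (a - b) * F' a.
  by rewrite /F /F'; field; rewrite a0 ah aa ab'.
by move=> E'; rewrite mulrBl -E' addrAC subrr add0r.
Qed.

(** The two sides of the identity agree in degree 3, so their difference D is quadratic. The choice
    of [g] makes D vanish at [a], the equation at [a] makes D' vanish there too, so D is [d2] times
    the square of x - a; the equation at [b] then leaves [A * (b - a) ^+ 3 * d2 = 0]. *)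
Lemma reproduction_exists A h a b a' b' : A != 0 -> a != b -> a != 0 -> b != 0 ->
  a != h -> b != h -> a != a' -> a != b' -> b != a' -> b != b' ->
  A / a + (a - h)^-1 + ((a - a')^-1 + (a - b')^-1) = 2%:R / (a - b) ->
  A / b + (b - h)^-1 + ((b - a')^-1 + (b - b')^-1) = 2%:R / (b - a) ->
  exists g, reproduction A h g (a + b) (a * b) (a' + b') (a' * b').
Proof.
move=> A0 ab a0 b0 ah bh aa' ab' ba' bb' Ea Eb.
have {Ea} Ea := root_equation a0 ab ah aa' ab' Ea.
have ba : b != a by rewrite eq_sym.
have {Eb} Eb := root_equation b0 ba bh ba' bb' Eb.
move: (a' + b') (a' * b') Ea Eb => S' N' /= Ea Eb.
have ab0 : a - b != 0 by rewrite subr_eq0.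
set Fa := (a - h) * (a ^+ 2 - S' * a + N') in Ea.
set Fb := (b - h) * (b ^+ 2 - S' * b + N') in Eb.
(* The solution of D(a) = 0: at [a] the left side of the identity reduces to
   [- a * (a - b) * (a - g)]. *)
pose g := a + A * Fa / (a * (a - b)).
have Eg : a * (a - b) * (a - g) = - (A * Fa).
  by rewrite /g; field; rewrite a0 ab0.
pose d2 := A * (h + S') - ((A + 1) * (a + b) + (A - 1) * g).
pose d1 := (A + 2%:R) * (a * b) + A * (a + b) * g - A * (N' + S' * h).
pose d0 := A * h * N' - (A + 1) * (a * b) * g.
have Da : d2 * a ^+ 2 + d1 * a + d0 = 0.
  transitivity (- (a * (a - b) * (a - g)) - A * Fa).
    by rewrite /d2 /d1 /d0 /Fa; ring.
  by rewrite Eg opprK subrr.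
have Da' : 2%:R * d2 * a + d1 = 0.
  apply: (mulfI (mulf_neq0 a0 ab0)); rewrite mulr0.
  transitivity ((2%:R * a - A * (a - b)) * (d2 * a ^+ 2 + d1 * a + d0)
    - A * (a * (a - b) * (a ^+ 2 - S' * a + N' + (a - h) * (2%:R * a - S'))
           - (2%:R * a - A * (a - b)) * Fa)); last by rewrite Da Ea subrr !mulr0 subrr.
  by rewrite /d2 /d1 /d0 /Fa; ring.
have d1E : d1 = - (2%:R * d2 * a) by apply/eqP; rewrite -addr_eq0 addrC Da'.
have d0E : d0 = d2 * a ^+ 2.
  by apply: (linear_combination (k := 1) Da); rewrite d1E; ring.
have Db : b * (b - a) * (2%:R * d2 * b + d1) =
    (2%:R * b - A * (b - a)) * (d2 * b ^+ 2 + d1 * b + d0).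
  apply: (linear_combination (k := - A) Eb).
  by rewrite /d2 /d1 /d0 /Fb; ring.
have d20 : d2 = 0.
  have : A * (b - a) ^+ 3 * d2 = 0.
    apply: (linear_combination (k := 1) Db); rewrite d0E d1E; ring.
  move/eqP; rewrite mulf_eq0 mulf_eq0 (negPf A0) expf_eq0 /= subr_eq0 (negPf ba) /=.
  by move/eqP.
exists g; split.
- by apply: esym; apply: (linear_combination (k := 1) d20); rewrite /d2; ring.
- have d10 : d1 = 0 by rewrite d1E d20 mulr0 mul0r oppr0.
  by apply: (linear_combination (k := 1) d10); rewrite /d1; ring.
- have d00 : d0 = 0 by rewrite d0E d20 mul0r.
  by apply: esym; apply: (linear_combination (k := 1) d00); rewrite /d0; ring.
Qed.

(* A root may lie at the singular point x = 0 when its label vanishes; the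
   equation at the other root then still determines g, provided h = 0. *)
Lemma reproduction_exists0 A b a' b' : b != 0 -> b != a' -> b != b' ->
  A / b + (b - 0)^-1 + ((b - a')^-1 + (b - b')^-1) = 2%:R / (b - 0) ->
  exists g, reproduction A 0 g b 0 (a' + b') (a' * b').
Proof.
rewrite subr0 => b0 ba' bb'; rewrite two_fractions //.
have := quadratic_neq0 ba' bb'.
(* With one root and [h] both 0, the middle coefficient of the reproduction reads
   [A * b * g = A * N']. *)
move: (a' + b') (a' * b') => S' N' Y0 E; exists (N' / b).
have E' : (A + 1) * b ^+ 2 - A * S' * b + (A - 1) * N' = 0.
  have E0 : A / b + b^-1 + (2%:R * b - S') / (b ^+ 2 - S' * b + N') - 2%:R / b = 0.
    by rewrite E subrr.
  rewrite -[LHS](mul1r) -(mulr0 (b * (b ^+ 2 - S' * b + N'))) -E0 mul1r.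
  by field; rewrite b0 Y0.
split; [|by field|by ring].
apply: (linear_combination (k := b^-1) E'); field; exact: b0.
Qed.

(* The reproduction at A = 0 would need two distinct double interpolation
   conditions on a monic cubic that force (a - b)^3 = 0. *)
Lemma reproduction_obstruction h a b a' b' : a != b ->
  a != h -> b != h -> a != a' -> a != b' -> b != a' -> b != b' ->
  (a - h)^-1 + ((a - a')^-1 + (a - b')^-1) = 2%:R / (a - b) ->
  (b - h)^-1 + ((b - a')^-1 + (b - b')^-1) = 2%:R / (b - a) -> False.
Proof.
have clear x y : x != y -> x != h -> x != a' -> x != b' ->
  (x - h)^-1 + ((x - a')^-1 + (x - b')^-1) = 2%:R / (x - y) ->
  (x - y) * ((x - a') * (x - b') + (x - h) * (2%:R * x - (a' + b'))) =
  2%:R * ((x - h) * (x - a') * (x - b')).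
  rewrite -subr_eq0 -![x == _]subr_eq0 => xy xh xa xb E.
  transitivity ((x - y) * (x - h) * (x - a') * (x - b') *
     ((x - h)^-1 + ((x - a')^-1 + (x - b')^-1))); first by field; rewrite xh xa xb.
  by rewrite E; field.
move=> ab ah bh aa' ab' ba' bb' Ea Eb.
have {}Ea := clear a b ab ah aa' ab' Ea.
have ba : b != a by rewrite eq_sym.
have {}Eb := clear b a ba bh ba' bb' Eb.
have : (a - b) ^+ 3 = 0.
  transitivity
   (((a - b) * ((a - a') * (a - b') + (a - h) * (2%:R * a - (a' + b')))
    - 2%:R * ((a - h) * (a - a') * (a - b'))) -
   ((b - a) * ((b - a') * (b - b') + (b - h) * (2%:R * b - (a' + b')))
    - 2%:R * ((b - h) * (b - a') * (b - b')))); first by ring.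
  by rewrite Ea Eb !subrr.
by move/eqP; rewrite expf_eq0 subr_eq0 (negPf ab).
Qed.

(** Where the right side of the identity vanishes, dividing the left side by x (x - g) y(x) trades
    the interaction with the two roots of y for one with [g] and a raised label. *)
Lemma reproduction_log_derivative A h g a b S' N' x :
  reproduction A h g (a + b) (a * b) S' N' ->
  (x - h) * (x ^+ 2 - S' * x + N') = 0 -> x != 0 -> x != a -> x != b ->
  x != g /\ (x - a)^-1 + (x - b)^-1 = (A + 1) / x + (x - g)^-1.
Proof.
move=> /(reproductionE x) E Y0 x0 xa xb.
rewrite -(mulrA A) Y0 mulr0 in E; rewrite two_fractions //.
have y0 := quadratic_neq0 xa xb; move: (a + b) (a * b) E y0 => S N E y0.
have xg : x - g != 0.
  apply/eqP => xg; move: E; rewrite xg !mulr0 subr0 add0r => /eqP.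
  by rewrite mulf_eq0 (negPf x0) (negPf y0).
split; first by rewrite -subr_eq0.
apply/eqP; rewrite -subr_eq0 -oppr_eq0; apply/eqP.
rewrite -(mul0r (x * (x - g) * (x ^+ 2 - S * x + N))^-1) -E.
by field; rewrite x0 xg y0.
Qed.

(** Converse of [reproduction_exists]: the identity and its derivative at the root [a] give the
    value and the derivative of (x - h) Y there, the value being nonzero. *)
Lemma reproduction_root A h g a b a' b' :
  reproduction A h g (a + b) (a * b) (a' + b') (a' * b') ->
  A != 0 -> a != 0 -> a != b -> a != g ->
  [/\ a != h, a != a', a != b' &
   A / a + (a - h)^-1 + ((a - a')^-1 + (a - b')^-1) = 2%:R / (a - b)].
Proof.
move=> rep A0 a0 ab ag.
have E := reproductionE a rep.
have EF : A * ((a - h) * ((a - a') * (a - b'))) = - (a * (a - b) * (a - g)).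
  by apply: esym; apply: (linear_combination (k := 1) E); ring.
move: ab ag; rewrite -subr_eq0 -[a == g]subr_eq0 => ab ag.
have : A * ((a - h) * ((a - a') * (a - b'))) != 0.
  by rewrite EF oppr_eq0 !mulf_neq0.
rewrite !mulf_eq0 (negPf A0) !negb_or /= => /and3P[ah aa ab'].
split; [by rewrite -subr_eq0|by rewrite -subr_eq0|by rewrite -subr_eq0|].
(* The derivative of the identity of reproductionE at the root a. *)
have ED : A * ((a - a') * (a - b') + (a - h) * (2%:R * a - (a' + b'))) =
    (A * (a - b) - 2%:R * a) * (a - g).
  case: rep => E1 E2 _.
  apply/eqP; rewrite -subr_eq0; apply/eqP.
  transitivity (2%:R * a * ((A + 1) * (a + b) + (A - 1) * g - A * (h + (a' + b')))
    - ((A + 2%:R) * (a * b) + A * (a + b) * g - A * (a' * b' + (a' + b') * h))).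
    by ring.
  by rewrite E1 E2 !subrr mulr0 subr0.
apply: (mulfI (mulf_neq0 A0 (mulf_neq0 ah (mulf_neq0 aa ab')))).
transitivity (A * ((a - h) * ((a - a') * (a - b'))) * (A / a) +
   A * ((a - a') * (a - b') + (a - h) * (2%:R * a - (a' + b')))).
  by field; rewrite a0 ah aa ab'.
by rewrite ED EF; field; rewrite a0 ab.
Qed.

(* Eliminating S and N from the reproduction identity. *)
Lemma reproduction_elim A h g S N S' N' kap : reproduction A h g S N S' N' ->
  A != 0 -> g ^+ 2 - S' * g + N' != 0 ->
  g * (2%:R * g - S') = kap * (g ^+ 2 - S' * g + N') ->
  g + (g - h) * kap = (A + 2%:R) * (g - h).
Proof.
move=> [E1 E2 E3] A0 Y0 EY.
have E : (A + 2%:R) * (A * h * N') + A * g ^+ 2 * (A * (h + S') - (A - 1) * g)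
    = (A + 1) * g * (A * (N' + S' * h)).
  by rewrite -E3 -E1 -E2; ring.
apply: (mulfI (mulf_neq0 A0 Y0)).
transitivity (A * (g * (g ^+ 2 - S' * g + N') + (g - h) * (kap * (g ^+ 2 - S' * g + N'))));
  first by ring.
rewrite -EY; apply: (linear_combination (k := 1) E); ring.
Qed.

(** For given [h], [g] and right-hand quadratic, the outer coefficients are linear in [S] and in
    [N], with factors [A + 1] and [(A + 1) * g]. *)
Lemma reproduction_det A h g S N S1 N1 S' N' :
  A + 1 != 0 -> g != 0 ->
  reproduction A h g S N S' N' -> reproduction A h g S1 N1 S' N' -> S = S1 /\ N = N1.
Proof.
move=> A1 g0 [E1 _ E3] [F1 _ F3]; split.
  by apply: (mulfI A1); apply: (addIr ((A - 1) * g)); rewrite E1 F1.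
by apply: (mulfI A1); apply: (mulIf g0); rewrite E3 F3.
Qed.

Lemma chain_step lam kap x x0 : x != 0 -> x != x0 ->
  lam / x + (x - x0)^-1 + kap / x = 0 -> (lam + kap + 1) * x = (lam + kap) * x0.
Proof.
move=> x1; rewrite -subr_eq0 => xx0 E.
apply/eqP; rewrite -subr_eq0; apply/eqP.
rewrite -(mulr0 (x * (x - x0))) -E; field; by rewrite xx0 x1.
Qed.

End LocalEquations.

(** * Chains of linear polynomials *)

Section Chains.
Variable K : numFieldType.
Implicit Types (e x : K) (T L f w : nat -> K).

Definition ratio e := e / (e + 1).

Lemma succ_neq0 e : 0 <= e -> e + 1 != 0.
Proof. by move=> e0; rewrite gt_eqF // ltr_wpDl. Qed.

Lemma ratio_gt0 e : 0 < e -> 0 < ratio e.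
Proof. by move=> e0; rewrite divr_gt0 // addr_gt0. Qed.

Lemma ratio_lt1 e : 0 <= e -> ratio e < 1.
Proof. by move=> e0; rewrite ltr_pdivrMr ?mul1r ?ltrDl // ltr_wpDl. Qed.

Lemma ratio_neq1 e : 0 <= e -> ratio e != 1.
Proof. by move=> e0; rewrite lt_eqF // ratio_lt1. Qed.

Lemma ratio_fixed e x : 0 <= e -> x = ratio e * x -> x = 0.
Proof.
move=> e0 /eqP; rewrite -subr_eq0 -{1}[x]mul1r -mulrBl mulf_eq0 subr_eq0.
by rewrite eq_sym (negPf (ratio_neq1 e0)) => /eqP.
Qed.

Lemma ratio_solve e x x0 : 0 <= e -> (e + 1) * x = e * x0 -> x = ratio e * x0.
Proof.
move=> e0 E; apply: (mulfI (succ_neq0 e0)); rewrite E /ratio.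
by field; exact: succ_neq0.
Qed.

Lemma inv_sub_next e x : 0 <= e -> (x - ratio e * x)^-1 = (e + 1) / x.
Proof.
move=> e0; have e1 := succ_neq0 e0.
have -> : x - ratio e * x = x / (e + 1) by rewrite /ratio; field.
by rewrite invf_div.
Qed.

Lemma inv_sub_prev e x : 0 < e -> (ratio e * x - x)^-1 = - e / (ratio e * x).
Proof.
move=> e0; have [->|x0] := eqVneq x 0; first by rewrite !mulr0 subr0 invr0 mulr0.
have e1 := succ_neq0 (ltW e0); have e00 : e != 0 by rewrite gt_eqF.
rewrite -opprB invrN inv_sub_next ?(ltW e0) // /ratio.
by field; rewrite x0 e1 e00.
Qed.

(** Once [T i.+1] is a ratio of [T i], its interaction with [T i] is a multiple of [1 / T i] and
    merges with the label: [f i] is the effective label of color [i]. Nonvanishing also propagates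
    downwards, since [T i = 0] would force [T i.+1 = 0]. *)
Lemma chain_down L T f w m :
  (forall i, (1 <= i <= m)%N -> 0 < f i) ->
  (forall i, (1 <= i < m)%N -> f i = L i + w i * (f i.+1 + 1)) ->
  (forall i, (1 <= i < m)%N -> [/\ T i != T i.-1, T i != T i.+1 &
     L i / T i + (T i - T i.-1)^-1 + w i / (T i - T i.+1) = 0]) ->
  ((0 < m)%N -> T m != 0 /\ T m = ratio (f m) * T m.-1) ->
  forall i, (1 <= i <= m)%N -> T i != 0 /\ T i = ratio (f i) * T i.-1.
Proof.
move=> f0 fE TE Tm i /andP[i1 im].
have m0 : (0 < m)%N by rewrite (leq_trans i1).
move: {2}(m - i)%N (leqnn (m - i)) => n; elim: n i i1 im => [|n IHn] i i1 im mi.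
  have -> : i = m by apply/eqP; rewrite eqn_leq im -subn_eq0 -leqn0.
  exact: Tm.
have [im'|mi'] := ltnP i m; last first.
  have -> : i = m by apply/eqP; rewrite eqn_leq im.
  exact: Tm.
have mi' : (m - i.+1 <= n)%N by lia.
have [T1 T1E] := IHn i.+1 isT im' mi'.
have [Tp Tn E] := TE i (introT andP (conj i1 im')).
have f1 : 0 <= f i.+1 by rewrite ltW // f0.
have T0 : T i != 0.
  by apply: contraNneq T1 => T0; rewrite T1E /= T0 mulr0.
split=> //; apply: ratio_solve; first by rewrite ltW // f0 // i1.
rewrite fE ?i1 //; apply: chain_step => //.
by rewrite -E T1E /= inv_sub_next // mulrA.
Qed.

Definition chain f i := \prod_(1 <= j < i.+1) ratio (f j).

Lemma chain0 f : chain f 0 = 1.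
Proof. by rewrite /chain big_geq. Qed.

Lemma chainS f i : chain f i.+1 = ratio (f i.+1) * chain f i.
Proof. by rewrite /chain big_nat_recr //= mulrC. Qed.

Lemma chain_unique T f m : T 0%N = 1 ->
  (forall i, (1 <= i <= m)%N -> T i = ratio (f i) * T i.-1) ->
  forall i, (i <= m)%N -> T i = chain f i.
Proof.
move=> T0 TE; elim=> [|i IHi] im; first by rewrite chain0.
by rewrite TE ?im // chainS /= IHi // ltnW.
Qed.

Lemma chain_neq0 f i : (forall j, (1 <= j <= i)%N -> 0 < f j) -> chain f i != 0.
Proof.
elim: i => [|i IHi] f0; first by rewrite chain0 oner_eq0.
rewrite chainS mulf_neq0 // ?IHi // => [|j /andP[j1 ji]].
  by rewrite gt_eqF // ratio_gt0 // f0 // ltnS leqnn.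
by rewrite f0 // j1 ltnW.
Qed.

Lemma chain_neq_prev f i : (1 <= i)%N -> (forall j, (1 <= j <= i)%N -> 0 < f j) ->
  chain f i != chain f i.-1.
Proof.
case: i => // i _ f0; rewrite chainS /=; apply/eqP => /esym E.
have: chain f i != 0 by apply: chain_neq0 => j /andP[j1 ji]; rewrite f0 // j1 leqW.
by rewrite (ratio_fixed _ E) ?eqxx // ltW // f0 // ltnS leqnn.
Qed.

Lemma chain_equation L f w i : (1 <= i)%N -> (forall j, (1 <= j <= i.+1)%N -> 0 < f j) ->
  f i = L i + w i * (f i.+1 + 1) ->
  L i / chain f i + (chain f i - chain f i.-1)^-1 + w i / (chain f i - chain f i.+1) = 0.
Proof.
case: i => // i _ f0 fE.
rewrite [chain f i.+2]chainS inv_sub_next; last by rewrite ltW // f0 // ltnS leqnn.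
rewrite [chain f i.+1]chainS /= inv_sub_prev; last by rewrite f0 // ltnS leqnSn.
by rewrite mulrA -!mulrDl fE; apply/eqP; rewrite mulf_eq0; apply/orP; left; apply/eqP; ring.
Qed.

Lemma chain_last_equation L f i : (1 <= i)%N -> 0 < f i -> f i = L i ->
  L i / chain f i + (chain f i - chain f i.-1)^-1 = 0.
Proof.
case: i => // i _ f0 fE.
by rewrite chainS /= inv_sub_prev // -fE mulNr subrr.
Qed.

Section Single.
Variables (r l : nat) (L : nat -> K).
Let w i : K := if i.+1 == r then 2%:R else 1.

(** The point z_2 = 1, which only color 1 sees, acts as the root [T 0] of a color 0. *)
Definition single_bethe T := forall i, (1 <= i <= l)%N ->
  [/\ L i != 0 -> T i != 0, T i != T i.-1, (i < l)%N -> T i != T i.+1 &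
      L i / T i + (T i - T i.-1)^-1 + (if (i < l)%N then w i / (T i - T i.+1) else 0) = 0].

(** With label 0 the last equation says that the inverse of [T l - T l.-1] is 0. By the convention
    for inverses this forces a zero difference, which is excluded. *)
Lemma single_bethe_obstruction T : (0 < l)%N -> L l = 0 -> ~ single_bethe T.
Proof.
move=> l0 Ll /(_ l); rewrite l0 leqnn => /(_ isT) [_ Tl _].
rewrite Ll mul0r add0r ltnn addr0 => /eqP; rewrite invr_eq0 subr_eq0.
by rewrite (negPf Tl).
Qed.

Variable f : nat -> K.
Hypothesis fl : (0 < l)%N -> f l = L l.
Hypothesis fS : forall i, (1 <= i < l)%N -> f i = L i + w i * (f i.+1 + 1).
Hypothesis f0 : forall i, (1 <= i <= l)%N -> 0 < f i.

Lemma single_bethe_unique T : T 0%N = 1 -> single_bethe T ->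
  forall i, (i <= l)%N -> T i = chain f i.
Proof.
move=> T0 TE; apply: chain_unique => // i il.
have [||//] := @chain_down L T f w l f0 fS _ _ i il => [j /andP[j1 jl]|l0].
  have [|_ T1 T2] := TE j; first by rewrite j1 ltnW.
  by rewrite jl; split=> //; apply: T2.
have ll : (1 <= l <= l)%N by rewrite l0 leqnn.
have [Tl Tp _] := TE l ll; rewrite ltnn addr0 => E.
have {}Tl : T l != 0 by apply: Tl; rewrite -fl // gt_eqF // f0.
split=> //; apply: ratio_solve; first by rewrite ltW // f0.
rewrite fl // -[L l]addr0; apply: chain_step => //.
by rewrite mul0r addr0.
Qed.

Lemma single_bethe_chain : single_bethe (chain f).
Proof.
move=> i /andP[i1 il].
have fi j : (1 <= j <= i)%N -> 0 < f j.
  by move=> /andP[j1 ji]; rewrite f0 // j1 (leq_trans ji).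
split.
- by move=> _; apply: chain_neq0.
- exact: chain_neq_prev.
- move=> il'; rewrite eq_sym; apply: chain_neq_prev => // j /andP[j1 ji].
  by rewrite f0 // j1 (leq_trans ji).
- case: ifP => il'.
    apply: chain_equation => // [j /andP[j1 ji]|].
      by rewrite f0 // j1 (leq_trans ji).
    by rewrite fS // i1.
  have -> : i = l by apply/eqP; rewrite eqn_leq il leqNgt il'.
  have l0 : (0 < l)%N by rewrite (leq_trans i1).
  by rewrite addr0; apply: chain_last_equation; rewrite ?fl // -fl // f0 // l0 leqnn.
Qed.

Lemma single_bethe_ext T T' : (forall i, (i <= l)%N -> T i = T' i) ->
  single_bethe T -> single_bethe T'.
Proof.
move=> E H i /[dup] /H [H1 H2 H3 H4] /andP[i1 il].
have il' : (i.-1 <= l)%N by rewrite (leq_trans (leq_pred _)).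
rewrite -(E i) // -(E i.-1) //; split=> //; first by move=> il2; rewrite -(E i.+1) //; apply: H3.
by move: H4; case: ltnP => // il2; rewrite -(E i.+1).
Qed.

End Single.
End Chains.

(** * Chains in which the colors from d to r-1 have two roots *)

Section Double.
Variable K : numFieldType.
Implicit Types (T a b : nat -> K).
Variables (r d : nat) (L : nat -> K).

Definition pair_condition T a b k (x x' : K) :=
  [/\ L k != 0 -> x != 0,
      if k == d then is_true (x != T d.-1) else x != a k.-1 /\ x != b k.-1,
      x != a k.+1, x != b k.+1 &
      L k / x
      + (if k == d then (x - T d.-1)^-1 else (x - a k.-1)^-1 + (x - b k.-1)^-1)
      + ((x - a k.+1)^-1 + (x - b k.+1)^-1) = 2%:R / (x - x')].

(* The color r has a single root, entered as a r = b r: the factor 2 of its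
   interaction with the color r.-1 makes it behave like a double root there. *)
Definition double_bethe T a b :=
  [/\ forall i, (1 <= i < d)%N ->
        [/\ L i != 0 -> T i != 0, T i != T i.-1,
            if (i.+1 < d)%N then is_true (T i != T i.+1) else T i != a d /\ T i != b d &
            L i / T i + (T i - T i.-1)^-1 +
            (if (i.+1 < d)%N then (T i - T i.+1)^-1
             else (T i - a d)^-1 + (T i - b d)^-1) = 0],
      forall k, (d <= k < r)%N ->
        [/\ a k != b k, pair_condition T a b k (a k) (b k) &
            pair_condition T a b k (b k) (a k)],
      [/\ a r = b r, L r != 0 -> a r != 0, a r != a r.-1 & a r != b r.-1] &
      L r / a r + ((a r - a r.-1)^-1 + (a r - b r.-1)^-1) = 0].

Hypotheses (d1 : (1 <= d)%N) (dr : (d < r)%N).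

Lemma double_bethe_obstruction T a b : L d = 0 -> ~ double_bethe T a b.
Proof.
move=> Ld [_ /(_ d)]; rewrite leqnn dr => /(_ isT) [ab].
rewrite /pair_condition eqxx Ld !mul0r !add0r.
move=> [_ aT aa abS Ea] [_ bT ba bb Eb] _ _.
exact: (reproduction_obstruction ab aT bT aa abS ba bb Ea Eb).
Qed.

(** [A k] is the label of color [k] after the trades at [d], ..., [k.-1]: each trade adds the
    reflected label plus one to the next label. [p i] is the effective label of a color [i < d].
    They become [rho_] and [p_] of the statement. *)
Variables (A p : nat -> K).
Hypothesis Ad : A d = L d.
Hypothesis AS : forall k, (d <= k < r)%N -> A k.+1 = A k + L k.+1 + 1.
Hypothesis A0 : forall k, (d <= k <= r)%N -> 0 < A k.
Hypothesis ALe : forall k, (d <= k <= r)%N -> A k <= A r.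
Let M := 2%:R * A r.
Hypothesis pd : (1 < d)%N -> p d.-1 = L d.-1 + (M + 2%:R).
Hypothesis pS : forall i, (1 <= i < d.-1)%N -> p i = L i + (p i.+1 + 1).
Hypothesis p0 : forall i, (1 <= i < d)%N -> 0 < p i.

Let q k := M - A k.

Lemma q_gt0 k : (d <= k <= r)%N -> 0 < q k.
Proof.
move=> kr; rewrite /q /M mulr_natl mulr2n -addrA ltr_wpDr ?subr_ge0 ?ALe //.
by rewrite A0 // (ltnW dr) leqnn.
Qed.

(** [Zc k.+1] will be the root of g_k, with [Zc d] the root [T d.-1] and [Zc r.+1] that of color
    [r]; [Sc k] and [Nc k] will be the sum and the product of the two roots of color [k]. *)
Definition Zc k := chain p d.-1 * \prod_(d <= i < k) ratio (q i).
Definition Pic k := \prod_(k <= i < r.+1) (ratio (q i) * ratio (A i)).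
Definition Sc k := Zc k * (M / (M + 1) + (2%:R - M / (M + 1)) * Pic k).
Definition Nc k := Zc k ^+ 2 * Pic k.

Lemma Zc_d : Zc d = chain p d.-1.
Proof. by rewrite /Zc big_geq ?mulr1. Qed.

Lemma ZcS k : (d <= k)%N -> Zc k.+1 = ratio (q k) * Zc k.
Proof. by move=> dk; rewrite /Zc big_nat_recr //= mulrA mulrC. Qed.

Lemma PicS k : (k <= r)%N -> Pic k = ratio (q k) * ratio (A k) * Pic k.+1.
Proof. by move=> kr; rewrite /Pic big_ltn. Qed.

Lemma Zc_neq0 k : (d <= k <= r.+1)%N -> Zc k != 0.
Proof.
move=> /andP[dk kr]; rewrite mulf_neq0 //.
  by apply: chain_neq0 => j /andP[j1 jd]; rewrite p0 // j1 -(prednK d1) ltnS.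
rewrite big_nat prodf_seq_neq0; apply/allP => i _; apply/implyP => /andP[di ik].
by rewrite gt_eqF // ratio_gt0 // q_gt0 // di -ltnS (leq_trans ik).
Qed.

Let dd : (d <= r)%N. Proof. exact: ltnW. Qed.

Lemma M_gt0 : 0 < M.
Proof. by rewrite mulr_gt0 ?ltr0n // A0 // dd leqnn. Qed.

Lemma prod_ratio_itv m n : (d <= m < n)%N -> (n <= r.+1)%N ->
  0 < \prod_(m <= i < n) (ratio (q i) * ratio (A i)) < 1.
Proof.
move=> /andP[dm mn] nr.
have step i : (d <= i <= r)%N -> 0 < ratio (q i) * ratio (A i) < 1.
  move=> ir; have [qi ai] := (q_gt0 ir, A0 ir).
  by rewrite mulr_gt0 ?ratio_gt0 //= mulr_ilt1 ?ratio_lt1 // ?ltW ?ratio_gt0.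
have mr : (d <= m <= r)%N by rewrite dm -ltnS (leq_trans mn).
rewrite big_ltn //; have /andP[s0 s1] := step m mr.
suff /andP[t0 t1] : 0 < \prod_(m.+1 <= i < n) (ratio (q i) * ratio (A i)) <= 1.
  by rewrite mulr_gt0 //= (le_lt_trans _ s1) // ler_piMr // ltW.
rewrite big_nat; elim/big_rec: _ => [|i x /andP[mi ir] /andP[x0 x1]].
  by rewrite ltr01 lexx.
have ri : (d <= i <= r)%N by rewrite (leq_trans dm (ltnW mi)) -ltnS (leq_trans ir).
have /andP[s0' s1'] := step i ri.
by rewrite mulr_gt0 //= (le_trans _ (ltW s1')) // ler_piMr // ltW.
Qed.

Lemma Pic_itv k : (d <= k <= r)%N -> 0 < Pic k < 1.
Proof. by move=> /andP[dk kr]; apply: prod_ratio_itv; rewrite ?dk. Qed.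

Lemma closed_reproduction k : (d <= k < r)%N ->
  reproduction (A k) (Zc k) (Zc k.+1) (Sc k) (Nc k) (Sc k.+1) (Nc k.+1).
Proof.
move=> /andP[dk kr]; have dkr : (d <= k <= r)%N by rewrite dk ltnW.
rewrite /Sc /Nc ZcS // (PicS (ltnW kr)) /ratio.
have q1 := succ_neq0 (ltW (q_gt0 dkr)); have a1 := succ_neq0 (ltW (A0 dkr)).
have m1 := succ_neq0 (ltW M_gt0).
move: q1; rewrite /q; move: (Pic _) (Zc _) (A k) M a1 m1 => P Z a m a1 m1 q1.
by split; field; rewrite ?a1 ?m1 ?q1.
Qed.

(** Here [M = 2 A r] matters: it makes [q r = A r], so that the last quadratic is the square of a
    linear polynomial, as the doubled root of color [r] requires. *)
Lemma closed_end : Sc r = 2%:R * Zc r.+1 /\ Nc r = Zc r.+1 ^+ 2.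
Proof.
have drr : (d <= r <= r)%N by rewrite dd leqnn.
have a1 := succ_neq0 (ltW (A0 drr)); have m1 := succ_neq0 (ltW M_gt0).
rewrite /Sc /Nc ZcS // PicS // [Pic r.+1]big_geq // /ratio /q.
have qE : M - A r = A r by rewrite /M; ring.
rewrite qE; move: m1; rewrite /M; move: (Zc r) (A r) a1 => Z x x1 m1.
by split; field; rewrite ?x1 ?m1.
Qed.

Lemma closed_at_Z k : (d <= k <= r)%N -> Zc k ^+ 2 - Sc k * Zc k + Nc k != 0.
Proof.
move=> dkr; have m1 := succ_neq0 (ltW M_gt0).
have -> : Zc k ^+ 2 - Sc k * Zc k + Nc k = Zc k ^+ 2 * ((1 - Pic k) / (M + 1)).
  by rewrite /Sc /Nc; field.
have /andP[_ P1] := Pic_itv dkr.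
rewrite mulf_neq0 ?expf_neq0 ?Zc_neq0 ?mulf_neq0 ?invr_neq0 //.
  by case/andP: dkr => -> /leqW.
by rewrite subr_eq0 gt_eqF.
Qed.

(** At the root of g_k the reproduction identity reduces to x y_k on the left, and on the right no
    factor vanishes, by [closed_at_Z] at [k.+1]. *)
Lemma closed_at_ZS k : (d <= k < r)%N ->
  Zc k.+1 ^+ 2 - Sc k * Zc k.+1 + Nc k != 0.
Proof.
move=> /andP[dk kr]; have dkr : (d <= k <= r)%N by rewrite dk ltnW.
have := reproductionE (Zc k.+1) (closed_reproduction (introT andP (conj dk kr))).
rewrite subrr !mulr0 subr0 add0r => E; apply/eqP => y0; move: E.
rewrite y0 mulr0 => /esym/eqP; rewrite !mulf_eq0.
have -> : (A k == 0) = false by rewrite gt_eqF // A0.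
rewrite (negPf (closed_at_Z _)) ?(leqW dk) ?kr // orbF /=.
rewrite ZcS // subr_eq0 => /eqP /esym E.
have dkr' : (d <= k <= r.+1)%N by rewrite dk leqW // ltnW.
by move: (Zc_neq0 dkr'); rewrite (ratio_fixed _ E) ?eqxx // ltW // q_gt0.
Qed.

(** As [q r = A r], [Pic k] is [kap * ratio (A r) ^+ 2]; with [M = 2 A r] the discriminant then
    splits into factors that are nonzero because [kap] and [Pic k] lie strictly between 0 and 1. *)
Lemma closed_discriminant k : (d <= k < r)%N -> Sc k ^+ 2 - 4%:R * Nc k != 0.
Proof.
move=> /andP[dk kr].
pose kap := \prod_(k <= i < r) (ratio (q i) * ratio (A i)).
have drr : (d <= r <= r)%N by rewrite dd leqnn.
have PE : Pic k = kap * (ratio (A r)) ^+ 2.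
  rewrite /Pic big_nat_recr ?(ltnW kr) //= -/kap.
  have -> : q r = A r by rewrite /q /M; ring.
  by rewrite expr2.
have a0 := A0 drr; have a1 := succ_neq0 (ltW a0); have m1 := succ_neq0 (ltW M_gt0).
have /andP[P0 P1] : 0 < Pic k < 1 by rewrite Pic_itv // dk ltnW.
have /andP[_ kap1] : 0 < kap < 1 by apply: prod_ratio_itv; rewrite ?dk.
have -> : Sc k ^+ 2 - 4%:R * Nc k =
    4%:R * (Zc k * A r / (M + 1)) ^+ 2 * (1 - kap) * (1 - Pic k).
  rewrite /Sc /Nc PE /ratio; move: m1; rewrite /M; move: (A r) a1 => x x1 m1.
  by field; rewrite x1 m1.
have Z0 : Zc k != 0 by apply: Zc_neq0; rewrite dk leqW // ltnW.
have k1 : 1 - kap != 0 by rewrite subr_eq0 gt_eqF.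
have p1 : 1 - Pic k != 0 by rewrite subr_eq0 gt_eqF.
have ar : A r != 0 by rewrite gt_eqF.
by rewrite mulf_neq0 // mulf_neq0 // mulf_neq0 ?pnatr_eq0 // expf_neq0 // mulf_neq0 ?invr_neq0 // mulf_neq0.
Qed.

Section Uniqueness.
Variables (T a b : nat -> K).
Hypothesis sol : double_bethe T a b.

(** Trading y_k for g_k gives color [k.+1] a single lower neighbor and the label [A k.+1], which is
    the situation color [d] starts from. Above [d] the original label may vanish, so a root at the
    origin has to be allowed for. *)
Lemma reproduction_sequence m : (d + m <= r)%N -> exists g : nat -> K, g d.-1 = T d.-1 /\
  forall k, (d <= k < d + m)%N -> reproduction (A k) (g k.-1) (g k)
    (a k + b k) (a k * b k) (a k.+1 + b k.+1) (a k.+1 * b k.+1).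
Proof.
have [_ pairs _ _] := sol.
elim: m => [|m IHm] mr.
  by exists T; split=> // k /andP[dk]; rewrite addn0 ltnNge dk.
have mr' : (d + m < r)%N by rewrite -addnS.
have [g [gd gE]] := IHm (ltnW mr').
suff [x xE] : exists x, reproduction (A (d + m)) (g (d + m).-1) x
    (a (d + m) + b (d + m)) (a (d + m) * b (d + m))
    (a (d + m).+1 + b (d + m).+1) (a (d + m).+1 * b (d + m).+1).
  exists (fun k => if k == (d + m)%N then x else g k); split.
    by rewrite ltn_eqF ?gd // prednK // leq_addr.
  move=> k /andP[dk]; rewrite addnS ltnS leq_eqVlt => /orP[/eqP ->|km].
    by rewrite eqxx ltn_eqF // prednK // (leq_trans d1) ?leq_addr.
  rewrite (ltn_eqF km) ltn_eqF; last by rewrite (leq_ltn_trans (leq_pred k)).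
  by apply: gE; rewrite dk.
have dk : (d <= d + m < r)%N by rewrite leq_addr mr'.
have Ak : A (d + m) != 0 by rewrite gt_eqF // A0 // leq_addr ltnW.
have [ab Pa Pb] := pairs _ dk.
case: m mr mr' g gd gE dk ab Pa Pb Ak {IHm} => [|m] mr mr' g gd gE dk ab Pa Pb Ak.
  rewrite addn0 in dk ab Pa Pb Ak *; move: Pa Pb.
  rewrite /pair_condition eqxx gd -Ad => -[/(_ Ak) a0 aT aa abS Ea] [/(_ Ak) b0 bT ba bb Eb].
  exact: reproduction_exists.
rewrite addnS in dk ab Pa Pb Ak mr mr' *; move: Pa Pb.
set k := (d + m)%N in dk ab Ak mr mr' gE *.
have kd : (k.+1 == d) = false by rewrite gtn_eqF // ltnS leq_addr.
have dk' : (d <= k < r)%N by rewrite leq_addr ltnW.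
have rep := gE k; rewrite leq_addr addnS leqnn in rep; have {}rep := rep isT.
have AkE : L k.+1 = A k.+1 - (A k + 1) by rewrite AS //; ring.
have Ak1 : A k + 1 != 0 by rewrite succ_neq0 // ltW // A0 // leq_addr ltnW // ltnW.
have Ak0 : A k != 0 by rewrite gt_eqF // A0 // leq_addr ltnW // ltnW.
rewrite /pair_condition kd /= => -[a0 [aa1 ab1] aa abS Ea] [b0 [ba1 bb1] ba bb Eb].
have conv x : (x - a k.+1) * (x - b k.+1) = 0 -> x != 0 -> x != a k -> x != b k ->
    x != g k /\ (x - a k)^-1 + (x - b k)^-1 = (A k + 1) / x + (x - g k)^-1.
  move=> xY x0 xa xb; apply: (reproduction_log_derivative rep) => //.
  have -> : x ^+ 2 - (a k.+1 + b k.+1) * x + a k.+1 * b k.+1 =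
      (x - a k.+1) * (x - b k.+1) by ring.
  by rewrite xY mulr0.
(* Writing the partner of [x] as [a k.+1 + b k.+1 - x] serves both roots at once. *)
have eqn x y : x != 0 -> L k.+1 / x + ((x - a k)^-1 + (x - b k)^-1) + y =
    2%:R / (x - (a k.+1 + b k.+1 - x)) ->
    (x - a k)^-1 + (x - b k)^-1 = (A k + 1) / x + (x - g k)^-1 ->
    A k.+1 / x + (x - g k)^-1 + y = 2%:R / (x - (a k.+1 + b k.+1 - x)).
  by move=> x0 <- ->; rewrite AkE; ring.
have ba' : b k.+1 != a k.+1 by rewrite eq_sym.
have aK : a k.+1 + b k.+1 - a k.+1 = b k.+1 by rewrite addrC addKr.
(* The roots of color [k] differ from a root at the origin, so the constant coefficient of the
   previous reproduction forces [g k = 0]: the lower neighbor of the next trade is the origin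
   too. *)
have [a00|a00] := eqVneq (a k.+1) 0.
  have N0 : a k * b k != 0 by rewrite mulf_neq0 // -a00 eq_sym.
  have g0 : g k = 0.
    case: rep => _ _; rewrite a00 mul0r mulr0 => /eqP.
    by rewrite mulf_eq0 mulf_eq0 (negPf Ak1) (negPf N0) => /eqP.
  have b00 : b k.+1 != 0 by rewrite -a00.
  have [|_ Eg] := conv (b k.+1) _ b00 ba1 bb1; first by rewrite subrr mulr0.
  rewrite a00 g0 add0r mul0r; apply: reproduction_exists0 => //.
  have := eqn (b k.+1) ((b k.+1 - a k.+2)^-1 + (b k.+1 - b k.+2)^-1) b00.
  by rewrite addrK => /(_ Eb Eg); rewrite g0 a00.
have [b00|b00] := eqVneq (b k.+1) 0.
  have N0 : a k * b k != 0 by rewrite mulf_neq0 // -b00 eq_sym.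
  have g0 : g k = 0.
    case: rep => _ _; rewrite b00 !mulr0 => /eqP.
    by rewrite mulf_eq0 mulf_eq0 (negPf Ak1) (negPf N0) => /eqP.
  have [|_ Eg] := conv (a k.+1) _ a00 aa1 ab1; first by rewrite subrr mul0r.
  rewrite b00 g0 addr0 mulr0; apply: reproduction_exists0 => //.
  have := eqn (a k.+1) ((a k.+1 - a k.+2)^-1 + (a k.+1 - b k.+2)^-1) a00.
  by rewrite aK => /(_ Ea Eg); rewrite g0 b00.
have [|ag Ega] := conv (a k.+1) _ a00 aa1 ab1; first by rewrite subrr mul0r.
have [|bg Egb] := conv (b k.+1) _ b00 ba1 bb1; first by rewrite subrr mulr0.
apply: reproduction_exists => //.
  have := eqn (a k.+1) ((a k.+1 - a k.+2)^-1 + (a k.+1 - b k.+2)^-1) a00.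
  by rewrite aK; apply.
have := eqn (b k.+1) ((b k.+1 - a k.+2)^-1 + (b k.+1 - b k.+2)^-1) b00.
by rewrite addrK; apply.
Qed.

(** The outcome of [reproduction_elim] for [kap = M + 2], solved for [g]. *)
Let kap_step A' g h : A' <= A r -> g + (g - h) * (M + 2%:R) = (A' + 2%:R) * (g - h) ->
  g = ratio (M - A') * h.
Proof.
move=> A'r E; apply: ratio_solve.
  by rewrite subr_ge0 (le_trans A'r) // /M mulr_natl mulr2n lerDl ltW // A0 // dd leqnn.
by apply: (linear_combination (k := 1) E); ring.
Qed.

(** The key is an invariant: g_k times the logarithmic derivative of y_(k+1) at g_k equals [M + 2]
    for every [k], where color [r] counts as a double root. It expresses g_k through g_(k-1), and
    the same value reaches color [d.-1], so the head closes up as a chain starting at 1. *)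
Lemma double_bethe_unique : T 0%N = 1 ->
  [/\ forall i, (i < d)%N -> T i = chain p i, a r = Zc r.+1 &
      forall k, (d <= k < r)%N -> a k + b k = Sc k /\ a k * b k = Nc k].
Proof.
move=> T0; have [head pairs [abr _ ca cb] Ec] := sol.
have [g [gd gE]] := reproduction_sequence (eq_leq (subnKC dd)).
rewrite (subnKC dd) in gE.
have r0 : (0 < r)%N by rewrite (leq_trans _ dr).
have r1 : (d <= r.-1 < r)%N by rewrite -ltnS prednK // dr leqnn.
have rr : (d <= r <= r)%N by rewrite dd leqnn.
have A1 k : (d <= k <= r)%N -> A k + 1 != 0 by move=> kr; rewrite succ_neq0 // ltW // A0.
have AN k : (d <= k <= r)%N -> A k != 0 by move=> kr; rewrite gt_eqF // A0.
have r1' : (d <= r.-1 <= r)%N by case/andP: r1 => -> /ltnW.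
have rep := gE _ r1; rewrite prednK // -abr in rep.
(* After the trade color [r] sees only the origin, with label [A r], and [g r.-1]. *)
have cE : a r = ratio (A r) * g r.-1.
  apply: ratio_solve; first by rewrite ltW // A0.
  have [c0|c0] := eqVneq (a r) 0.
    have N0 : a r.-1 * b r.-1 != 0 by rewrite mulf_neq0 // -c0 eq_sym.
    case: rep => _ _; rewrite c0 !mulr0 => /eqP.
    by rewrite mulf_eq0 mulf_eq0 (negPf (A1 _ r1')) (negPf N0) => /eqP ->; rewrite mulr0.
  have [|cg E] := reproduction_log_derivative (x := a r) rep _ c0 ca cb; first by ring.
  rewrite -[A r]addr0; apply: chain_step => //.
  rewrite mul0r addr0 -Ec E -{1}(prednK r0) AS // prednK //; ring.
(* Otherwise [a r = 0] as well, and the middle coefficient would put a root of color [r.-1] at the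
   same point. *)
have gr : g r.-1 != 0.
  apply/eqP => g0; rewrite g0 mulr0 in cE.
  case: rep => _ + _; rewrite g0 cE !(mulr0, mul0r, addr0) => /eqP.
  rewrite !mulf_eq0 => /or3P[/eqP E|/eqP E|/eqP E].
  - have : 0 < A r.-1 + 2%:R by rewrite addr_gt0 ?A0 ?ltr0n.
    by rewrite E ltxx.
  - by rewrite cE E eqxx in ca.
  - by rewrite cE E eqxx in cb.
have down m k : (k + m = r.-1)%N -> (d <= k)%N -> g k != 0 /\ g k = ratio (q k) * g k.-1.
  elim: m k => [|m IHm] k km dk.
    rewrite addn0 in km; rewrite km; split=> //; apply: kap_step; first exact: ALe.
    have gc : g r.-1 - a r != 0.
      rewrite subr_eq0; apply: contraNneq gr => gc; apply/eqP.
      by apply: (@ratio_fixed _ (A r)); rewrite -?cE // ltW // A0.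
    (* The invariant at the top: the double root [a r] contributes 2/(g - a_r) at g = [g r.-1], and
       [cE] makes this 2 (A_r + 1)/g. *)
    have YE : g r.-1 ^+ 2 - (a r + a r) * g r.-1 + a r * a r = (g r.-1 - a r) ^+ 2 by ring.
    apply: (reproduction_elim rep (AN _ r1')); first by rewrite YE expf_neq0.
    rewrite YE cE /M /ratio; field; exact: A1.
  have [gk gkE] := IHm k.+1 (etrans (addSnnS k m) km) (leqW dk).
  have kr : (k.+1 < r)%N by rewrite -(prednK r0) ltnS -km addnS ltnS leq_addr.
  have kr1 : (d <= k < r)%N by rewrite dk ltnW.
  have kr2 : (d <= k.+1 < r)%N by rewrite leqW.
  have kr3 : (d <= k.+1 <= r)%N by rewrite leqW // ltnW.
  have kr4 : (d <= k <= r)%N by rewrite dk ltnW // ltnW.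
  have g0 : g k != 0 by apply: contraNneq gk => g0; rewrite gkE /= g0 mulr0.
  split=> //; apply: kap_step; first exact: ALe.
  (* The invariant one color lower: the reproduction of color [k.+1] at its lower point [g k] gives
     [(A k.+1 + 1) + (q k.+1 + 1) = M + 2]. *)
  have YE : g k * (2%:R * g k - (a k.+1 + b k.+1)) = (M + 2%:R) *
      (g k ^+ 2 - (a k.+1 + b k.+1) * g k + a k.+1 * b k.+1).
    have := reproductionE (g k) (gE _ kr2); rewrite subrr !(mulr0, mul0r) gkE /=.
    move: (a k.+1 + b k.+1) (a k.+1 * b k.+1) => S N E.
    have q0 : 0 < q k.+1 by apply: q_gt0.
    have q1 := succ_neq0 (ltW q0).
    apply: (mulfI g0); apply: (linear_combination (k := - (q k.+1 + 1)) E).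
    have qE : M = A k.+1 + q k.+1 by rewrite /q; ring.
    rewrite qE /ratio; field; exact: q1.
  apply: (reproduction_elim (gE _ kr1) (AN _ kr4)) => //.
  (* If the quadratic vanished at [g k], so would its derivative, and the two roots of color [k.+1]
     would coincide. *)
  apply/eqP => Y0; move: YE; rewrite Y0 mulr0 => /eqP.
  rewrite mulf_eq0 (negPf g0) subr_eq0 /= => /eqP Yg.
  have [ab _ _] := pairs _ kr2.
  have : (a k.+1 - b k.+1) ^+ 2 = 0.
    transitivity ((a k.+1 + b k.+1) ^+ 2 - 4%:R * (a k.+1 * b k.+1)); first by ring.
    rewrite -Yg in Y0 *; apply: (linear_combination (k := - 4%:R) Y0); ring.
  by move/eqP; rewrite expf_eq0 subr_eq0 (negPf ab).
have {}down k : (d <= k < r)%N -> g k != 0 /\ g k = ratio (q k) * g k.-1.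
  move=> /andP[dk kr]; apply: (down (r.-1 - k)%N) => //.
  by rewrite subnKC // -ltnS prednK.
have [gd0 gdE] := down d (introT andP (conj (leqnn d) dr)).
have Td0 : T d.-1 != 0.
  by rewrite -gd; apply: contraNneq gd0 => E; rewrite gdE E mulr0.
have Tchain i : (i < d)%N -> T i = chain p i.
  move=> id; apply: (@chain_unique _ T p d.-1) => //; last by rewrite -ltnS prednK.
  move=> {id}i id; have [] // := @chain_down _ L T p (fun=> 1) d.-1 _ _ _ _ i id.
  - by move=> j /andP[j1 jd]; rewrite p0 // j1 -(prednK d1) ltnS.
  - by move=> j jd; rewrite mul1r pS.
  - move=> j /andP[j1 jd]; have jd' : (j < d)%N by rewrite (leq_trans jd) ?leq_pred.
    have jd2 : (j.+1 < d)%N by rewrite -(prednK d1) ltnS.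
    have [|_ Tp] := head j; first by rewrite j1.
    by rewrite jd2 mul1r.
  - move=> d2; have dd1 : (1 <= d.-1 < d)%N by rewrite d2 ltn_predL.
    have [_ Tp] := head _ dd1; rewrite prednK // ltnn => -[Ta Tb] E.
    split=> //; have pd' : p d.-1 = L d.-1 + (M + 2%:R) by rewrite pd // -(prednK d1) ltnS.
    apply: ratio_solve; first by rewrite ltW // p0.
    rewrite pd'; apply: chain_step => //; rewrite -E.
    (* [T d.-1] is the lower point of the trade at [d], so color [d.-1] feels the two roots of color
       [d] as [M + 2] over [T d.-1]. *)
    have rd := gE d (introT andP (conj (leqnn d) dr)).
    have [|_ ->] := reproduction_log_derivative (x := T d.-1) rd _ Td0 Ta Tb.
      by rewrite gd subrr mul0r.
    have dr' : (d <= d <= r)%N by rewrite leqnn.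
    rewrite gdE gd inv_sub_next; last by rewrite ltW // q_gt0.
    by rewrite /q; ring.
have gZ k : (d <= k.+1 <= r)%N -> g k = Zc k.+1.
  elim: k => [|k IHk] /andP[dk kr].
    have dE : d = 1%N by apply/eqP; rewrite eqn_leq dk.
    by move: gd; rewrite dE /= => ->; rewrite T0 -[1%N]dE Zc_d dE chain0.
  move: dk; rewrite leq_eqVlt => /orP[/eqP dE|dk].
    by rewrite -dE Zc_d -Tchain ?prednK // -gd dE.
  rewrite ltnS in dk.
  by have [|_ ->] := down k.+1; [rewrite dk|rewrite ZcS // IHk ?dk // ltnW].
have aZ : a r = Zc r.+1.
  have grZ : g r.-1 = Zc r by rewrite gZ prednK.
  rewrite cE ZcS // grZ.
  by congr (ratio _ * _); rewrite /q /M; ring.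
split=> // k kr.
(* Downwards from color [r]: the actual and the closed quadratic of color [j] are reproduced from
   the same data at [j.+1], which determine them. *)
suff main m j : (j + m = r)%N -> (d <= j)%N -> a j + b j = Sc j /\ a j * b j = Nc j.
  by case/andP: kr => dk kr; apply: (main (r - k)%N) => //; rewrite subnKC // ltnW.
elim: m j => [|m IHm] j jm dj.
  rewrite addn0 in jm; rewrite jm -abr; have [-> ->] := closed_end.
  by rewrite aZ mulr_natl mulr2n expr2.
have [Sj Nj] := IHm j.+1 (etrans (addSnnS j m) jm) (leqW dj).
have jr : (d <= j < r)%N by rewrite dj -jm addnS ltnS leq_addr.
have jr' : (d <= j <= r)%N by case/andP: jr => -> /ltnW.
have R1 := gE j jr; rewrite Sj Nj in R1.
have R2 := closed_reproduction jr.
have g1 : g j = Zc j.+1 by apply: gZ; case/andP: jr => /leqW -> ->.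
have g2 : g j.-1 = Zc j.
  case: (j) jr => [|i] ir; first by rewrite leqn0 gtn_eqF in ir.
  by apply: gZ; case/andP: ir => -> /ltnW.
rewrite g1 g2 in R1; apply: (reproduction_det _ _ R1 R2); first exact: A1.
by rewrite -g1; have [] := down j jr.
Qed.

End Uniqueness.

(** Reproduction read backwards: [reproduction_root] gives equations with label [A k] and lower
    neighbor [Zc k]; for [k > d], [reproduction_log_derivative] then puts the two roots of color
    [k.-1] in place of that neighbor and restores the label [L k]. *)
Lemma double_bethe_closed T a b :
  (forall i, (i < d)%N -> T i = chain p i) -> a r = Zc r.+1 -> b r = a r ->
  (forall k, (d <= k < r)%N -> a k + b k = Sc k /\ a k * b k = Nc k) ->
  double_bethe T a b.
Proof.
move=> TE aE bE abE.
have r0 : (0 < r)%N by rewrite (leq_trans _ dr).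
have r1 : (d <= r.-1 < r)%N by rewrite -ltnS prednK // dr leqnn.
have rr : (d <= r <= r)%N by rewrite dd leqnn.
have Td : T d.-1 = Zc d by rewrite Zc_d TE // prednK.
have {}abE k : (d <= k <= r)%N -> a k + b k = Sc k /\ a k * b k = Nc k.
  move=> /andP[dk]; rewrite leq_eqVlt => /orP[/eqP->|kr]; last by apply: abE; rewrite dk.
  have [-> ->] := closed_end.
  by rewrite bE aE mulr_natl mulr2n expr2.
have rep k : (d <= k < r)%N -> reproduction (A k) (Zc k) (Zc k.+1)
    (a k + b k) (a k * b k) (a k.+1 + b k.+1) (a k.+1 * b k.+1).
  move=> /andP[dk kr]; have [-> ->] := abE k (introT andP (conj dk (ltnW kr))).
  have [|-> ->] := abE k.+1; first by rewrite leqW.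
  by apply: closed_reproduction; rewrite dk.
have generic k : (d <= k < r)%N -> [/\ a k != b k, a k != 0, b k != 0,
    a k != Zc k.+1 & b k != Zc k.+1].
  move=> /[dup] kr /andP[dk kr'].
  have [Sk Nk] := abE k (introT andP (conj dk (ltnW kr'))).
  have Z0 : Zc k != 0 by apply: Zc_neq0; rewrite dk leqW // ltnW.
  have /andP[P0 _] : 0 < Pic k < 1 by apply: Pic_itv; rewrite dk ltnW.
  have : a k * b k != 0 by rewrite Nk mulf_neq0 ?expf_neq0 // gt_eqF.
  rewrite mulf_eq0 negb_or => /andP[a0 b0].
  have : (Zc k.+1 - a k) * (Zc k.+1 - b k) != 0.
    have -> : (Zc k.+1 - a k) * (Zc k.+1 - b k) =
      Zc k.+1 ^+ 2 - (a k + b k) * Zc k.+1 + a k * b k by ring.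
    by rewrite Sk Nk closed_at_ZS.
  rewrite mulf_eq0 negb_or !subr_eq0 !(eq_sym (Zc _)) => /andP[aZ bZ].
  split=> //; apply: contraNneq (closed_discriminant kr) => ab.
  by rewrite -Sk -Nk ab; apply/eqP; ring.
have AN k : (d <= k <= r)%N -> A k != 0 by move=> kr; rewrite gt_eqF // A0.
have rootA k : (d <= k < r)%N -> [/\ a k != Zc k, a k != a k.+1, a k != b k.+1 &
    A k / a k + (a k - Zc k)^-1 + ((a k - a k.+1)^-1 + (a k - b k.+1)^-1)
      = 2%:R / (a k - b k)].
  move=> kr; have [ab a0 b0 aZ bZ] := generic k kr.
  apply: (reproduction_root (rep k kr)) => //; apply: AN.
  by case/andP: kr => -> /ltnW.
have rootB k : (d <= k < r)%N -> [/\ b k != Zc k, b k != a k.+1, b k != b k.+1 &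
    A k / b k + (b k - Zc k)^-1 + ((b k - a k.+1)^-1 + (b k - b k.+1)^-1)
      = 2%:R / (b k - a k)].
  move=> kr; have [ab a0 b0 aZ bZ] := generic k kr.
  have := rep k kr; rewrite (addrC (a k)) (mulrC (a k)) => repk.
  apply: (reproduction_root repk) => //; last by rewrite eq_sym.
  by apply: AN; case/andP: kr => -> /ltnW.
have prev k x : (d <= k < r)%N -> (x - a k.+1) * (x - b k.+1) = 0 ->
    x != 0 -> x != a k -> x != b k ->
    (x - a k)^-1 + (x - b k)^-1 = (A k + 1) / x + (x - Zc k.+1)^-1.
  move=> kr x1 x0 xa xb.
  have [|_ //] := reproduction_log_derivative (x := x) (rep k kr) _ x0 xa xb.
  have -> : x ^+ 2 - (a k.+1 + b k.+1) * x + a k.+1 * b k.+1 =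
    (x - a k.+1) * (x - b k.+1) by ring.
  by rewrite x1 mulr0.
have pair k x x' : (d <= k < r)%N -> (x - a k) * (x - b k) = 0 ->
    [/\ x != Zc k, x != a k.+1, x != b k.+1 &
    A k / x + (x - Zc k)^-1 + ((x - a k.+1)^-1 + (x - b k.+1)^-1) = 2%:R / (x - x')] ->
    x != 0 -> pair_condition T a b k x x'.
  move=> kr xab [xZ xa xb E] x0; rewrite /pair_condition.
  case: (k =P d) => [kd|/eqP kd]; first by rewrite kd in E xZ xa xb *; split; rewrite ?Td -?Ad.
  case: k kr xab xZ xa xb E kd => [|k] kr xab xZ xa xb E kd.
    by rewrite leqNgt d1 in kr.
  have kr' : (d <= k < r)%N.
    case/andP: kr; rewrite leq_eqVlt eq_sym (negPf kd) ltnS /= => -> /ltnW.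
    by [].
  have [_ aa ab _] := rootA k kr'; have [_ ba bb _] := rootB k kr'.
  have [xak xbk] : x != a k /\ x != b k.
    move/eqP: xab; rewrite mulf_eq0 !subr_eq0 => /orP[/eqP->|/eqP->].
      by rewrite eq_sym aa eq_sym ba.
    by rewrite eq_sym ab eq_sym bb.
  split=> //=; rewrite (prev k x) // -E AS //.
  by ring.
split.
- move=> i /andP[i1 id].
  have pi j : (1 <= j <= i)%N -> 0 < p j.
    by move=> /andP[j1 ji]; rewrite p0 // j1 (leq_ltn_trans ji).
  have id' : (i.-1 < d)%N by rewrite (leq_ltn_trans (leq_pred _)).
  have T0 : T i != 0 by rewrite TE // chain_neq0.
  have TT : T i != T i.-1 by rewrite !TE // chain_neq_prev.
  have [i2|i2] := ltnP i.+1 d.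
    have pi' j : (1 <= j <= i.+1)%N -> 0 < p j.
      by move=> /andP[j1 ji]; rewrite p0 // j1 (leq_ltn_trans ji).
    split=> //; first by rewrite eq_sym !TE // chain_neq_prev.
    rewrite !TE // -[(_ - chain p i.+1)^-1]mul1r.
    apply: (@chain_equation _ L p (fun=> 1)) => //.
    by rewrite pS ?mul1r // i1 -ltnS prednK.
  have iE : i = d.-1 by apply/eqP; rewrite -eqSS prednK // eqn_leq id.
  have dr' : (d <= d < r)%N by rewrite leqnn.
  have [aZ _ _ _] := rootA d dr'; have [bZ _ _ _] := rootB d dr'.
  have Ta : T i != a d by rewrite iE Td eq_sym.
  have Tb : T i != b d by rewrite iE Td eq_sym.
  split=> //.
  have [|_ ->] := reproduction_log_derivative (x := T i) (rep d dr') _ T0 Ta Tb.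
    by rewrite iE Td subrr mul0r.
  have dr2 : (d <= d <= r)%N by rewrite leqnn.
  have ZE : Zc d.+1 = ratio (q d) * T i by rewrite ZcS // iE Td.
  rewrite ZE inv_sub_next; last by rewrite ltW // q_gt0.
  have -> : T i = ratio (p i) * T i.-1.
    by rewrite !TE //; case: (i) i1 => // j _; rewrite chainS.
  rewrite inv_sub_prev ?pi ?i1 ?leqnn //.
  have d2 : (1 < d)%N by rewrite -(prednK d1) ltnS -iE.
  rewrite iE (pd d2) /q; ring.
- move=> k kr; have [ab a0 b0 aZ bZ] := generic k kr.
  split=> //; apply: pair => //; rewrite ?subrr ?mul0r ?mulr0 //.
  + exact: rootA.
  + exact: rootB.
- have [_ aa _ _] := rootA _ r1; have [_ ba _ _] := rootB _ r1.
  rewrite prednK // in aa ba.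
  split; [by rewrite bE| |by rewrite eq_sym|by rewrite eq_sym] => _.
  by rewrite aE Zc_neq0 // leqW //= leqnn.
- have [_ aa _ _] := rootA _ r1; have [_ ba _ _] := rootB _ r1.
  rewrite prednK // in aa ba.
  have ar0 : a r != 0 by rewrite aE Zc_neq0 // leqW //= leqnn.
  have aa' : a r != a r.-1 by rewrite eq_sym.
  have ba' : a r != b r.-1 by rewrite eq_sym.
  rewrite (prev _ _ r1) ?prednK // ?subrr ?mul0r //.
  have qE : q r = A r by rewrite /q /M; ring.
  have ArE : A r = A r.-1 + L r + 1 by have := AS r1; rewrite prednK.
  have LE : L r = A r - A r.-1 - 1 by rewrite ArE; ring.
  by rewrite aE ZcS // qE inv_sub_prev ?A0 // LE; ring.
Qed.
End Double.

(** * The Bethe ansatz equation color by color *)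

Section Colors.
Variable ls : seq nat.

(** The coordinates of color [k] occupy the positions from [color_offset k] up to, but excluding,
    [color_offset k.+1]. *)
Definition color_offset k := (\sum_(1 <= i < k) nth 0 ls i.-1)%N.

Local Notation off := color_offset.

Lemma color_offsetS k : (1 <= k)%N -> off k.+1 = (off k + nth 0 ls k.-1)%N.
Proof. by move=> k1; rewrite /off big_nat_recr. Qed.

Lemma color_offset_end : off (size ls).+1 = sumn ls.
Proof.
by rewrite /off big_add1 /= sumnE [RHS](big_nth 0%N).
Qed.

Lemma color_offset_le k : (off k <= off k.+1)%N.
Proof. by case: k => [|k]; [rewrite /off !big_geq | rewrite [off k.+2]color_offsetS // leq_addr]. Qed.

Lemma nth_colors_eq j k : (1 <= k <= size ls)%N ->
  (nth 0 (colors ls) j == k)%N = (off k <= j < off k.+1)%N.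
Proof.
pose f i := nth 0%N ls i.-1.
(* Generalized to lists starting at color [m] for the induction. Beyond the end of the list [nth]
   returns 0, which is not a color. *)
suff main n m j' : (1 <= m)%N -> forall k', (1 <= k')%N ->
    (nth 0 (flatten [seq nseq (f i) i | i <- iota m n]) j' == k')%N =
    (m <= k' < m + n)%N && (\sum_(m <= i < k') f i <= j' < \sum_(m <= i < k'.+1) f i)%N.
  by move=> /andP[k1 kl]; rewrite main // add1n ltnS k1 kl.
elim: n m j' => [|n IHn] m j' m1 k' k1.
  by rewrite /= nth_nil addn0 ltn_eqF //; case: (leqP m k') => //= mk; rewrite ltnNge mk.
rewrite /= nth_cat size_nseq nth_nseq.
have [jm|mj] := ltnP j' (f m).
  have [mk|km|<-] := ltngtP m k' => //=.
    by rewrite [in RHS]big_ltn // [(f m + _ <= j')%N]leqNgt (leq_trans jm) ?leq_addr // andbF.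
  by rewrite -addSnnS leq_addr /= big_geq // big_nat1 jm.
rewrite IHn // addSnnS; have [mk|km|<-] := ltngtP m k' => //=; last first.
  by rewrite big_nat1 [(j' < _)%N]ltnNge mj !andbF.
congr (_ && _).
have mk1 : (m < k'.+1)%N by apply: ltnW.
by rewrite (big_ltn mk) (big_ltn mk1) leq_subRL // ltn_subLR.
Qed.

Lemma color_range (j : 'I_(sumn ls)) : (1 <= color j <= size ls)%N.
Proof.
have : color j \in colors ls by rewrite mem_nth // size_colors.
move=> /flatten_mapP [k]; rewrite mem_iota mem_nseq => /andP[k1 kl] /andP[_ /eqP ->].
by rewrite k1 -ltnS -add1n.
Qed.

Lemma color_eq (j : 'I_(sumn ls)) k : (1 <= k)%N ->
  (color j == k) = (off k <= j < off k.+1)%N.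
Proof.
move=> k1; have [kl|lk] := leqP k (size ls); first by rewrite nth_colors_eq ?k1.
rewrite ltn_eqF; last by have /andP[_ /leq_ltn_trans] := color_range j; apply.
apply/esym/negP => /andP[jk _].
have : (off (size ls).+1 <= off k)%N.
  elim: k lk {k1 jk} => // k IHk; rewrite leq_eqVlt => /orP[/eqP <- //|lk].
  by apply: leq_trans (IHk lk) (color_offset_le k).
by rewrite color_offset_end leqNgt (leq_ltn_trans jk).
Qed.

Lemma color_offset_bound k : (off k <= sumn ls)%N.
Proof.
have mono a b : (a <= b)%N -> (off a <= off b)%N.
  move=> /subnKC <-; elim: (b - a)%N => [|n IHn]; first by rewrite addn0.
  by rewrite addnS (leq_trans IHn) ?color_offset_le.
rewrite -color_offset_end; have [|lk] := leqP k (size ls).+1; first exact: mono.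
rewrite /off (big_cat_nat (n := (size ls).+1)) //= ?[X in (_ + X)%N]big_nat ?[X in (_ + X)%N]big1 ?addn0 //.
  by move=> i /andP[li _]; rewrite nth_default // -ltnS prednK // (leq_trans _ li).
exact: ltnW.
Qed.

Section Roots.
Variables (T : Type) (t0 : T) (t : 'I_(sumn ls) -> T).

(** Extended by a default to all positions, so that a color becomes an interval of natural
    numbers. *)
Definition root_seq m := oapp t t0 (insub m).

Lemma root_seqE (j : 'I_(sumn ls)) : root_seq j = t j.
Proof. by rewrite /root_seq valK. Qed.

Lemma big_color (R : Type) (idx : R) (op : Monoid.com_law idx) k (F : nat -> T -> R) :
  (1 <= k)%N ->
  \big[op/idx]_(j < sumn ls | color j == k) F j (t j) =
  \big[op/idx]_(off k <= m < off k.+1) F m (root_seq m).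
Proof.
move=> k1; have kk := color_offset_le k; have kl := color_offset_bound k.+1.
transitivity (\big[op/idx]_(0 <= m < sumn ls | (off k <= m < off k.+1)%N) F m (root_seq m)).
  rewrite big_mkord; apply: eq_big => j; first exact: color_eq.
  by rewrite root_seqE.
rewrite (big_cat_nat (n := off k)) //= ?(leq_trans kk) //.
rewrite [X in op X _]big_nat_cond [X in op X _]big_pred0 ?Monoid.mul1m; last first.
  by move=> m; case: ltnP => //= mk; rewrite andbF.
rewrite (big_cat_nat (n := off k.+1)) //=.
rewrite [X in op _ X]big_nat_cond [X in op _ X]big_pred0 ?Monoid.mulm1; last first.
  by move=> m; case: (leqP (off k.+1) m) => //= mk; rewrite !andbF.
rewrite [LHS]big_nat_cond [RHS]big_nat_cond; apply: eq_bigl => m.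
by rewrite andbb andbT.
Qed.

Lemma forall_color k (P : nat -> T -> Prop) : (1 <= k)%N ->
  (forall j : 'I_(sumn ls), color j == k -> P j (t j)) <->
  (forall m, (off k <= m < off k.+1)%N -> P m (root_seq m)).
Proof.
move=> k1; split=> H.
  move=> m mk; have ml : (m < sumn ls)%N.
    by case/andP: mk => _ /leq_trans; apply; apply: color_offset_bound.
  rewrite -[m]/(val (Ordinal ml)) root_seqE; apply: H.
  by rewrite color_eq.
by move=> j; rewrite color_eq // -root_seqE; apply: H.
Qed.

End Roots.
End Colors.

(** * The equation at a single coordinate *)

Section BetheEquations.
Variables (C : numClosedFieldType) (r : nat) (lam : 'rV[C]_r) (ls : r.-tuple nat).
Hypothesis r3 : (3 <= r)%N.

Local Notation L := (label lam).
Local Notation off := (color_offset ls).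
Implicit Type t : 'I_(sumn ls) -> C.

(** For [k < r] this is minus the Cartan integer of [alpha k.+1] against the coroot of [alpha k];
    the other neighbor always gives -1. *)
Definition weight k : C := if k.+1 == r then 2%:R else 1.

(* Half the square length of a simple root. *)
Let nrm k : C := if k == r then 2%:R else 1.

Let r0 : (0 < r)%N. Proof. exact: leq_trans r3. Qed.

Lemma form_lam_alpha k : (1 <= k <= r)%N -> form (alpha k) lam = nrm k * L k.
Proof.
move=> kr; rewrite label_form // formC /nrm /alpha.
case: eqP => [->|_]; last by rewrite mul1r.
by rewrite formMnr formBr form_eps_out subr0 mulr_natl.
Qed.

Lemma form_omega1_alpha k : (1 <= k <= r)%N ->
  form (alpha k) (omega 1 : 'rV[C]_r) = (k == 1%N)%:R.
Proof.
move=> kr; have /andP[k1 kr'] := kr; rewrite omega1 /alpha; case: eqP => [->|_].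
  rewrite formMnl form_eps ?r0 ?leqnn //.
  by rewrite gtn_eqF ?mul0rn // (leq_trans _ r3).
rewrite formBl form_eps // formC form_eps ?r0 //.
by rewrite (ltn_eqF (_ : 1 < k.+1)%N) ?subr0.
Qed.

Lemma form_alpha_alpha k m : (1 <= k <= r)%N -> (1 <= m <= r)%N ->
  form (alpha k) (alpha m : 'rV[C]_r) = nrm k *
    (2%:R * (m == k)%:R - (m.+1 == k)%:R - weight k * (m == k.+1)%:R).
Proof.
move=> /andP[k1 kr] /andP[m1 mr]; rewrite /nrm /weight.
have [->|mk] := eqVneq m k.
  rewrite (gtn_eqF (ltnSn k)) (ltn_eqF (ltnSn k)) mulr0 !subr0 mulr1.
  have [->|kr'] := eqVneq k r; first by rewrite form_alpha_long // -natrM.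
  by rewrite form_alpha_short ?mul1r // k1 ltn_neqAle kr'.
have [mk1|mk1] := eqVneq m.+1 k.
  have kE : (m == k.+1) = false by apply/eqP => e; lia.
  rewrite kE !mulr0 subr0 sub0r mulrN1 formC -mk1.
  have [mr1|mr1] := eqVneq m.+1 r; first by rewrite mr1 form_alpha_last.
  by rewrite form_alpha_next //; lia.
rewrite mulr0 subrr sub0r; have [mE|km] := eqVneq m k.+1.
  have kr' : (k == r) = false by apply/eqP => e; lia.
  rewrite kr' mul1r mulr1 mE; case: eqP => [E|E]; first by rewrite E form_alpha_last.
  by rewrite form_alpha_next //; lia.
rewrite mulr0 oppr0 mulr0.
have [lkm|lmk|e] := ltngtP k m.
- by rewrite form_alpha_far //; lia.
- by rewrite formC form_alpha_far //; lia.
- by rewrite e eqxx in mk.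
Qed.

(** The equation of a coordinate of color [k] divided by minus half the square length of [alpha k],
    with the interaction inside the color moved to the right. *)
Definition local_bethe (T : nat -> C) k m :=
  [/\ L k != 0 -> T m != 0,
      if k == 1%N then is_true (T m != 1)
      else forall m', (off k.-1 <= m' < off k)%N -> T m != T m',
      forall m', (off k.+1 <= m' < off k.+2)%N -> T m != T m',
      forall m', (off k <= m' < off k.+1)%N -> m' != m -> T m != T m' &
      L k / T m
      + (if k == 1%N then (T m - 1)^-1
         else \sum_(off k.-1 <= m' < off k) (T m - T m')^-1)
      + weight k * \sum_(off k.+1 <= m' < off k.+2) (T m - T m')^-1
      = 2%:R * \sum_(off k <= m' < off k.+1 | m' != m) (T m - T m')^-1].

(** [alpha k] pairs nontrivially only with the colors [k.-1], [k] and [k.+1], so conditions and sums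
    split into these three colors. *)
Lemma bethe_solutionE t :
  bethe_solution [tuple lam; omega 1] [tuple 0; 1] t <->
  forall k, (1 <= k <= r)%N -> forall m, (off k <= m < off k.+1)%N ->
    local_bethe (root_seq 0 t) k m.
Proof.
have cr (j : 'I_(sumn ls)) : (1 <= color j <= r)%N.
  by have := color_range j; rewrite size_tuple.
have nrm0 k : nrm k != 0 by rewrite /nrm; case: ifP; rewrite ?pnatr_eq0 ?oner_eq0.
have weight0 k : weight k != 0 by rewrite /weight; case: ifP; rewrite ?pnatr_eq0 ?oner_eq0.
set T := root_seq 0 t.
suff loc (i : 'I_(sumn ls)) k : color i = k ->
    (let a (s : 'I_2) := form (alpha (color i)) (tnth [tuple lam; omega 1] s) in
     let b (j : 'I_(sumn ls)) :=
       form (alpha (color i)) (alpha (color j) : 'rV[C]_r) in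
     [/\ forall s, a s != 0 -> t i != tnth [tuple 0; 1] s,
         forall j, j != i -> b j != 0 -> t i != t j &
         - (\sum_(s < 2 | a s != 0) a s / (t i - tnth [tuple 0; 1] s))
         + \sum_(j < sumn ls | (j != i) && (b j != 0)) b j / (t i - t j) = 0]) <->
    local_bethe T k i.
  split=> [H k kr m mk|H i].
    have ml : (m < sumn ls)%N.
      by case/andP: mk => _ /leq_trans; apply; apply: color_offset_bound.
    have cE : color (Ordinal ml) = k.
      by apply/eqP; rewrite color_eq //; case/andP: kr.
    exact: (loc (Ordinal ml) k cE).1 (H (Ordinal ml)).
  apply: (loc i (color i) erefl).2; apply: H => //.
  by rewrite -color_eq //; case/andP: (cr i).
move=> ik; rewrite ik; have kr : (1 <= k <= r)%N by rewrite -ik.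
have k1 : (1 <= k)%N by case/andP: kr.
rewrite /local_bethe [T i]root_seqE.
have TE j : t j = T j by rewrite [RHS]root_seqE.
have sumk h (P : pred nat) : (1 <= h)%N ->
    \sum_(off h <= m < off h.+1 | P m) (t i - T m)^-1 =
    \sum_(j < sumn ls | (color j == h) && P j) (t i - t j)^-1.
  move=> h1; rewrite big_mkcond.
  rewrite -(@big_color ls _ 0 t _ _ _ h (fun m x => if P m then (t i - x)^-1 else 0)) //.
  by rewrite [RHS]big_mkcondr.
have sumk' h : (1 <= h)%N -> \sum_(off h <= m < off h.+1) (t i - T m)^-1 =
    \sum_(j < sumn ls | color j == h) (t i - t j)^-1.
  by move=> h1; rewrite sumk //; apply: eq_bigl => j; rewrite andbT.
pose S0 := \sum_(j < sumn ls | color j == k) (if j != i then (t i - t j)^-1 else 0).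
pose Sm := \sum_(j < sumn ls | (color j).+1 == k) (t i - t j)^-1.
pose Sp := \sum_(j < sumn ls | color j == k.+1) (t i - t j)^-1.
have E0 : \sum_(off k <= m' < off k.+1 | m' != i) (t i - T m')^-1 = S0.
  rewrite sumk // /S0 -big_mkcondr; apply: eq_bigl => j.
  by rewrite (inj_eq val_inj).
have km1 : (k == 1%N) = false -> (1 <= k.-1)%N /\ k.-1.+1 = k.
  by move=> /eqP kn; split; lia.
have Em : (if k == 1%N then (t i - 1)^-1
   else \sum_(off k.-1 <= m' < off k) (t i - T m')^-1) = (k == 1%N)%:R / (t i - 1) + Sm.
  case kE: (k == 1%N).
    rewrite mul1r [Sm]big1 ?addr0 // => j.
    by move=> /eqP jk; have /andP[] := cr j; rewrite -ltnS jk (eqP kE).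
  have [kp kp'] := km1 kE; rewrite mul0r add0r -[in off k]kp' sumk' // /Sm.
  by apply: eq_bigl => j; rewrite -[in RHS]kp' eqSS.
rewrite E0 Em sumk' // -/Sp.
have bE (j : 'I_(sumn ls)) : form (alpha k) (alpha (color j) : 'rV[C]_r) = nrm k *
    (2%:R * (color j == k)%:R - ((color j).+1 == k)%:R - weight k * (color j == k.+1)%:R).
  exact: form_alpha_alpha kr (cr j).
have b0 (j : 'I_(sumn ls)) : (form (alpha k) (alpha (color j) : 'rV[C]_r) != 0) =
    [|| color j == k, (color j).+1 == k | color j == k.+1].
  rewrite bE mulf_eq0 (negPf (nrm0 k)) /=.
  have [->|jk] := eqVneq (color j) k.
    rewrite (gtn_eqF (ltnSn k)) (ltn_eqF (ltnSn k)) mulr0 !subr0 mulr1.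
    by rewrite pnatr_eq0.
  have [<-|jk'] := eqVneq (color j).+1 k.
    rewrite (ltn_eqF (ltnW _)) // !mulr0 subr0 sub0r oppr_eq0.
    by rewrite oner_eq0.
  rewrite mulr0 subr0 sub0r oppr_eq0 mulf_eq0 (negPf (weight0 k)) pnatr_eq0.
  by case: (color j == k.+1).
have aE : \sum_(s < 2 | form (alpha k) (tnth [tuple lam; omega 1] s) != 0)
    form (alpha k) (tnth [tuple lam; omega 1] s) / (t i - tnth [tuple 0; 1] s) =
    nrm k * (L k / t i + (k == 1%N)%:R / (t i - 1)).
  (* Division being total, the omitted terms may be put back: a zero numerator gives 0 whatever the
     denominator. *)
  have drop0 (x y : C) : (if x != 0 then x / y else 0) = x / y.
    by have [->|] := eqVneq x 0; rewrite ?mul0r.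
  rewrite big_mkcond big_ord_recl big_ord1 /= !drop0 !(tnth_nth 0) /=.
  rewrite form_lam_alpha // form_omega1_alpha // subr0 mulrDr; congr (_ + _); first exact/esym/mulrA.
  case kE: (k == 1%N); last by rewrite !mul0r mulr0.
  by rewrite /nrm (eqP kE) ltn_eqF ?(leq_trans _ r3) // mul1r.
have bsum : \sum_(j < sumn ls | (j != i) && (form (alpha k) (alpha (color j) : 'rV[C]_r) != 0))
    form (alpha k) (alpha (color j) : 'rV[C]_r) / (t i - t j) =
    nrm k * (2%:R * S0 - Sm - weight k * Sp).
  transitivity (\sum_(j < sumn ls | j != i)
      form (alpha k) (alpha (color j) : 'rV[C]_r) / (t i - t j)).
    rewrite big_mkcondr; apply: eq_bigr => j _.
    by case: eqP => // ->; rewrite mul0r.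
  rewrite /S0 /Sm /Sp big_mkcond ![\sum_(j < _ | color j == _) _]big_mkcond.
  rewrite [\sum_(j < _ | _.+1 == _) _]big_mkcond /= !mulr_sumr -!sumrB mulr_sumr.
  apply: eq_bigr => j _; have [->|ji] := eqVneq j i.
    rewrite ik eqxx (gtn_eqF (ltnSn k)) (ltn_eqF (ltnSn k)).
    by rewrite !mulr0 !subr0 mulr0.
  rewrite bE -mulrA; congr (_ * _).
  rewrite !mulrBl -!mulrA; congr (_ * _ - _ - _ * _).
  - by case: eqP; rewrite ?mul1r ?mul0r.
  - by case: eqP; rewrite ?mul1r ?mul0r.
  - by case: eqP; rewrite ?mul1r ?mul0r.
rewrite /= aE bsum.
have eqE : - (nrm k * (L k / t i + (k == 1%N)%:R / (t i - 1))) +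
     nrm k * (2%:R * S0 - Sm - weight k * Sp) = 0 <->
   L k / t i + ((k == 1%N)%:R / (t i - 1) + Sm) + weight k * Sp = 2%:R * S0.
  split=> [E|E].
    apply: (mulfI (nrm0 k)); apply: (linear_combination (k := - 1) E); ring.
  by apply: (linear_combination (k := - nrm k) E); ring.
have aC : (forall s, form (alpha k) (tnth [tuple lam; omega 1] s) != 0 ->
      t i != tnth [tuple 0; 1] s) <->
    (L k != 0 -> t i != 0) /\ (k == 1%N -> t i != 1).
  split=> [H|[H1 H2] s].
    split=> [Lk|kE].
      have := H ord0; rewrite !(tnth_nth 0) /= form_lam_alpha //; apply.
      by rewrite mulf_neq0.
    have := H (lift ord0 ord0); rewrite !(tnth_nth 0) /= form_omega1_alpha // kE; apply.
    by rewrite oner_eq0.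
  rewrite !(tnth_nth 0); case: s => -[|[|//]] sl /=.
    by rewrite form_lam_alpha // mulf_eq0 negb_or => /andP[_].
  rewrite form_omega1_alpha // => kE; apply: H2.
  by move: kE; rewrite pnatr_eq0; case: (k == 1%N).
have fc h (Q : nat -> Prop) : (1 <= h)%N ->
    (forall j : 'I_(sumn ls), color j == h -> Q j -> t i != t j) <->
    (forall m, (off h <= m < off h.+1)%N -> Q m -> t i != T m).
  by move=> h1; apply: (forall_color 0 t (fun m x => Q m -> t i != x) h1).
split.
- move=> [/aC [H1 H2] H3 /eqE H4]; split=> //.
  + case kE: (k == 1%N); first exact: H2.
    have [kp kp'] := km1 kE; rewrite -[in off k]kp' => m mk.
    apply: ((fc k.-1 (fun=> True) kp).1 _ m mk) => // j jk _.
    have jk' : (color j).+1 == k by rewrite -kp' eqSS.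
    apply: H3; last by rewrite b0 jk' orbT.
    by apply: contraTneq jk' => ->; rewrite ik gtn_eqF.
  + move=> m mk; apply: ((fc k.+1 (fun=> True) isT).1 _ m mk) => // j jk _.
    apply: H3; last by rewrite b0 jk !orbT.
    by apply: contraTneq jk => ->; rewrite ik ltn_eqF.
  + move=> m mk mi; apply: ((fc k (fun m => m != i) k1).1 _ m mk) => // j jk ji.
    by apply: H3; rewrite ?b0 ?jk.
- move=> [H1 H2 H3 H3' H4]; split; [|move=> j ji|exact/eqE].
    by apply/aC; split=> // kE; rewrite kE in H2.
  rewrite b0 => /or3P[jk|jk|jk].
  + exact: ((fc k (fun m => m != i) k1).2 H3' j jk).
  + case kE: (k == 1%N).
      by move: jk (cr j); rewrite (eqP kE) eqSS => /eqP ->.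
    rewrite kE in H2; have [kp kp'] := km1 kE.
    apply: ((fc k.-1 (fun=> True) kp).2 _ j) => //; last by rewrite -eqSS kp'.
    by rewrite kp' => m mk _; apply: H2.
  + by apply: ((fc k.+1 (fun=> True) isT).2 _ j) => // m mk _; apply: H3.
Qed.

End BetheEquations.

(** * Solutions up to permutation *)

Section Permutations.
Variables (K : fieldType) (ls : seq nat).
Implicit Type t : 'I_(sumn ls) -> K.

(** The polynomials determine the multiset of pairs of a color and a root, and a permutation
    matching the pairs preserves colors automatically. *)
Lemma same_up_to_perm_y_poly t t' :
  (forall k, (1 <= k <= size ls)%N -> y_poly t' k = y_poly t k) -> same_up_to_perm t t'.
Proof.
move=> yE.
pose P t := [tuple (color j, t j) | j < sumn ls].
have yP u k : y_poly u k =
    \prod_(x <- [seq u j | j <- enum 'I_(sumn ls) & color j == k]) ('X - x%:P).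
  by rewrite big_map big_filter big_enum_cond.
have countP u k x : count_mem (k, x) (P u) =
    count_mem x [seq u j | j <- enum 'I_(sumn ls) & color j == k].
  have PE : P u = [seq (color j, u j) | j <- enum 'I_(sumn ls)] :> seq _.
    by congr map; exact: val_ord_tuple.
  rewrite PE; move: (enum 'I_(sumn ls)) => e.
  rewrite !count_map count_filter; apply: eq_count => j /=.
  by rewrite xpair_eqE andbC.
have : perm_eq (P t') (P t).
  apply/allP => -[k x]; rewrite mem_cat => kx; apply/eqP.
  rewrite !countP; apply/seq.permP; apply: prod_XsubC_eq; rewrite -!yP yE //.
  by case/orP: kx => /mapP [j _ [-> _]]; apply: color_range.
move=> /tuple_permP [s sE]; exists s => j.
  have := congr1 (fun u => nth (0%N, 0) u j) sE.
  by rewrite -!tnth_nth !tnth_mktuple => -[].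
have := congr1 (fun u => nth (0%N, 0) u j) sE.
by rewrite -!tnth_nth !tnth_mktuple => -[].
Qed.

End Permutations.

(** * Tuples with at most one root of each color *)

Section SingleTuple.
Variables (C : numClosedFieldType) (r : nat) (lam : 'rV[C]_r) (ls : r.-tuple nat) (l : nat).
Hypothesis lr : (l <= r)%N.
Hypothesis lsE : ls = nseq l 1%N ++ nseq (r - l) 0%N :> seq nat.

Local Notation off := (color_offset ls).

Lemma offset_single k : off k = minn k.-1 l.
Proof.
elim: k => [|[|k] IHk]; first by rewrite /off big_geq ?min0n.
  by rewrite /off big_geq ?min0n.
rewrite color_offsetS // IHk lsE nth_cat size_nseq !nth_nseq /=.
have [kl|lk] := ltnP k l.
  by rewrite (minn_idPl kl) addn1.
rewrite (minn_idPr (leqW lk)).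
by case: ifP; rewrite addn0.
Qed.

Lemma sumn_single : sumn ls = l.
Proof. by rewrite -color_offset_end size_tuple offset_single; apply/minn_idPr. Qed.

(** Positions count from 0 and colors from 1; the freed index 0 holds the singular point z_2 = 1. *)
Definition point_seq (T : nat -> C) i : C := if i is j.+1 then T j else 1.

Lemma local_bethe_single T :
  (forall k, (1 <= k <= r)%N -> forall m, (off k <= m < off k.+1)%N -> local_bethe lam ls T k m)
  <-> single_bethe r l (label lam) (point_seq T).
Proof.
have offl k : (k <= l)%N -> off k.+1 = k by move=> kl; rewrite offset_single; apply/minn_idPl.
have offr k : (l <= k)%N -> off k.+1 = l by move=> kl; rewrite offset_single; apply/minn_idPr.
have range k m : (off k.+1 <= m < off k.+2)%N = (k < l)%N && (m == k).
  have [kl|lk] := ltnP k l; last first.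
    by rewrite !offr ?(leqW lk) //; case: ltngtP.
  by rewrite !offl ?(ltnW kl) // ltnS -eqn_leq eq_sym.
have sum1 k (F : nat -> C) : (k < l)%N -> \sum_(off k.+1 <= m < off k.+2) F m = F k.
  by move=> kl; rewrite !offl ?(ltnW kl) // big_nat1.
have sum0 k (P : pred nat) (F : nat -> C) : (l <= k)%N ->
    \sum_(off k.+1 <= m < off k.+2 | P m) F m = 0.
  by move=> lk; rewrite !offr ?(leqW lk) // big_geq.
have sumd k (F : nat -> C) : (k < l)%N -> \sum_(off k.+1 <= m < off k.+2 | m != k) F m = 0.
  move=> kl; rewrite big_nat_cond big1 // => m /andP[].
  by rewrite range => /andP[_ /eqP ->]; rewrite eqxx.
suff loc k : (k < l)%N -> local_bethe lam ls T k.+1 k <->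
  [/\ label lam k.+1 != 0 -> point_seq T k.+1 != 0,
      point_seq T k.+1 != point_seq T k,
      (k.+1 < l)%N -> point_seq T k.+1 != point_seq T k.+2 &
      label lam k.+1 / point_seq T k.+1 + (point_seq T k.+1 - point_seq T k)^-1 +
      (if (k.+1 < l)%N then (if k.+2 == r then 2%:R else 1) /
         (point_seq T k.+1 - point_seq T k.+2) else 0) = 0].
  split=> [H [|k] // kl|H [|k] // kr m].
    have {}kl : (k < l)%N := kl.
    apply: (loc k kl).1; apply: H; first by rewrite (leq_trans kl).
    by rewrite range kl eqxx.
  by rewrite range => /andP[kl /eqP ->]; apply: (loc k kl).2; apply: H.
move=> kl; rewrite /local_bethe sumd // mulr0 /=.
have nextE : weight C r k.+1 * \sum_(off k.+2 <= m' < off k.+3) (T k - T m')^-1 =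
   (if (k.+1 < l)%N then (if k.+2 == r then 2%:R else 1) / (T k - T k.+1) else 0).
  by case: ltnP => kl'; [rewrite sum1 | rewrite sum0 ?mulr0].
rewrite nextE.
have prevE : (if k.+1 == 1%N then (T k - 1)^-1
     else \sum_(off k <= m' < off k.+1) (T k - T m')^-1) = (T k - point_seq T k)^-1.
  by case: (k) kl => [|j] kl //=; rewrite sum1 // ltnW.
rewrite prevE.
have prevne : (if k.+1 == 1%N then is_true (T k != 1)
     else forall m', (off k <= m' < off k.+1)%N -> T k != T m') <-> T k != point_seq T k.
  case: (k) kl => [|j] kl //=; split=> [|H m]; first by apply; rewrite range eqxx ltnW.
  by rewrite range => /andP[_ /eqP ->].
split=> [[H1 /prevne H2 H3 _ H4]|[H1 /prevne H2 H3 H4]]; split=> //.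
- by move=> kl'; apply: H3; rewrite range kl' eqxx.
- by move=> m; rewrite range => /andP[kl' /eqP ->]; apply: H3.
- by move=> m; rewrite range => /andP[_ /eqP ->]; rewrite eqxx.
Qed.

Lemma y_poly_single (t : 'I_(sumn ls) -> C) k :
  y_poly t k.+1 = if (k < l)%N then 'X - (point_seq (root_seq 0 t) k.+1)%:P else 1.
Proof.
rewrite /y_poly (@big_color ls _ 0 t _ _ _ k.+1 (fun _ x => 'X - x%:P)) // !offset_single /=.
have [kl|lk] := ltnP k l.
  by rewrite (minn_idPl kl) big_nat1.
by rewrite (minn_idPr (leqW lk)) big_geq.
Qed.

End SingleTuple.

(** * Tuples with two roots in the middle colors *)

Section DoubleTuple.
Variables (C : numClosedFieldType) (r : nat) (lam : 'rV[C]_r) (ls : r.-tuple nat) (h : nat).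
Hypothesis r3 : (3 <= r)%N.
Hypothesis hr : (h <= r - 2)%N.
Hypothesis lsE : ls = nseq h 1%N ++ nseq (r - 1 - h) 2%N ++ [:: 1%N] :> seq nat.

Local Notation off := (color_offset ls).
Local Notation d := h.+1.

Lemma offset_low k : (k <= h)%N -> off k.+1 = k.
Proof.
elim: k => [|k IHk] kh; first by rewrite /off big_geq.
by rewrite color_offsetS // IHk ?(ltnW kh) // lsE nth_cat size_nseq nth_nseq /= kh addn1.
Qed.

Lemma offset_high k : (d <= k <= r)%N -> off k = (h + 2 * (k - d))%N.
Proof.
move=> /andP[dk kr]; rewrite -(subnKC dk); move: (k - d)%N (subnKC dk) => n nk.
have {nk dk kr k} nr : (d + n <= r)%N by rewrite nk.
elim: n nr => [|n IHn] nr; first by rewrite addn0 subnn muln0 addn0 offset_low.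
rewrite addnS color_offsetS ?addSn // IHn ?(leq_trans _ nr) ?addnS //.
rewrite lsE nth_cat size_nseq /= ltnNge leq_addr /= nth_cat size_nseq !addKn.
have -> : (n < r - 1 - h)%N by lia.
by rewrite nth_nseq (_ : (n < r - 1 - h)%N); lia.
Qed.

Lemma offset_last : off r.+1 = (off r).+1.
Proof.
rewrite color_offsetS; last by lia.
rewrite lsE nth_cat size_nseq; have -> : (r.-1 < h)%N = false by lia.
by rewrite nth_cat size_nseq subn1 ltnn subnn addn1.
Qed.

Lemma offset_end : off r.+2 = off r.+1.
Proof. by rewrite color_offsetS // nth_default ?addn0 // size_tuple. Qed.

Lemma sumn_double : sumn ls = (2 * r - d)%N.
Proof.
rewrite -color_offset_end size_tuple offset_last offset_high; lia.
Qed.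

Definition first_root (T : nat -> C) k := T (off k).
(** The only root of color [r] is returned a second time, to match [a r = b r] in [double_bethe]. *)
Definition second_root (T : nat -> C) k := if k == r then T (off k) else T (off k).+1.

Lemma local_bethe_double T :
  (forall k, (1 <= k <= r)%N -> forall m, (off k <= m < off k.+1)%N -> local_bethe lam ls T k m)
  <-> double_bethe r d (label lam) (point_seq T) (first_root T) (second_root T).
Proof.
set a := first_root T; set b := second_root T; set p := point_seq T.
have hr1 : (d < r)%N by lia.
have off2 k : (d <= k < r)%N -> off k.+1 = (off k).+2.
  by move=> /andP[dk kr]; rewrite !offset_high; lia.
have bE k : (d <= k < r)%N -> b k = T (off k).+1.
  by move=> /andP[_ kr]; rewrite /b /second_root ltn_eqF.
have br : b r = a r by rewrite /b /second_root eqxx.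
have sum_low k (F : nat -> C) : (k < h)%N -> \sum_(off k.+1 <= m < off k.+2) F m = F k.
  by move=> kh; rewrite !offset_low ?(ltnW kh) // big_nat1.
have sum_high k (F : C -> C) : (d <= k < r)%N ->
    \sum_(off k <= m < off k.+1) F (T m) = F (a k) + F (b k).
  by move=> kr; rewrite (off2 k kr) big_nat_recl // big_nat1 bE.
have sum_r (F : C -> C) : \sum_(off r <= m < off r.+1) F (T m) = F (a r).
  by rewrite offset_last big_nat1.
have range_low k m : (k < h)%N -> (off k.+1 <= m < off k.+2)%N = (m == k).
  by move=> kh; rewrite !offset_low ?(ltnW kh) // ltnS -eqn_leq eq_sym.
have range_high k m : (d <= k < r)%N ->
    (off k <= m < off k.+1)%N = (m == off k) || (m == (off k).+1).
  by move=> kr; rewrite (off2 k kr); apply/idP/idP; lia.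
have range_r m : (off r <= m < off r.+1)%N = (m == off r).
  by rewrite offset_last ltnS -eqn_leq eq_sym.
(* The factor 2 of color [r.-1] towards color [r] is what turns the single root there into the pair
   [a r], [b r]. *)
have next_sum k (F : C -> C) : (d <= k.+1 <= r)%N ->
    weight C r k * \sum_(off k.+1 <= m < off k.+2) F (T m) = F (a k.+1) + F (b k.+1).
  move=> /andP[dk]; rewrite /weight leq_eqVlt; case: eqP => [kr _|_ /= kr].
    by rewrite kr sum_r br mulr_natl mulr2n.
  by rewrite mul1r sum_high // dk.
have next_all k x : (d <= k.+1 <= r)%N ->
    (forall m, (off k.+1 <= m < off k.+2)%N -> x != T m) <-> x != a k.+1 /\ x != b k.+1.
  move=> /andP[dk]; rewrite leq_eqVlt => /orP[/eqP kr|kr].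
    rewrite kr br; split=> [H|[H _] m]; first by split; apply: H; rewrite range_r.
    by rewrite range_r => /eqP ->.
  have dkr : (d <= k.+1 < r)%N by rewrite dk.
  rewrite bE //; split=> [H|[H1 H2] m].
    by split; apply: H; rewrite range_high ?eqxx ?orbT.
  by rewrite range_high // => /orP[/eqP ->|/eqP ->].
pose prev_sum k x := if k == 1%N then (x - 1)^-1
  else \sum_(off k.-1 <= m' < off k) (x - T m')^-1.
pose prev_all k x := if k == 1%N then is_true (x != 1)
  else forall m', (off k.-1 <= m' < off k)%N -> x != T m'.
have prev_low k x : (1 <= k <= d)%N ->
    (prev_all k x <-> x != p k.-1) /\ prev_sum k x = (x - p k.-1)^-1.
  rewrite /prev_all /prev_sum; case: k => [|[|k]] // kh.
  have {}kh : (k < h)%N := kh.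
  split; last by rewrite sum_low.
  split=> [H|H m]; first by apply: H; rewrite range_low.
  by rewrite range_low // => /eqP ->.
have prev_high k x : (d < k <= r)%N ->
    (prev_all k x <-> x != a k.-1 /\ x != b k.-1) /\
    prev_sum k x = (x - a k.-1)^-1 + (x - b k.-1)^-1.
  rewrite /prev_all /prev_sum; case: k => [|[|k]] // /andP[dk kr].
  have kr1 : (d <= k.+1 < r)%N by rewrite -ltnS dk.
  split; last exact: (sum_high k.+1 (fun y => (x - y)^-1)).
  by apply: next_all; rewrite -ltnS dk ltnW.
have loc_low k : (k < h)%N -> local_bethe lam ls T k.+1 k <->
    [/\ label lam k.+1 != 0 -> p k.+1 != 0, p k.+1 != p k,
        if (k.+2 < d)%N then is_true (p k.+1 != p k.+2) else p k.+1 != a d /\ p k.+1 != b d &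
        label lam k.+1 / p k.+1 + (p k.+1 - p k)^-1 +
        (if (k.+2 < d)%N then (p k.+1 - p k.+2)^-1
         else (p k.+1 - a d)^-1 + (p k.+1 - b d)^-1) = 0].
  move=> kh; have kd : (1 <= k.+1 <= d)%N by rewrite /= ltnW.
  rewrite /local_bethe -/(prev_sum k.+1 (T k)) -/(prev_all k.+1 (T k)).
  have [prevE ->] := prev_low k.+1 (T k) kd; rewrite -[T k]/(p k.+1) /=.
  have -> : \sum_(off k.+1 <= m' < off k.+2 | m' != k) (p k.+1 - T m')^-1 = 0.
    rewrite big_nat_cond big1 // => m /andP[].
    by rewrite range_low // => /eqP ->; rewrite eqxx.
  rewrite mulr0.
  have nextE : weight C r k.+1 * \sum_(off k.+2 <= m' < off k.+3) (p k.+1 - T m')^-1 =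
      (if (k.+2 < d)%N then (p k.+1 - p k.+2)^-1
         else (p k.+1 - a d)^-1 + (p k.+1 - b d)^-1).
    case: ltnP => kd'.
      have kh' : (k.+1 < h)%N by rewrite -ltnS.
      by rewrite sum_low // /weight ltn_eqF ?mul1r //; lia.
    have kE : k.+2 = d by apply/eqP; rewrite eqn_leq kd' andbT ltnS.
    by rewrite (next_sum k.+1 (fun y => (p k.+1 - y)^-1)) kE // leqnn ltnW.
  have nextA : (forall m, (off k.+2 <= m < off k.+3)%N -> p k.+1 != T m) <->
      (if (k.+2 < d)%N then is_true (p k.+1 != p k.+2)
       else p k.+1 != a d /\ p k.+1 != b d).
    case: ltnP => kd'.
      have kh' : (k.+1 < h)%N by rewrite -ltnS.
      split=> [H|H m]; first by apply: H; rewrite range_low.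
      by rewrite range_low // => /eqP ->.
    have kE : k.+2 = d by apply/eqP; rewrite eqn_leq kd' andbT ltnS.
    by rewrite -kE; apply: next_all; rewrite kE leqnn ltnW.
  rewrite nextE; split=> [[H1 /prevE H2 /nextA H3 _ H4]|[H1 /prevE H2 /nextA H3 H4]].
    by split.
  split=> // m; rewrite range_low // => /eqP ->; by rewrite eqxx.
(* Symmetric in the two positions of the color, so that it applies to either root. *)
have loc_high k m m' : (d <= k < r)%N -> m != m' ->
    (forall n, (off k <= n < off k.+1)%N = (n == m) || (n == m')) ->
    local_bethe lam ls T k m <->
    T m != T m' /\ pair_condition d (label lam) p a b k (T m) (T m').
  move=> kr mm' rng; have /andP[dk kr'] := kr.
  rewrite /local_bethe /pair_condition -/(prev_sum k (T m)) -/(prev_all k (T m)).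
  have k1r : (d <= k.+1 <= r)%N by rewrite leqW.
  have nextA := next_all k (T m) k1r.
  rewrite (next_sum k (fun y => (T m - y)^-1) k1r).
  have -> : \sum_(off k <= n < off k.+1 | n != m) (T m - T n)^-1 = (T m - T m')^-1.
    have m'r : m' \in index_iota (off k) (off k.+1).
      by rewrite mem_index_iota rng eqxx orbT.
    rewrite big_mkcond (bigD1_seq m') ?iota_uniq //= eq_sym mm' big_nat_cond big1 ?addr0 //.
    move=> n /andP[]; rewrite rng => /orP[/eqP ->|/eqP ->]; rewrite ?eqxx // => _.
  have prevE : (prev_all k (T m) <->
      if k == d then is_true (T m != p d.-1) else T m != a k.-1 /\ T m != b k.-1) /\
      prev_sum k (T m) = (if k == d then (T m - p d.-1)^-1
        else (T m - a k.-1)^-1 + (T m - b k.-1)^-1).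
    case: eqP => [kd|/eqP kd].
      by rewrite kd; apply: prev_low; rewrite leqnn.
    by apply: prev_high; rewrite ltn_neqAle eq_sym kd dk ltnW.
  case: prevE => prevE ->.
  split=> [[H1 /prevE H2 /nextA [H3 H3'] H4 H5]|[H4 [H1 /prevE H2 H3 H3' H5]]].
    split; first by apply: H4; rewrite ?rng ?eqxx ?orbT // eq_sym.
    by split.
  split=> //; first exact/nextA.
  by move=> n; rewrite rng => /orP[/eqP ->|/eqP ->] //; rewrite eqxx.
have r1 : (1 <= r)%N by lia.
have loc_r : local_bethe lam ls T r (off r) <->
    [/\ label lam r != 0 -> a r != 0, a r != a r.-1, a r != b r.-1 &
        label lam r / a r + ((a r - a r.-1)^-1 + (a r - b r.-1)^-1) = 0].
  have dr' : (d < r <= r)%N by rewrite hr1 leqnn.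
  rewrite /local_bethe -/(prev_sum r (T (off r))) -/(prev_all r (T (off r))).
  have [prevE ->] := prev_high r (T (off r)) dr'.
  rewrite offset_end [\sum_(off r.+1 <= _ < _) _]big_geq // mulr0 addr0.
  have -> : \sum_(off r <= m' < off r.+1 | m' != off r) (T (off r) - T m')^-1 = 0.
    rewrite big_nat_cond big1 // => m /andP[].
    by rewrite range_r => /eqP ->; rewrite eqxx.
  rewrite mulr0 -[T (off r)]/(a r).
  split=> [[H1 /prevE [H2 H2'] _ _ H4]|[H1 H2 H2' H4]]; first by split.
  split=> //; first exact/prevE.
    by move=> m /andP[m1 m2]; have := leq_ltn_trans m1 m2; rewrite ltnn.
  by move=> m; rewrite range_r => /eqP ->; rewrite eqxx.
have neqS n : n != n.+1 by rewrite ltn_eqF.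
have rngS k n : (d <= k < r)%N -> (off k <= n < off k.+1)%N = (n == (off k).+1) || (n == off k).
  by move=> kr; rewrite range_high // orbC.
split=> [H|[Hlow Hhigh Hr1 Hr2]].
  split.
  - case=> [|k] // kh; have {}kh : (k < h)%N := kh.
    by apply: (loc_low k kh).1; apply: H; [lia | rewrite range_low].
  - move=> k kr; have kr' : (1 <= k <= r)%N by lia.
    have [|ab Pa] := (loc_high k _ _ kr (neqS _) (fun n => range_high k n kr)).1.
      by apply: H => //; rewrite range_high // eqxx.
    have [||ba Pb] := (loc_high k _ _ kr _ (fun n => rngS k n kr)).1.
    + by rewrite eq_sym.
    + by apply: H => //; rewrite range_high // eqxx orbT.
    + by rewrite -bE // in ab Pa Pb *.
  - have [] := loc_r.1 _; last by move=> H1 H2 H3 H4; split; rewrite ?br.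
    by apply: H; [rewrite r1 leqnn | rewrite range_r].
  - have [] // := loc_r.1 _.
    by apply: H; [rewrite r1 leqnn | rewrite range_r].
move=> k /andP[k1 kr] m; have [kd|dk] := ltnP k d.
  case: k k1 kd {kr} => // k _ kh; rewrite range_low // => /eqP ->.
  exact: (loc_low k kh).2 (Hlow k.+1 kh).
move: kr; rewrite leq_eqVlt => /orP[/eqP ->|kr].
  rewrite range_r => /eqP ->; apply: loc_r.2.
  by case: Hr1 => _ H2 H3 H4; split.
have kr' : (d <= k < r)%N by rewrite dk.
have [ab Pa Pb] := Hhigh k kr'; rewrite bE // in ab Pa Pb.
rewrite range_high // => /orP[/eqP ->|/eqP ->].
  by apply: (loc_high k _ _ kr' (neqS _) (fun n => range_high k n kr')).2.
apply: (loc_high k _ (off k) kr' _ (fun n => rngS k n kr')).2; first by rewrite eq_sym.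
by rewrite eq_sym.
Qed.

Lemma y_poly_double (t : 'I_(sumn ls) -> C) k (T := root_seq 0 t) : (1 <= k <= r)%N ->
  y_poly t k = if (d <= k < r)%N
    then ('X - (first_root T k)%:P) * ('X - (second_root T k)%:P)
    else 'X - (if k == r then first_root T r else point_seq T k)%:P.
Proof.
move=> /andP[k1 kr].
rewrite /y_poly (@big_color ls _ 0 t _ _ _ k (fun _ x => 'X - x%:P)) //.
rewrite /first_root /second_root.
have [->|kr'] := eqVneq k r.
  by rewrite ltnn andbF offset_last big_nat1.
have klt : (k < r)%N by rewrite ltn_neqAle kr'.
rewrite klt andbT; case: ltnP => dk.
  rewrite !offset_high ?(leqW dk) ?dk // ?klt ?kr //.
  rewrite (_ : h + 2 * (k.+1 - d) = (h + 2 * (k - d)).+2)%N; last by lia.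
  by rewrite big_nat_recl // big_nat1.
case: k k1 dk {kr kr' klt} => // k _ kh.
by rewrite !offset_low ?(ltnW kh) // big_nat1.
Qed.

End DoubleTuple.

(** * Matching the closed forms of the statement *)

Section ClosedForms.
Variable K : numFieldType.
Implicit Types (L f w : nat -> K).

Lemma chain_gt0 L f w m : ((0 < m)%N -> 0 < f m) ->
  (forall i, (1 <= i < m)%N -> f i = L i + w i * (f i.+1 + 1)) ->
  (forall i, (1 <= i < m)%N -> 0 <= L i) -> (forall i, 0 < w i) ->
  forall i, (1 <= i <= m)%N -> 0 < f i.
Proof.
move=> fm fS L0 w0 i /andP[i1 im].
suff main k j : (j + k = m)%N -> (1 <= j)%N -> 0 < f j.
  by apply: (main (m - i)%N) => //; rewrite subnKC.
elim: k j => [|k IHk] j jk j1.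
  by rewrite addn0 in jk; rewrite jk; apply: fm; rewrite -jk.
have jm : (1 <= j < m)%N by rewrite j1 -jk addnS ltnS leq_addr.
rewrite fS // ltr_wpDl ?L0 // mulr_gt0 // addr_gt0 //.
by apply: IHk; rewrite // addSnnS.
Qed.

Variables (r : nat) (L : nat -> K) (n : nat -> nat).
Hypothesis r3 : (3 <= r)%N.
Hypothesis LE : forall i, (1 <= i <= r)%N -> L i = (n i)%:R.

Let L0 i : (1 <= i <= r)%N -> 0 <= L i.
Proof. by move=> ir; rewrite LE. Qed.

(** The numbers e in the fractions e/(e+1) are the effective labels [f]: the label of the color plus
    the contribution of the next color, and for the last color its label alone. *)
Lemma single_closed_form l : (l <= r)%N -> ((0 < l)%N -> (0 < n l)%N) ->
  exists f, [/\ (0 < l)%N -> f l = L l,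
    forall i, (1 <= i < l)%N ->
      f i = L i + (if i.+1 == r then 2%:R else 1) * (f i.+1 + 1),
    forall i, (1 <= i <= l)%N -> 0 < f i &
    forall i, (1 <= i <= l)%N ->
      chain f i = if (l < r)%N then c_small L l i else c_middle r L i].
Proof.
move=> lr nl.
have w0 i : 0 < (if i.+1 == r then 2%:R else 1 : K) by case: ifP; rewrite ?ltr0n.
have Ll0 : (0 < l)%N -> 0 < L l by move=> l0; rewrite LE ?l0 // ltr0n nl.
have L0l i : (1 <= i < l)%N -> 0 <= L i.
  by move=> /andP[i1 il]; rewrite L0 // i1 (leq_trans (ltnW il)).
have [llr|rl] := ltnP l r.
  pose f i := \sum_(i <= m < l.+1) L m + l%:R - i%:R : K.
  have fl : (0 < l)%N -> f l = L l by move=> _; rewrite /f big_nat1 addrK.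
  have fS i : (1 <= i < l)%N ->
      f i = L i + (if i.+1 == r then 2%:R else 1) * (f i.+1 + 1).
    move=> /andP[i1 il]; rewrite ltn_eqF ?(leq_trans _ llr) // mul1r /f big_ltn 1?leqW //.
    by rewrite -[i.+1]addn1 natrD; ring.
  exists f; split=> //; apply: chain_gt0 fS L0l w0 => l0.
  by rewrite fl // Ll0.
have {rl} lE : l = r by apply/eqP; rewrite eqn_leq lr.
rewrite lE in Ll0 L0l nl *.
have r0 : (0 < r)%N by rewrite (leq_trans _ r3).
pose g i := \sum_(i <= m < r) L m + 2%:R * L r + r%:R + 1 - i%:R : K.
(* The effective label of color [r] is [L r], whereas [g r] would be [2 L r + 1]; the factor 2 at
   color [r.-1] reconciles it with the formula below [r]. *)
pose f i := if i == r then L r else g i.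
have fl : (0 < r)%N -> f r = L r by rewrite /f eqxx.
have fS i : (1 <= i < r)%N ->
    f i = L i + (if i.+1 == r then 2%:R else 1) * (f i.+1 + 1).
  move=> /andP[i1 ir]; rewrite {1}/f ltn_eqF // /g big_ltn //.
  case: eqP => [E|E].
    by rewrite E fl // big_geq ?E // -[in r%:R]E -[i.+1]addn1 natrD; ring.
  rewrite mul1r /f; case: eqP => // _; rewrite /g -[i.+1]addn1 natrD; ring.
have f0 : forall i, (1 <= i <= r)%N -> 0 < f i.
  by apply: chain_gt0 fS L0l w0 => l0; rewrite fl // Ll0.
exists f; split=> // i /andP[i1 ir].
have short j : (j < r)%N -> chain f j = c_middle_short r L j.
  move=> jr; rewrite /chain /c_middle_short; apply: eq_big_nat => m /andP[m1 mj].
  rewrite /ratio /f ltn_eqF; last by rewrite (leq_trans _ jr).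
  by congr (_ / _); rewrite /g; ring.
rewrite /c_middle; case: eqP => [->|/eqP ir'].
  by rewrite -{1}(prednK r0) chainS (prednK r0) fl // short // ltn_predL.
by rewrite short // ltn_neqAle ir'.
Qed.

Section Double.
Variable l : nat.
Local Notation d := (2 * r - l)%N.
Hypothesis d1 : (1 <= d)%N.
Hypothesis dr : (d < r)%N.
Hypothesis nd : (0 < n d)%N.

Local Notation A := (rho_ r L l).
Local Notation p := (p_ r L l).

Let dl : (d + l = 2 * r)%N. Proof. by rewrite subnK // ltnW // -subn_gt0. Qed.

Let dl' : (2 * r)%:R = d%:R + l%:R :> K. Proof. by rewrite -natrD dl. Qed.

Lemma rho_d : A d = L d.
Proof. by rewrite /rho_ big_nat1 dl'; ring. Qed.

Lemma rho_S k : (d <= k < r)%N -> A k.+1 = A k + L k.+1 + 1.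
Proof.
move=> /andP[dk kr]; rewrite /rho_ [in LHS]big_nat_recr ?leqW //=.
by rewrite -[in k.+1%:R]addn1 natrD; ring.
Qed.

Lemma rho_gt0 k : (d <= k <= r)%N -> 0 < A k.
Proof.
elim: k => [|k IHk] /andP[dk kr]; first by move: d1; rewrite ltnNge dk.
move: dk; rewrite leq_eqVlt => /orP[/eqP <-|dk].
  by rewrite rho_d LE ?ltr0n ?nd ?d1 // ltnW.
rewrite ltnS in dk; rewrite rho_S ?dk // ltr_wpDl ?ltr01 // addr_ge0 ?L0 //.
by rewrite ltW // IHk // dk ltnW.
Qed.

Lemma rho_le k : (d <= k <= r)%N -> A k <= A r.
Proof.
move=> /andP[dk kr]; suff main m j : (j + m = r)%N -> (d <= j)%N -> A j <= A r.
  by apply: (main (r - k)%N) => //; rewrite subnKC.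
elim: m j => [|m IHm] j jm dj; first by rewrite addn0 in jm; rewrite jm.
have jr : (j < r)%N by rewrite -jm addnS ltnS leq_addr.
apply: le_trans (IHm j.+1 _ (leqW dj)); last by rewrite addSnnS.
by rewrite rho_S ?dj // -addrA lerDl addr_ge0 ?L0.
Qed.

Lemma M_E : M_ r L l = 2%:R * A r.
Proof.
by rewrite /M_ /rho_ [(2 * l)%:R]natrM [(2 * r)%:R]natrM; ring.
Qed.

Lemma q_E i : (d <= i <= r)%N -> q_ r L l i = 2%:R * A r - A i.
Proof.
move=> /andP[di ir]; rewrite /q_ /rho_ [\sum_(d <= m < r.+1) _](big_cat_nat (n := i.+1)) //=.
  by rewrite [(2 * r)%:R]natrM; ring.
exact: leqW.
Qed.

Lemma p_last : (1 < d)%N -> p d.-1 = L d.-1 + (2%:R * A r + 2%:R).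
Proof.
move=> d2; have e : d%:R = d.-1%:R + 1 :> K by rewrite natr1 prednK.
rewrite /p_ /rho_ [\sum_(d.-1 <= m < d) _]big_ltn ?ltn_predL // prednK //.
rewrite [\sum_(d <= m < d) _]big_geq // addr0.
apply: (linear_combination (k := 1) dl'); rewrite natrM e; ring.
Qed.

Lemma p_S i : (1 <= i < d.-1)%N -> p i = L i + (p i.+1 + 1).
Proof.
move=> /andP[i1 id]; rewrite /p_ [in LHS]big_ltn; last by rewrite (leq_trans id) ?leq_pred.
by rewrite -[in i.+1%:R]addn1 natrD; ring.
Qed.

Lemma p_gt0 i : (1 <= i < d)%N -> 0 < p i.
Proof.
move=> /andP[i1 id].
have w0 (j : nat) : 0 < 1 :> K by [].
apply: (@chain_gt0 L p (fun=> 1) d.-1) => //.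
- move=> d2; rewrite p_last; last by rewrite -(prednK d1) ltnS.
  rewrite ltr_wpDl ?L0 ?addr_gt0 ?mulr_gt0 ?ltr0n ?rho_gt0 ?leqnn ?andbT ?(ltnW dr) //.
  by rewrite d2 (leq_trans (leq_pred _)) // ltnW.
- by move=> j jd; rewrite mul1r p_S.
- move=> j /andP[j1 jd]; rewrite L0 // j1 ltnW // (leq_trans jd) //.
  by rewrite (leq_trans (leq_pred _)) // ltnW.
- by rewrite i1 -ltnS prednK.
Qed.

Local Notation Z := (Zc r d A p).

Lemma prod_P_E : \prod_(1 <= i < d) P_ r L l i = chain p d.-1.
Proof. by rewrite /chain prednK. Qed.

Lemma prod_Q_E a b : (d <= a)%N -> (b <= r.+1)%N ->
  \prod_(a <= i < b) Q_ r L l i = \prod_(a <= i < b) ratio (2%:R * A r - A i).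
Proof.
move=> da br; apply: eq_big_nat => i /andP[ai ib].
by rewrite /Q_ q_E // (leq_trans da ai) -ltnS (leq_trans ib).
Qed.

Lemma c_large_low j : (j < d)%N -> c_large r L l j = chain p j.
Proof. by move=> jd; rewrite /c_large ltn_eqF // (ltn_trans jd). Qed.

Lemma c_large_last : c_large r L l r = Z r.+1.
Proof. by rewrite /c_large eqxx prod_P_E prod_Q_E. Qed.

Lemma prod_E k : (d <= k < r)%N ->
  \prod_(k <= i < r.+1) Q_ r L l i * \prod_(k <= i < r.+1) R_ r L l i = Pic r A k.
Proof.
move=> /andP[dk kr]; rewrite prod_Q_E // /Pic -big_split /=.
by [].
Qed.

Lemma ab_prod_E k : (d <= k < r)%N -> ab_prod r L l k = Nc r d A p k.
Proof.
move=> /[dup] dkr /andP[dk kr]; rewrite /Nc /ab_prod -prod_E //.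
rewrite [\prod_(d <= i < r.+1) _](big_cat_nat (n := k)) //= ?leqW ?(ltnW kr) //.
rewrite prod_P_E /Zc -prod_Q_E //; last by rewrite leqW // ltnW.
ring.
Qed.

Lemma ab_sum_E k : (d <= k < r)%N -> ab_sum r L l k = Sc r d A p k.
Proof.
move=> /[dup] dkr /andP[dk kr]; rewrite /Sc /ab_sum -prod_E // M_E prod_P_E.
rewrite /Zc -[\prod_(d <= i < k) ratio _]prod_Q_E //; last by rewrite leqW // ltnW.
have m1 : 2%:R * A r + 1 != 0.
  by rewrite gt_eqF // addr_gt0 // mulr_gt0 ?ltr0n // rho_gt0 // leqnn (ltnW dr).
field; exact: m1.
Qed.

End Double.
End ClosedForms.

(** * Existence, uniqueness and the explicit tuples *)

Section Main.
Variables (C : numClosedFieldType) (r : nat) (lam : 'rV[C]_r) (n : nat -> nat).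
Hypothesis r3 : (3 <= r)%N.
Hypothesis lamE : forall i, (1 <= i <= r)%N -> label lam i = (n i)%:R.

Local Notation L := (label lam).
Local Notation Lam := [tuple lam; omega 1].
Local Notation z := [tuple 0; 1].
Local Notation claim ls :=
  ((~ admissible lam ls -> forall t, ~ bethe_solution Lam z (ls := ls) t) /\
   (admissible lam ls -> exists t, [/\ bethe_solution Lam z (ls := ls) t,
      forall t', bethe_solution Lam z (ls := ls) t' -> same_up_to_perm t t' &
      is_y_tuple r L (sumn ls) (y_poly t)])).

Let r0 : (0 < r)%N. Proof. exact: leq_trans r3. Qed.

Lemma single_claim (ls : r.-tuple nat) l : (l <= r)%N ->
  ls = nseq l 1%N ++ nseq (r - l) 0%N :> seq nat -> claim ls.
Proof.
move=> lr lsE.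
have adm : admissible lam ls <-> ((0 < l)%N -> (0 < n l)%N).
  (* For [l = r] the weight drops by [eps r]; for [l < r] it gains [eps l.+1]. *)
  move: lr lsE; rewrite leq_eqVlt => /orP[/eqP -> |llr] ->.
    rewrite subnn cats0; apply: iff_trans (admissible_sub r0 lamE _ (shift_all C r0)) _.
      by rewrite r0 leqnn.
    by rewrite r0; split=> [//|]; apply.
  by apply: (admissible_add r0 lamE llr); apply: shift_single.
have sE := sumn_single lr lsE.
have betheE t : bethe_solution Lam z (ls := ls) t <->
    single_bethe r l L (point_seq (root_seq 0 t)).
  apply: iff_trans (bethe_solutionE lam r3 t) _.
  exact (local_bethe_single lam lr lsE _).
split=> [nadm t /betheE|/adm nl].
  have [l0 nl] : (0 < l)%N /\ n l = 0%N.
    case: (posnP l) => [l0|l0]; first by case: nadm; apply/adm; rewrite l0.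
    split=> //; apply/eqP; rewrite -leqn0 leqNgt; apply/negP => nl.
    by case: nadm; apply/adm.
  by apply: single_bethe_obstruction; rewrite // lamE ?l0 // nl.
have [f [fl fS f0 fc]] := single_closed_form r3 lamE lr nl.
pose t (j : 'I_(sumn ls)) := chain f j.+1.
have tE i : (i <= l)%N -> chain f i = point_seq (root_seq 0 t) i.
  case: i => [|i] il; first by rewrite chain0.
  have il' : (i < sumn ls)%N by rewrite sE.
  exact: esym (root_seqE 0 t (Ordinal il')).
have uniqE t' : bethe_solution Lam z (ls := ls) t' ->
    forall i, (i <= l)%N -> point_seq (root_seq 0 t') i = chain f i.
  by move=> /betheE; apply: single_bethe_unique fl fS f0 _ _.
have yE (u : 'I_(sumn ls) -> C) k : y_poly u k.+1 =
    if (k < l)%N then 'X - (point_seq (root_seq 0 u) k.+1)%:P else 1.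
  exact (y_poly_single lsE u k).
exists t; split.
- by apply/betheE; apply: (single_bethe_ext tE); apply: single_bethe_chain.
- move=> t' /uniqE t'E; apply: same_up_to_perm_y_poly => -[|k] // _.
  by rewrite !yE; case: ltnP => // kl; rewrite t'E // -tE.
- rewrite /is_y_tuple sE.
  have yc i : (1 <= i <= l)%N ->
      y_poly t i = 'X - (if (l < r)%N then c_small L l i else c_middle r L i)%:P.
    case: i => // i il; have il' : (i < l)%N := il.
    by rewrite yE il' -tE // fc.
  case: ltnP yc => [llr|rl] yc.
    move=> [|i] // ir; case: (leqP i.+1 l) => il; first exact: yc.
    by rewrite yE ltnNge -ltnS il.
  have lE : l = r by apply/eqP; rewrite eqn_leq lr.
  by rewrite lE eqxx => i ir; rewrite yc // lE.
Qed.

Lemma double_claim (ls : r.-tuple nat) h : (h <= r - 2)%N ->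
  ls = nseq h 1%N ++ nseq (r - 1 - h) 2%N ++ [:: 1%N] :> seq nat -> claim ls.
Proof.
move=> hr lsE; have hr1 : (h < r.-1)%N by lia.
have adm : admissible lam ls <-> (0 < n h.+1)%N.
  rewrite lsE; apply: (admissible_sub r0 lamE); first by lia.
  exact: shift_double.
have sE := sumn_double r3 hr lsE.
have betheE t : bethe_solution Lam z (ls := ls) t <->
    double_bethe r h.+1 L (point_seq (root_seq 0 t)) (first_root ls (root_seq 0 t))
      (second_root ls (root_seq 0 t)).
  apply: iff_trans (bethe_solutionE lam r3 t) _.
  exact (local_bethe_double lam r3 hr lsE _).
have yE (t : 'I_(sumn ls) -> C) k : (1 <= k <= r)%N -> y_poly t k = if (h.+1 <= k < r)%N
    then ('X - (first_root ls (root_seq 0 t) k)%:P) * ('X - (second_root ls (root_seq 0 t) k)%:P)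
    else 'X - (if k == r then first_root ls (root_seq 0 t) r
               else point_seq (root_seq 0 t) k)%:P.
  exact (@y_poly_double _ _ _ _ r3 hr lsE t k).
split=> [nadm t /betheE|/adm nd].
  apply: double_bethe_obstruction; first by lia.
  rewrite lamE; last by lia.
  by case: (posnP (n h.+1)) => [->|] // nd; case: nadm; apply/adm.
have dE : h.+1 = (2 * r - sumn ls)%N by rewrite sE; lia.
have sr : (r < sumn ls)%N by rewrite sE; lia.
have d1 : (1 <= 2 * r - sumn ls)%N by rewrite -dE.
have dr : (2 * r - sumn ls < r)%N by lia.
rewrite dE in nd.
pose A := rho_ r L (sumn ls); pose p := p_ r L (sumn ls).
pose d := (2 * r - sumn ls)%N.
have Ad := rho_d L d1; have AS := @rho_S _ r L (sumn ls).
have A0 := @rho_gt0 _ _ _ _ lamE _ d1 dr nd; have ALe := @rho_le _ _ _ _ lamE (sumn ls).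
have pd := p_last L d1; have pS := @p_S _ r L (sumn ls).
have p0 := @p_gt0 _ _ _ _ lamE _ d1 dr nd.
(* The quadratic formula for sum [Sc] and product [Nc]; the choice of the square root only affects
   the order of the two roots. *)
pose ac k : C := (Sc r d A p k + sqrtC (Sc r d A p k ^+ 2 - 4%:R * Nc r d A p k)) / 2%:R.
pose bc k : C := (Sc r d A p k - sqrtC (Sc r d A p k ^+ 2 - 4%:R * Nc r d A p k)) / 2%:R.
have abc k : ac k + bc k = Sc r d A p k /\ ac k * bc k = Nc r d A p k.
  split; first by rewrite /ac /bc; field.
  have sq := sqrtCK (Sc r d A p k ^+ 2 - 4%:R * Nc r d A p k).
  apply: (linear_combination (k := - 4%:R^-1) sq); rewrite /ac /bc.
  by field.
(* Coordinates in the order of colors: [h] simple ones, then pairs alternating with the parity of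
   [m - h], and last the root of color [r]. *)
pose T m : C := if (m < h)%N then chain p m.+1
  else if m == (h + 2 * (r - h.+1))%N then Zc r d A p r.+1
  else if odd (m - h) then bc (h.+1 + (m - h)./2)%N else ac (h.+1 + (m - h)./2)%N.
pose t (j : 'I_(sumn ls)) := T j.
have tT m : (m < sumn ls)%N -> root_seq 0 t m = T m.
  by move=> ml; rewrite -[m]/(val (Ordinal ml)) root_seqE.
have offE k : (h.+1 <= k <= r)%N -> color_offset ls k = (h + 2 * (k - h.+1))%N.
  exact (@offset_high _ _ _ r3 hr lsE k).
have first_low k : (h.+1 <= k < r)%N -> first_root ls (root_seq 0 t) k = ac k.
  move=> /andP[dk kr]; rewrite /first_root offE ?dk ?(ltnW kr) // tT; last by rewrite sE; lia.
  rewrite /T ltnNge leq_addr /= ifF; last by apply/eqP; lia.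
  by rewrite addKn mul2n odd_double doubleK subnKC.
have second_low k : (h.+1 <= k < r)%N -> second_root ls (root_seq 0 t) k = bc k.
  move=> /andP[dk kr]; rewrite /second_root (ltn_eqF kr) offE ?dk ?(ltnW kr) // tT; last by rewrite sE; lia.
  rewrite /T -addnS ltnNge leq_addr /= ifF; last by apply/eqP; lia.
  by rewrite addKn mul2n /= odd_double /= uphalf_double subnKC.
have first_last : first_root ls (root_seq 0 t) r = Zc r d A p r.+1.
  rewrite /first_root offE ?leqnn ?andbT //; last by lia.
  rewrite tT; last by rewrite sE; lia.
  by rewrite /T ltnNge leq_addr /= eqxx.
have second_last (u : 'I_(sumn ls) -> C) : second_root ls (root_seq 0 u) r = first_root ls (root_seq 0 u) r.
  by rewrite /second_root eqxx.
have point_low i : (i < h.+1)%N -> point_seq (root_seq 0 t) i = chain p i.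
  case: i => [|i] ih; first by rewrite chain0.
  rewrite /= tT; last by rewrite sE; lia.
  by rewrite /T -ltnS ih.
have solt : bethe_solution Lam z (ls := ls) t.
  apply/betheE; rewrite dE.
  apply: (double_bethe_closed d1 dr Ad AS A0 ALe pd pS p0) => [i id| | |k kr].
  - by apply: point_low; rewrite dE.
  - exact: first_last.
  - exact: second_last.
  - by rewrite first_low ?second_low ?dE.
have uniqE t' : bethe_solution Lam z (ls := ls) t' ->
    [/\ forall i, (i < h.+1)%N -> point_seq (root_seq 0 t') i = chain p i,
        first_root ls (root_seq 0 t') r = Zc r d A p r.+1 &
        forall k, (h.+1 <= k < r)%N ->
          first_root ls (root_seq 0 t') k + second_root ls (root_seq 0 t') k = Sc r d A p k /\
          first_root ls (root_seq 0 t') k * second_root ls (root_seq 0 t') k = Nc r d A p k].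
  move=> /betheE; rewrite dE => sol.
  exact: (double_bethe_unique d1 dr Ad AS A0 ALe pd pS p0 sol).
exists t; split=> //.
- move=> t' /uniqE [T1 T2 T3]; have [S1 S2 S3] := uniqE t solt.
  apply: same_up_to_perm_y_poly => k; rewrite size_tuple => kr.
  rewrite !yE //; case: ifP => kd; last first.
    case: eqP => [_|/eqP kr']; first by rewrite T2 S2.
    rewrite T1 ?S1 //; lia.
  (* Uniqueness fixes only the symmetric functions of the two roots, so the quadratics are compared
     by coefficients. *)
  have prodE (a b : C) : ('X - a%:P) * ('X - b%:P) = 'X^2 - (a + b)%:P * 'X + (a * b)%:P.
    by rewrite polyCD polyCM; ring.
  by rewrite !prodE; have [-> ->] := T3 k kd; have [-> ->] := S3 k kd.
- rewrite /is_y_tuple ltnNge (ltnW sr) /= gtn_eqF // -/d.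
  exists (first_root ls (root_seq 0 t)), (second_root ls (root_seq 0 t)); split=> [k kr|i ir].
    have [_ _ S3] := uniqE t solt; rewrite ab_prod_E // (ab_sum_E lamE d1 dr nd kr).
    by have [-> ->] := S3 k (etrans (congr1 (fun x => x <= k < r)%N dE) kr).
  rewrite yE // dE -/d; case: ifP => // kd.
  case: eqP => [->|/eqP ir']; first by rewrite first_last c_large_last.
  rewrite point_low ?c_large_low //; lia.
Qed.

End Main.

Theorem theorem5p1 (R : realType) (r : nat) (hr : (3 <= r)%N)
    (lam : 'rV[R[i]]_r) (hlam : dominant_integral lam) (ls : r.-tuple nat)
    (hls : (exists2 k1 : nat, (k1 <= r)%N &
              tval ls = nseq k1 1%N ++ nseq (r - k1) 0%N) \/
           (exists2 k2 : nat, (k2 <= r - 2)%N &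
              tval ls = nseq k2 1%N ++ nseq (r - 1 - k2) 2%N ++ [:: 1%N])) :
  let Lam := [tuple lam; omega 1] in
  let z := [tuple 0; 1] in
  (~ admissible lam ls -> forall t, ~ bethe_solution Lam z (ls := ls) t) /\
  (admissible lam ls ->
     exists t, [/\ bethe_solution Lam z (ls := ls) t,
                   forall t', bethe_solution Lam z (ls := ls) t' ->
                     same_up_to_perm t t' &
                   is_y_tuple r (label lam) (sumn ls) (y_poly t)]).
Proof.
move=> Lam z.
have [n lamE] : exists n : nat -> nat,
    forall i, (1 <= i <= r)%N -> label lam i = (n i)%:R.
  have [i|n nE] := @boolp.choice _ _ (fun i m => (1 <= i <= r)%N -> label lam i = m%:R).
    case: (boolP (1 <= i <= r)%N) => [/hlam [m mE]|_]; first by exists m.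
    by exists 0%N.
  by exists n.
case: hls => [[k1 k1r lsE]|[k2 k2r lsE]].
  exact: (single_claim hr lamE k1r lsE).
exact: (double_claim hr lamE k2r lsE).
Qed.
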